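(* For the curved quadratic tetrahedral template described in the context, the vector $z$ belongs to the linearized four-point volume kernel $\ker Dg^Q(X)$ and lies outside the tangent cone at $X$ of the feasible set $\{y: g^Q(y)=0\}$ defined by all 48 nonlinear four-point volume constraints. Along $y(t)=X+tz$, the Jacobian $Dg^Q(y(t))$ has rank 48 for all sufficiently small nonzero $t$, and its smallest singular value is $\Theta(|t|)$ as $t\to0$. The Jacobian of the exact-volume map $g^I$ has constant rank $47$ in a neighborhood of $X$; its local feasible set $\{y:g^I(y)=0\}$ near $X$ is a smooth manifold of dimension $34$. Every vector in $\ker B$, where $B=Dg^Q(X)$, including $z$, is tangent at $X$ to a smooth curve in that exact-volume feasible set.
   Context: Parent cell and rule: $\widehat T=\{\xi\in\mathbb R^3:\xi_i\ge0,\ \xi_1+\xi_2+\xi_3\le1\}$ with barycentric coordinates $\lambda_0=1-\xi_1-\xi_2-\xi_3$, $\lambda_i=\xi_i$. Quadratic (Tet10) Lagrange basis: $\lambda_i(2\lambda_i-1)$ at the four vertices, $4\lambda_i\lambda_j$ at the six edge midpoints. $Q_4[f]=\frac1{24}\sum_{q=1}^4f(\xi_q)$, where the points have barycentric coordinates the four permutations of $(\alpha,\beta,\beta,\beta)$, $\alpha=\frac{5+3\sqrt5}{20}$, $\beta=\frac{5-\sqrt5}{20}$. Template: divide $[0,1]^3$ into $2^3$ equal subcubes and each subcube, with lower corner $b$, into six Freudenthal tetrahedra: for each permutation $(i,j,k)$ of $(1,2,3)$ take vertices $b$, $b+e_i/2$, $b+(e_i+e_j)/2$, $b+(e_1+e_2+e_3)/2$,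 oriented positively. Add all edge midpoints as nodes. This gives 48 cells and 125 nodes (the points of $\{0,\frac14,\frac12,\frac34,1\}^3$). Each node with uncurved coordinate $s$ is placed at $X(s)=s+e_3\prod_{i=1}^3s_i(1-s_i)$, and positions are interpolated quadratically in each tetrahedron; $X$ denotes this reference configuration. Configurations $y$ are continuous piecewise quadratic (in parent coordinates) with outer-boundary nodal values equal to those of $X$, leaving 81 free nodal coordinates. Volumes: for a configuration $y$ with cell maps $y_e:\widehat T\to\mathbb R^3$ and $J_{y,e}=D_\xi y_e$, $V_e^Q(y)=Q_4[\det J_{y,e}]$, $V_e^I(y)=\int_{\widehat T}\det J_{y,e}\,d\xi$, $g_e^r(y)=V_e^r(y)-V_e^r(X)$, $g^r=(g_e^r)_e\in\mathbb R^{48}$, $r\in\{Q,I\}$. Derivatives are with respect to the 81 free nodal coordinates. The tangent cone at $X$ of a feasible set consists of all limits $\lim_j(y_j-X)/t_j$ with $y_j$ feasible and $t_j\downarrow0$. Witness: $z\in\mathbb R^{81}$ has nodal values $z(\frac12,\frac14,\frac14)=(0,-2,-\frac{527}{256})$, $z(\frac34,\frac14,\frac14)=(-1,-1,-1)$, $z(\frac34,\frac12,\frac14)=(\frac23,0,\frac{2533}{3840})$ (indexed by uncurved node), and zero at all other nodes. *)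

(* Defs.v *)
From HB Require Import structures.
From mathcomp Require Import all_boot all_order all_algebra.
From mathcomp Require Import all_classical all_reals all_analysis.

Set Implicit Arguments.
Unset Strict Implicit.
Unset Printing Implicit Defensive.

Import Order.TTheory GRing.Theory Num.Theory.
Import numFieldNormedType.Exports.

Local Open Scope classical_set_scope.
Local Open Scope ring_scope.

(* Nodes are lists of three naturals in {0,..,4}: the node p has uncurved
   coordinate s = p / 4.  Cells are numbered 0..47: cell e lies in the subcube
   number e %/ 6 (whose corner is read off in binary) and belongs to the
   permutation number e %% 6, the three even permutations coming first. *)
Section Mesh.
Local Open Scope nat_scope.

Definition subcube_corner (e : nat) : seq nat :=
  [seq 2 * (((e %/ 6) %/ 2 ^ c) %% 2) | c <- iota 0 3].

Definition cell_axes (e : nat) : seq nat :=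
  nth [::] [:: [:: 0; 1; 2]; [:: 1; 2; 0]; [:: 2; 0; 1];
               [:: 0; 2; 1]; [:: 1; 0; 2]; [:: 2; 1; 0]] (e %% 6).

Definition path_vertex (e m : nat) : seq nat :=
  [seq nth 0 (subcube_corner e) c + 2 * (c \in take m (cell_axes e))
     | c <- iota 0 3].

(* For an odd permutation the last two vertices are exchanged, so that all
   cells are positively oriented. *)
Definition cell_vertex (e a : nat) : seq nat :=
  path_vertex e
    (nth 0 (if e %% 6 < 3 then [:: 0; 1; 2; 3] else [:: 0; 1; 3; 2]) a).

(* Vertices have even coordinates, so the halving is exact. *)
Definition edge_node (e a b : nat) : seq nat :=
  [seq (nth 0 (cell_vertex e a) c + nth 0 (cell_vertex e b) c) %/ 2
     | c <- iota 0 3].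

Definition interior_node (p : seq nat) : bool := all (fun k => 0 < k < 4) p.

(* The free degrees of freedom: the 27 interior nodes in lexicographic order,
   three coordinates each. *)
Definition free_index (p : seq nat) (c : nat) : 'I_81 :=
  inord (3 * (9 * (nth 0 p 0).-1 + 3 * (nth 0 p 1).-1 + (nth 0 p 2).-1) + c).

Definition free_node (i : 'I_81) : seq nat :=
  [:: (i %/ 27).+1; ((i %/ 9) %% 3).+1; ((i %/ 3) %% 3).+1].

Definition free_axis (i : 'I_81) : 'I_3 := inord (i %% 3).

Lemma free_indexK (i : 'I_81) : free_index (free_node i) (free_axis i) = i.
Proof.
apply: val_inj; case: i => i Hi /=.
rewrite /free_axis /= !inordK ?ltn_mod //; last first.
  by do 81 (case: i Hi => [//|i Hi]).
by do 81 (case: i Hi => [//|i Hi]).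
Qed.

Definition cell_nodes (e : nat) : seq (seq nat) :=
  [seq cell_vertex e a | a <- iota 0 4] ++
  [seq edge_node e a b | a <- iota 0 4, b <- iota a.+1 (3 - a)].

Lemma mesh_nodes :
  perm_eq (undup (flatten [seq cell_nodes e | e <- iota 0 48]))
    [seq x :: q | x <- iota 0 5, q <- [seq [:: y; z] | y <- iota 0 5, z <- iota 0 5]].
Proof. by vm_compute. Qed.

End Mesh.

Section Template.
Context {R : realType}.

Implicit Types (y : 'rV[R]_81) (xi : 'rV[R]_3) (p : seq nat) (e : nat).

Definition ref_position p : 'rV[R]_3 :=
  let s (i : 'I_3) : R := (nth 0%N p i)%:R / 4 in
  \row_(c < 3) (s c + (c == ord_max)%:R * \prod_(i < 3) (s i * (1 - s i))).

Definition ref_config : 'rV[R]_81 :=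
  \row_i ref_position (free_node i) 0 (free_axis i).

Definition nodal_value y p : 'rV[R]_3 :=
  if interior_node p then \row_(c < 3) y 0 (free_index p c)
  else ref_position p.

Definition bary xi (a : 'I_4) : R :=
  if unlift ord0 a is Some i then xi 0 i else 1 - \sum_(i < 3) xi 0 i.

Definition cell_map y e xi : 'rV[R]_3 :=
  \sum_(a < 4) (bary xi a * (2 * bary xi a - 1)) *: nodal_value y (cell_vertex e a)
  + \sum_(a < 4) \sum_(b < 4 | (a < b)%N)
      (4 * bary xi a * bary xi b) *: nodal_value y (edge_node e a b).

(* 'J is the transpose of the usual Jacobian matrix (row-vector convention);
   its determinant is the same. *)
Definition det_jac y e xi : R := \det ('J (cell_map y e) xi).

Definition quad_alpha : R := (5 + 3 * Num.sqrt 5) / 20.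
Definition quad_beta : R := (5 - Num.sqrt 5) / 20.

(* The point whose q-th barycentric coordinate is alpha, the others being
   beta. *)
Definition quad_point (q : 'I_4) : 'rV[R]_3 :=
  \row_(i < 3) (if lift ord0 i == q then quad_alpha else quad_beta).

Definition Q4 (f : 'rV[R]_3 -> R) : R := 24^-1 * \sum_(q < 4) f (quad_point q).

Definition parent_cell : set (R * R * R) :=
  [set x | [/\ 0 <= x.1.1, 0 <= x.1.2, 0 <= x.2 & x.1.1 + x.1.2 + x.2 <= 1]].

Definition point3 (x : R * R * R) : 'rV[R]_3 :=
  \row_(i < 3) [:: x.1.1; x.1.2; x.2]`_i.

Definition lebesgue3 :=
  ((@lebesgue_measure R \x @lebesgue_measure R) \x @lebesgue_measure R)%E.

Definition volQ y e : R := Q4 (det_jac y e).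

Definition volI y e : R :=
  \int[lebesgue3]_(x in parent_cell) det_jac y e (point3 x).

Definition gQ y : 'rV[R]_48 := \row_(e < 48) (volQ y e - volQ ref_config e).
Definition gI y : 'rV[R]_48 := \row_(e < 48) (volI y e - volI ref_config e).

Definition witness_value p : seq R :=
  if p == [:: 2; 1; 1]%N then [:: 0; - 2; - (527 / 256)]
  else if p == [:: 3; 1; 1]%N then [:: - 1; - 1; - 1]
  else if p == [:: 3; 2; 1]%N then [:: 2 / 3; 0; 2533 / 3840]
  else [:: 0; 0; 0].

Definition witness : 'rV[R]_81 :=
  \row_i (witness_value (free_node i))`_(free_axis i).

End Template.

Section Notions.
Context {R : realType}.

Definition tangent_cone (V : normedModType R) (S : set V) (x : V) : set V :=
  [set v | exists (u : nat -> V) (t : nat -> R),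
     [/\ forall j, S (u j), forall j, 0 < t j, t @ \oo --> (0 : R) &
         (fun j => (t j)^-1 *: (u j - x)) @ \oo --> v]].

Definition singular_values m n (A : 'M[R]_(m, n)) : set R :=
  [set s | 0 <= s /\
     (if (m <= n)%N then eigenvalue (A *m A^T) (s ^+ 2)
      else eigenvalue (A^T *m A) (s ^+ 2))].

(* The set is finite and, for m, n > 0, nonempty: inf is a minimum. *)
Definition smallest_singular_value m n (A : 'M[R]_(m, n)) : R :=
  inf (singular_values A).

(* On an open subset U of a finite-dimensional space, f is C^k iff all its
   iterated directional derivatives of order <= k exist and are continuous. *)
Fixpoint Ck_on (V W : normedModType R) (k : nat) (U : set V) (f : V -> W) : Prop :=
  (forall x, U x -> {for x, continuous f}) /\
  (if k is k'.+1 then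
     forall v, (forall x, U x -> derivable f x v) /\ Ck_on k' U ('D_v f)
   else True).

Definition smooth_on (V W : normedModType R) (U : set V) (f : V -> W) : Prop :=
  forall k, Ck_on k U f.

Definition smooth_diffeo (V W : normedModType R) (U : set V) (U' : set W)
    (f : V -> W) (h : W -> V) : Prop :=
  [/\ open U /\ open U', smooth_on U f /\ smooth_on U' h,
      (forall x, U x -> U' (f x) /\ h (f x) = x) &
      (forall x, U' x -> U (h x) /\ f (h x) = x)].

(* Embedded d-dimensional C^infinity submanifolds of R^n, by slice charts. *)
Definition smooth_submanifold n (d : nat) (M : set 'rV[R]_n) : Prop :=
  (d <= n)%N /\
  forall p, M p -> exists U U' (f h : 'rV[R]_n -> 'rV[R]_n),
    [/\ U p, smooth_diffeo U U' f h &
        forall x, U x -> (M x <-> forall i : 'I_n, (d <= i)%N -> f x 0 i = 0)].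

Definition tangent_to_smooth_curve n (S : set 'rV[R]_n) (x v : 'rV[R]_n) : Prop :=
  exists (eps : R) (gamma : R -> 'rV[R]_n),
    [/\ 0 < eps, smooth_on `]- eps, eps[%classic gamma, gamma 0 = x,
        is_derive (0 : R) (1 : R) gamma v &
        forall t, `|t| < eps -> S (gamma t)].

End Notions.

(* Main.v *)
Require Import Defs.
From Stdlib Require Import ZArith.
From HB Require Import structures.
From mathcomp Require Import all_boot all_order all_algebra.
From mathcomp Require Import all_classical all_reals all_analysis.
From mathcomp Require Import measurable_realfun ssrZ zify ring lra.
Set Implicit Arguments.
Unset Strict Implicit.
Unset Printing Implicit Defensive.
Import Order.TTheory GRing.Theory Num.Theory.
Import numFieldNormedType.Exports.
Local Open Scope classical_set_scope.
Local Open Scope ring_scope.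

(** In a quadratic cell the rows of the Jacobian are affine in the barycentric
    coordinates, so that its determinant is a combination of the monomials
    lambda_a lambda_b lambda_c whose coefficients are cubic in the nodal values.
    The integral of such a monomial over the cell and its four-point sum depend
    only on the coincidences among a, b and c, and comparing them gives
      volI y e = E_e y / 720   and
      volQ y e = E_e y / 720 + (3 sqrt 5 - 5) / 14400 * D_e y
    for two cubic forms E_e (exact_form) and D_e (defect_form) with integer
    coefficients in the ten nodal values of the cell (volI_form, volQ_form).
    The theorem follows from two opposite properties of these forms.

    The sum of all the E_e is constant, because the contributions of the inner
    faces cancel (total_exact_form).  Hence the columns of the Jacobian of gI
    always add up to zero and its rank is at most 47.  At X it is 47
    (rank_jacobian_ref): the Jacobian is a multiple of an integer matrix, 47
    columns of which have a left inverse modulo 7.  The rank is therefore 47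
    near X, the zero set of gI is there a manifold of dimension 81 - 47 = 34,
    and every vector of the kernel is the velocity of a curve in it
    (level_set_chart, level_set_tangent).

    The defects D_e are stationary at X (defect_stationary).  There only the
    third component of the configuration is not affine on a cell, so that the
    first variation of the determinant is a polynomial of degree at most two,
    which the four-point rule integrates exactly.  Thus gQ and gI have the same
    Jacobian B at X, which gives the claims on the kernel of B.  Moreover the
    total of gQ (X + h) is a multiple of S2 h + S3 h with S2 quadratic and S3
    cubic, and S2 z does not vanish (witness_second_order).  Feasible points
    X + t v with t -> 0 and v -> z would satisfy S2 v + t * S3 v = 0, whence
    S2 z = 0: the witness is not in the tangent cone (witness_not_tangent).

    Finally, the Jacobian of gQ along X + t z is a pencil B + t B1 + t^2 B2,
    where z B = 0 and B 1 = 0 but z B1 1 is a nonzero multiple of S2 z.  Since 1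
    spans the kernel of B, these data give an explicit left inverse of the
    pencil of size 1 / |t|; it bounds the singular values from below by a
    multiple of |t|, while the vector 1 shows that one of them is at most a
    multiple of |t| (pencil_lower_bound, pencil_upper_bound).

    The statements on the mesh itself (the cancellation on inner faces, z B = 0,
    the stationarity of the defects, S2 z <> 0 and the left inverse modulo 7)
    are evaluations of trilinear forms with integer coefficients at integer
    nodal values, obtained after clearing denominators. *)

(** * Rings of functions and smoothness *)

Section RingClosure.
Context {R : realType} {V : normedModType R}.
Implicit Types (S : (V -> R) -> Prop) (f g : V -> R).

Inductive ring_closure S : (V -> R) -> Prop :=
| ring_closure_gen f : S f -> ring_closure S f
| ring_closure_cst c : ring_closure S (fun=> c)
| ring_closureD f g :
    ring_closure S f -> ring_closure S g -> ring_closure S (f \+ g)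
| ring_closureM f g :
    ring_closure S f -> ring_closure S g -> ring_closure S (f \* g).

Lemma ring_closure_sum S (I : Type) (r : seq I) (P : pred I) (F : I -> V -> R) :
  (forall i, P i -> ring_closure S (F i)) ->
  ring_closure S (fun x => \sum_(i <- r | P i) F i x).
Proof.
move=> SF; elim: r => [|i r IH].
  rewrite (_ : (fun _ => _) = fun=> 0); first exact: ring_closure_cst.
  by apply/funext => x; rewrite big_nil.
have [Pi|Pi] := boolP (P i); last first.
  by congr ring_closure: IH; apply/funext => x; rewrite big_cons (negbTE Pi).
rewrite (_ : (fun _ => _) = F i \+ (fun x => \sum_(j <- r | P j) F j x)).
  exact: (ring_closureD (SF i Pi) IH).
by apply/funext => x; rewrite big_cons Pi.
Qed.

Lemma ring_closure_prod S (I : Type) (r : seq I) (P : pred I) (F : I -> V -> R) :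
  (forall i, P i -> ring_closure S (F i)) ->
  ring_closure S (fun x => \prod_(i <- r | P i) F i x).
Proof.
move=> SF; elim: r => [|i r IH].
  rewrite (_ : (fun _ => _) = fun=> 1); first exact: ring_closure_cst.
  by apply/funext => x; rewrite big_nil.
have [Pi|Pi] := boolP (P i); last first.
  by congr ring_closure: IH; apply/funext => x; rewrite big_cons (negbTE Pi).
rewrite (_ : (fun _ => _) = F i \* (fun x => \prod_(j <- r | P j) F j x)).
  exact: (ring_closureM (SF i Pi) IH).
by apply/funext => x; rewrite big_cons Pi.
Qed.

Lemma ring_closureZ S c f : ring_closure S f -> ring_closure S (fun x => c * f x).
Proof. by move=> Sf; apply: ring_closureM Sf; exact: ring_closure_cst. Qed.

Lemma ring_closureB S f g :
  ring_closure S f -> ring_closure S g -> ring_closure S (fun x => f x - g x).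
Proof.
move=> Sf Sg; apply: (ring_closureD Sf).
have := ring_closureZ (-1) Sg; congr ring_closure.
by apply/funext => x; rewrite mulN1r.
Qed.

Lemma ring_closure_det S n (A : V -> 'M[R]_n) :
  (forall i j, ring_closure S (fun x => A x i j)) ->
  ring_closure S (fun x => \det (A x)).
Proof.
move=> SA; apply: ring_closure_sum => s _; apply: ring_closureZ.
exact: ring_closure_prod.
Qed.

Lemma ring_closure_continuous S (x : V) f :
  (forall g, S g -> {for x, continuous g}) ->
  ring_closure S f -> {for x, continuous f}.
Proof.
move=> Sc; elim=> {f} [f Sf|c|f g _ cf _ cg|f g _ cf _ cg].
- exact: Sc.
- exact: cst_continuous.
- exact: continuousD.
- exact: (@continuousM R V f g x).
Qed.

(** By the Leibniz rule, differentiation stays in a ring of functions as soon as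
    it does so on generators.  A second family T is allowed because the
    derivative of a generator may need generators outside S. *)
Lemma ring_closure_derive S T (U : set V) v f :
  (forall g, S g -> ring_closure T g) ->
  (forall g, S g -> exists2 g', ring_closure T g' &
     forall x, U x -> is_derive x v g (g' x)) ->
  ring_closure S f ->
  ring_closure T f /\
  exists2 f', ring_closure T f' & forall x, U x -> is_derive x v f (f' x).
Proof.
move=> ST Sd; elim=> {f} [f Sf|c|f g _ [Tf [f' Tf' df]] _ [Tg [g' Tg' dg]]
  |f g _ [Tf [f' Tf' df]] _ [Tg [g' Tg' dg]]].
- by split; [exact: ST|exact: Sd].
- split; first exact: ring_closure_cst.
  by exists (fun=> 0) => [|x _]; [exact: ring_closure_cst|exact: is_derive_cst].
- split; first exact: ring_closureD.
  exists (f' \+ g'); first exact: ring_closureD.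
  by move=> x Ux; have := df x Ux; have := dg x Ux; move=> ? ?; exact: is_deriveD.
- split; first exact: ring_closureM.
  exists ((f \* g') \+ (g \* f')).
    by apply: ring_closureD; exact: ring_closureM.
  by move=> x Ux; have := df x Ux; have := dg x Ux; move=> ? ?; exact: is_deriveM.
Qed.

End RingClosure.

Lemma ring_closure_comp (R : realType) (V W : normedModType R)
    (S : (V -> R) -> Prop) (T : (W -> R) -> Prop) (h : V -> W) (f : W -> R) :
  (forall g, T g -> ring_closure S (g \o h)) ->
  ring_closure T f -> ring_closure S (f \o h).
Proof.
move=> TS; elim=> {f} [f Tf|c|f g _ Sf _ Sg|f g _ Sf _ Sg].
- exact: TS.
- exact: (ring_closure_cst S c).
- exact: (ring_closureD Sf Sg).
- exact: (ring_closureM Sf Sg).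
Qed.

Section RowVectors.
Context {R : realType}.

Lemma coord_le_norm m n (A : 'M[R]_(m, n)) i j : `|A i j| <= `|A|.
Proof.
rewrite [leRHS]/Num.Def.normr/= mx_normrE.
exact: (le_bigmax _ (fun k : 'I_m * 'I_n => `|A k.1 k.2|) (i, j)).
Qed.

Lemma mx_norm_le m n (A : 'M[R]_(m, n)) e :
  0 <= e -> (forall i j, `|A i j| <= e) -> `|A| <= e.
Proof.
move=> e0 Ae; rewrite [leLHS]/Num.Def.normr/= mx_normrE.
by apply: bigmax_le => //= -[i j] _; exact: Ae.
Qed.

Lemma mx_norm_mul m n p (A : 'M[R]_(m, n)) (B : 'M[R]_(n, p)) :
  `|A *m B| <= n%:R * `|A| * `|B|.
Proof.
apply: mx_norm_le => [|i j]; first by rewrite !mulr_ge0.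
rewrite mxE (le_trans (ler_norm_sum _ _ _))//.
rewrite -mulrA -[n in n%:R]card_ord -sumr_const mulr_suml ler_sum// => k _.
by rewrite mul1r normrM ler_pM// coord_le_norm.
Qed.

Lemma mx_cvg (T : Type) (F : set_system T) (FF : Filter F) m n
    (A : T -> 'M[R]_(m, n)) (B : 'M[R]_(m, n)) :
  (forall i j, A t i j @[t --> F] --> B i j) -> A @ F --> B.
Proof.
move=> AB; apply/cvgrPdist_le => e e0.
have : \forall t \near F, forall k : 'I_m * 'I_n, `|B k.1 k.2 - A t k.1 k.2| <= e.
  apply: filter_forall => k.
  by move/cvgrPdist_le : (AB k.1 k.2); exact.
apply: filterS => t Ht; apply: mx_norm_le => [|i j]; first exact: ltW.
by rewrite !mxE; exact: (Ht (i, j)).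
Qed.

Lemma mx_continuous (V : topologicalType) m n (A : V -> 'M[R]_(m, n)) x :
  (forall i j, {for x, continuous (fun y => A y i j)}) -> {for x, continuous A}.
Proof. by move=> Ac; apply: mx_cvg => i j; exact: Ac. Qed.

End RowVectors.

(** Iterated derivatives never leave a class of continuous functions that is
    stable under differentiation, whence C^k by induction on k. *)
Lemma smooth_on_class (R : realType) (V : normedModType R) n (U : set V)
    (S : (V -> R) -> Prop) (f : V -> 'rV[R]_n) : open U ->
  (forall g, S g -> forall x, U x -> {for x, continuous g}) ->
  (forall v g, S g -> exists2 g', S g' & forall x, U x -> is_derive x v g (g' x)) ->
  (forall j, exists2 g, S g & forall x, U x -> f x 0 j = g x) ->
  smooth_on U f.
Proof.
move=> oU Sc Sd + k; elim: k f => [|k IH] f fS.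
all: have nearU x : U x -> \forall y \near x, U y by move=> Ux; exact: open_nbhs_nbhs.
all: have cf x : U x -> {for x, continuous f}.
1,3: move=> Ux; apply: mx_continuous => i j; rewrite (ord1 i).
1,2: have [g Sg fg] := fS j.
1,2: rewrite /prop_for /continuous_at (fg x Ux).
1,2: apply: cvg_trans (Sc g Sg x Ux); apply: near_eq_cvg.
1,2: by near do apply/esym/fg; exact: nearU.
  by split.
split=> // v.
have dfj j : exists2 g, S g &
    forall x, U x -> is_derive x v (fun y => f y 0 j) (g x).
  have [g Sg fg] := fS j; have [g' Sg' gg'] := Sd v g Sg.
  exists g' => // x Ux; apply: near_eq_is_derive (gg' x Ux).
  by near do apply/esym/fg; exact: nearU.
have df x : U x -> derivable f x v.
  move=> Ux; apply/derivable_mxP => i j; rewrite (ord1 i).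
  by have [? _ /(_ x Ux)[]] := dfj j.
split=> //; apply: IH => j; have [g Sg fg] := dfj j; exists g => // x Ux.
rewrite derive_mx ?mxE; last exact: df.
by have [_ ->] := fg x Ux.
Unshelve. all: by end_near.
Qed.

Section PolynomialFunctions.
Context {R : realType} {n : nat}.
Implicit Types (f : 'rV[R]_n -> R) (x v : 'rV[R]_n).

Definition polynomial_fun : ('rV[R]_n -> R) -> Prop :=
  ring_closure (fun f => exists i, f = fun x => x 0 i).

Lemma polynomial_fun_coord i : polynomial_fun (fun x => x 0 i).
Proof. by apply: ring_closure_gen; exists i. Qed.

Lemma polynomial_fun_continuous f : polynomial_fun f -> continuous f.
Proof.
move=> pf x; apply: ring_closure_continuous pf => g [i ->].
exact: coord_continuous.
Qed.

Lemma polynomial_fun_differentiable f x : polynomial_fun f -> differentiable f x.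
Proof.
elim=> {f} [f [i ->]|c|f g _ df _ dg|f g _ df _ dg].
- exact: differentiable_coord.
- exact: differentiable_cst.
- exact: differentiableD.
- exact: (@differentiableM R _ f g x).
Qed.

Lemma polynomial_fun_derive f v : polynomial_fun f -> polynomial_fun ('D_v f).
Proof.
have coordd (g : 'rV[R]_n -> R) : (exists i, g = fun x => x 0 i) ->
    exists2 g', polynomial_fun g' &
      forall x, [set: 'rV[R]_n] x -> is_derive x v g (g' x).
  move=> [i ->]; exists (fun=> v 0 i); first exact: ring_closure_cst.
  move=> x _; have dx : differentiable (fun y : 'rV[R]_n => y 0 i) x.
    exact: differentiable_coord.
  have idx : derivable (@id 'rV[R]_n) x v by exact: derivable_id.
  have /derivable_mxP /(_ 0 i) did := idx.
  split => //; have := derive_mx idx.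
  by rewrite derive_id => /matrixP /(_ 0 i) ->; rewrite mxE.
move=> pf.
have [_ [g pg fg]] := ring_closure_derive (@ring_closure_gen _ _ _) coordd pf.
rewrite (_ : 'D_v f = g) //.
by apply/funext => x; have [] := fg x Logic.I.
Qed.

Lemma polynomial_map_smooth m (f : 'rV[R]_n -> 'rV[R]_m) (U : set 'rV[R]_n) :
  open U -> (forall j, polynomial_fun (fun x => f x 0 j)) -> smooth_on U f.
Proof.
move=> oU pf; apply: (@smooth_on_class _ _ _ _ polynomial_fun) => //.
- by move=> g pg x _; exact: polynomial_fun_continuous.
- move=> v g pg; exists ('D_v g); first exact: polynomial_fun_derive.
  by move=> x _; apply/derivableP/diff_derivable/polynomial_fun_differentiable.
- by move=> j; exists (fun x => f x 0 j).
Qed.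

Lemma differentiable_rVP m (f : 'rV[R]_n -> 'rV[R]_m) x :
  (forall j, differentiable (fun y => f y 0 j) x) -> differentiable f x.
Proof.
move=> df; rewrite (_ : f = fun y => \sum_j f y 0 j *: delta_mx 0 j); last first.
  by apply/funext => y; exact: row_sum_delta.
rewrite (_ : (fun _ => _) = \sum_j (fun y => f y 0 j *: (delta_mx 0 j : 'rV_m))).
  by apply: differentiable_sum => j; exact: differentiableZl.
by apply/funext => y; rewrite fct_sumE.
Qed.

Lemma jacobian_coord m (f : 'rV[R]_n -> 'rV[R]_m) x i j :
  differentiable f x -> 'J f x i j = 'D_(delta_mx 0 i) (fun y => f y 0 j) x.
Proof.
move=> df; have := deriveEjacobian (delta_mx 0 i) df.
rewrite -rowE derive_mx; last exact: diff_derivable.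
by move=> /matrixP /(_ 0 j); rewrite !mxE => <-.
Qed.

End PolynomialFunctions.

(** * The inverse function theorem *)

(* Joins the completeness of matrices to their norm, for the fixed point theorem. *)
HB.instance Definition _ (R : realType) (m n : nat) :=
  Uniform_isComplete.Build 'M[R]_(m, n) cauchy_cvg.

Lemma is_derive_line (R : realType) (V W : normedModType R) (f : V -> W) x u
    (t v : R) df :
  is_derive (x + t *: u) (v *: u) f df ->
  is_derive t v (fun s : R => f (x + s *: u)) df.
Proof.
move=> [fd <-].
have E : (fun h : R => h^-1 *: (f (x + (h *: v + t) *: u) - f (x + t *: u))) =
    (fun h => h^-1 *: ((f \o shift (x + t *: u)) (h *: (v *: u)) - f (x + t *: u))).
  apply/funext => h /=; congr (_ *: (f _ - _)).
  have -> : h *: v = h * v by [].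
  by rewrite scalerDl -scalerA addrCA.
split; first by rewrite /derivable /= E.
by rewrite /derive /= E.
Qed.

Section InverseFunction.
Context {R : realType}.

(** Mean value theorem on the segment from x' to x, coordinate by coordinate: on
    it the Jacobian is within e / (n + 1) of its value at p.  The division by
    n + 1 absorbs the factor n of mx_norm_mul. *)
Lemma C1_strictly_differentiable n m (f : 'rV[R]_n -> 'rV[R]_m) p :
  (forall x, differentiable f x) -> {for p, continuous (jacobian f)} ->
  forall e, 0 < e -> exists2 d, 0 < d & forall x x',
    `|x - p| < d -> `|x' - p| < d ->
    `|f x - f x' - (x - x') *m 'J f p| <= e * `|x - x'|.
Proof.
move=> df cJ e e0; have e'0 : 0 < e / n.+1%:R by rewrite divr_gt0.
move/cvgrPdist_le : cJ => /(_ _ e'0) /nbhs_normP[d /= d0 Jd].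
exists d => // x x' xd x'd; apply: mx_norm_le => [|i j].
  by rewrite mulr_ge0// ltW.
rewrite (ord1 i) {i}; pose u := x - x'.
have dg t : is_derive t (1 : R) (fun s : R => f (x' + s *: u) 0 j)
    ((u *m 'J f (x' + t *: u)) 0 j).
  apply: (is_derive_line (f := fun z => f z 0 j)); rewrite scale1r.
  have dfx : derivable f (x' + t *: u) u by exact/diff_derivable.
  split; first by move/derivable_mxP : dfx; exact.
  by rewrite -deriveEjacobian// derive_mx// mxE.
have [|c c01] := MVT_segment ler01 (fun t _ => dg t).
  apply: continuous_subspaceT => t; apply: differentiable_continuous.
  by apply/derivable1_diffP; have [] := dg t.
rewrite scale0r addr0 scale1r subr0 mulr1 subrKC => E.
have -> : (f x - f x' - u *m 'J f p) 0 j =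
    (u *m ('J f (x' + c *: u) - 'J f p)) 0 j.
    have aux (v v' w w' : 'rV[R]_m) : v 0 j - v' 0 j = w 0 j ->
      (v - v' - w') 0 j = (w - w') 0 j by move=> vw; rewrite !mxE vw.
    by rewrite mulmxBr; exact: aux.
apply: le_trans (coord_le_norm _ _ _) _; apply: le_trans (mx_norm_mul _ _) _.
have : `|'J f (x' + c *: u) - 'J f p| <= e / n.+1%:R.
  rewrite distrC; apply: Jd => /=.
  have -> : p - (x' + c *: u) = - ((1 - c) *: (x' - p) + c *: (x - p)).
    rewrite /u; apply/matrixP => i k; rewrite !mxE; ring.
  rewrite normrN; apply: le_lt_trans (ler_normD _ _) _; rewrite !normrZ.
  move: c01; rewrite in_itv /= => /andP[c0 c1].
  rewrite (ger0_norm c0) ger0_norm ?subr_ge0//.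
  have [->|c0'] := eqVneq c 0; first by rewrite subr0 mul0r addr0 mul1r.
  have -> : d = (1 - c) * d + c * d by ring.
  apply: ler_ltD; first by apply: ler_wpM2l; rewrite ?subr_ge0// ltW.
  by rewrite ltr_pM2l// lt0r c0'.
have nu0 : 0 <= n%:R * `|u| by rewrite mulr_ge0.
move=> /(ler_wpM2l nu0) /le_trans; apply.
rewrite mulrAC [leRHS]mulrC [leLHS]mulrC ler_wpM2l//.
rewrite mulrCA -[leRHS]mulr1 ler_pM2l//.
by rewrite ler_pdivrMr// mul1r ler_nat.
Qed.

Lemma mulmx_bounded n m (A : 'M[R]_(n, m)) :
  exists2 a, 0 < a & forall v : 'rV[R]_n, `|v *m A| <= a * `|v|.
Proof.
exists (n%:R * `|A| + 1); first by rewrite ltr_wpDl// mulr_ge0.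
move=> v; apply: le_trans (mx_norm_mul _ _) _.
by rewrite mulrAC ler_wpM2r// lerDl.
Qed.

Lemma near_unitmx (V : normedModType R) n (A : V -> 'M[R]_n) x :
  {for x, continuous A} -> A x \in unitmx -> \forall y \near x, A y \in unitmx.
Proof.
move=> cA; rewrite unitmxE unitfE => dA.
have cdet : {for x, continuous (fun y => \det (A y))}.
  pose S (g : V -> R) := exists i j, g = fun y => A y i j.
  apply: (@ring_closure_continuous _ _ S).
    move=> _ [i [j ->]];
    exact: (@continuous_comp _ _ _ A (fun M : 'M[R]_n => M i j) x cA
              (@coord_continuous _ _ _ i j _)).
  by apply: ring_closure_det => i j; apply: ring_closure_gen; exists i, j.
near=> y; rewrite unitmxE unitfE; near: y.
exact: (cvgr_neq0 _ cdet dA).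
Unshelve. all: by end_near.
Qed.

(** The simplified Newton map T x = x - (f x - y) A^-1, where A is the Jacobian
    at p, has Lipschitz constant 1/2 on a ball around p because f is strictly
    differentiable there.  Its fixed point is the preimage of y; the same
    estimate makes the inverse Lipschitz, and strict differentiability at h y
    then gives its derivative. *)
Theorem inverse_function n (f : 'rV[R]_n -> 'rV[R]_n) p :
  (forall x, differentiable f x) -> continuous (jacobian f) -> 'J f p \in unitmx ->
  exists (U U' : set 'rV[R]_n) (h : 'rV[R]_n -> 'rV[R]_n),
    [/\ [/\ open U, open U' & U p],
        (forall x, U x -> [/\ 'J f x \in unitmx, U' (f x) & h (f x) = x]),
        (forall y, U' y -> U (h y) /\ f (h y) = y),
        (forall y, U' y -> {for y, continuous h}) &
        (forall y v, U' y -> is_derive y v h (v *m invmx ('J f (h y))))].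
Proof.
move=> df cJ Ju; set A := 'J f p.
have [a a0 Aa] := mulmx_bounded (invmx A).
have a20 : 0 < (2 * a)^-1 by rewrite invr_gt0 mulr_gt0.
have [d1 d10 sd] := C1_strictly_differentiable df (cJ p) a20.
have : \forall x \near p, 'J f x \in unitmx.
  exact: near_unitmx (cJ p) Ju.
move=> /nbhs_normP[d2 /= d20 Jd2].
pose d := Num.min d1 d2; have d0 : 0 < d by rewrite lt_min d10.
pose B : set 'rV[R]_n := [set x | `|x - p| < d].
have BJ x : B x -> 'J f x \in unitmx.
  by move=> xB; apply: Jd2; rewrite /= distrC (lt_le_trans xB)// ge_min lexx orbT.
have B1 x x' : B x -> B x' ->
    `|(f x - f x') *m invmx A - (x - x')| <= 2^-1 * `|x - x'|.
  move=> xB x'B.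
  have -> : (f x - f x') *m invmx A - (x - x') =
            (f x - f x' - (x - x') *m A) *m invmx A.
    by rewrite [RHS]mulmxBl mulmxK.
  apply: le_trans (Aa _) _; rewrite -ler_pdivlMl// mulrA -invfM mulrC (mulrC a).
  by rewrite mulrC; apply: sd; apply: lt_le_trans; (try by eassumption);
    rewrite ge_min lexx.
have B2 x x' : B x -> B x' -> `|x - x'| <= 2 * a * `|f x - f x'|.
  move=> xB x'B; have := B1 _ _ xB x'B.
  have := Aa (f x - f x').
  have := ler_dist_dist (x - x') ((f x - f x') *m invmx A).
  have := ler_normB ((f x - f x') *m invmx A) ((f x - f x') *m invmx A - (x - x')).
  rewrite opprB addrCA subrr addr0.
  set s := `|x - x'|; lra.
(* A displacement of y by r / (2 a) moves T p by at most r / 2, which the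
   contraction factor 1/2 completes to r: T maps the ball of radius r to itself. *)
pose r := d / 2; have r0 : 0 < r by rewrite divr_gt0.
pose U' : set 'rV[R]_n := [set y | `|y - f p| < r / (2 * a)].
have KB x : closed_ball_ Num.Def.normr p r x -> B x.
  rewrite /closed_ball_ /= distrC => /le_lt_trans; apply.
  by rewrite ltr_pdivrMr// mulr_natr mulr2n ltrDl.
have ex y : U' y -> exists2 x, B x & f x = y.
  move=> U'y; pose T x := x - (f x - y) *m invmx A.
  have TT x x' : T x - T x' = - ((f x - f x') *m invmx A - (x - x')).
    by rewrite /T !mulmxBl; apply/matrixP => i j; rewrite !mxE; ring.
  have Kp : closed_ball_ Num.Def.normr p r p.
    by rewrite /closed_ball_ /= subrr normr0 ltW.
  have fT : {homo T : x /
      closed_ball_ Num.Def.normr p r x >-> closed_ball_ Num.Def.normr p r x}.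
    move=> x Kx; rewrite /closed_ball_ /= distrC -(subrKA (T p)).
    apply: le_trans (ler_normD _ _) _.
    have := B1 _ _ (KB _ Kx) (KB _ Kp); rewrite -normrN -TT.
    have -> : T p - p = (y - f p) *m invmx A.
      by rewrite /T -[y - f p]opprB mulNmx addrAC subrr add0r.
    have := Aa (y - f p).
    have : a * `|y - f p| <= r / 2.
      move: U'y => /ltW; rewrite invfM mulrA ler_pdivlMr// => /=.
      by rewrite mulrC.
    move: Kx; rewrite /closed_ball_ /= distrC.
    set s := `|x - p|; lra.
  have ctr : is_contraction (mkfun_fun fT).
    exists (2^-1)%:nng; split => /=; first by rewrite invf_lt1// ltr1n.
    move=> -[x x'] /= [Kx Kx']; rewrite /mkfun TT normrN.
    by apply: B1; exact: KB.
  have [||x Kx xE] := banach_fixed_point ctr.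
  - exact: closed_closed_ball_.
  - by exists p.
  exists x; first exact: KB.
  move: xE; rewrite /= /mkfun /T => /eqP; rewrite -subr_eq0 opprB addrCA subrr addr0.
  move=> /eqP /(congr1 (fun w => w *m A)).
  by rewrite mulmxKV// mul0mx => /eqP; rewrite subr_eq0 => /eqP.
pose U := B `&` f @^-1` U'.
pose h y := xget p [set x | B x /\ f x = y].
have hP y : U' y -> B (h y) /\ f (h y) = y.
  by move=> /ex[x Bx fx]; rewrite /h; case: xgetP => [z _ //|/(_ x)]; case.
have hL y y' : U' y -> U' y' -> `|h y - h y'| <= 2 * a * `|y - y'|.
  move=> /hP[By fy] /hP[By' fy']; rewrite -[in leRHS]fy -[in leRHS]fy'.
  exact: B2.
have oball q e : open [set x : 'rV[R]_n | `|x - q| < e].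
  rewrite (_ : [set _ | _] = ball q e); first exact: ball_open.
  by rewrite -ball_normE; apply/seteqP; split => x /=; rewrite distrC.
exists U, U', h; split.
- split; [|exact: oball|].
    apply: openI; first exact: oball.
    apply: open_comp => [x _|]; last exact: oball.
    exact: differentiable_continuous.
  by split => /=; rewrite /B /U' /= subrr normr0// divr_gt0// mulr_gt0.
- move=> x [Bx U'x]; split; [exact: BJ|exact: U'x|].
  have [Bh fh] := hP _ U'x; apply/eqP; rewrite -subr_eq0 -normr_le0.
  by apply: le_trans (B2 _ _ Bh Bx) _; rewrite fh subrr normr0 mulr0.
- move=> y U'y; have [Bh fh] := hP _ U'y; split; last exact: fh.
  by split; [exact: Bh|rewrite /preimage /= fh].
- move=> y U'y; apply/(@cvgrPdist_lt _ _ _ (nbhs y)) => e e0; near=> y'.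
  have U'y' : U' y'.
    by near: y'; exact: open_nbhs_nbhs (conj (oball _ _) U'y).
  apply: le_lt_trans (hL _ _ U'y U'y') _.
  rewrite -ltr_pdivlMl ?mulr_gt0//; near: y'.
  have : \forall y' \near y, `|y - y'| < (2 * a)^-1 * e.
    by apply/nbhs_normP; exists ((2 * a)^-1 * e) => //=; rewrite mulr_gt0.
  exact.
- move=> y v U'y.
  have [Bx fx] := hP _ U'y; have Jx := BJ _ Bx.
  set x := h y in Bx fx Jx *; set w := v *m _.
  suff cw : s^-1 *: (h (s *: v + y) - h y) @[s --> (0 : R)^'] --> w.
    by split; [apply/cvg_ex; exists w|exact/cvg_lim].
  have [b b0 Ab] := mulmx_bounded (invmx ('J f x)).
  apply/cvgrPdist_le => e e0.
  pose c := b * (2 * a * `|v|) + 1.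
  have c0 : 0 < c by rewrite ltr_wpDl// !mulr_ge0// ltW.
  have ec0 : 0 < e / c by rewrite divr_gt0.
  have [d3 d30 sdx] := C1_strictly_differentiable df (cJ x) ec0.
  near=> s.
  have s0 : s != 0 by near: s; exact: nbhs_dnbhs_neq.
  have U's : U' (s *: v + y).
    near: s; apply: nbhs_dnbhs.
    have cl : {for (0 : R), continuous (fun s : R => s *: v + y)}.
      by apply: cvgD; [exact: scalel_continuous|exact: cvg_cst].
    apply: cl; rewrite scale0r add0r.
    exact: open_nbhs_nbhs (conj (oball _ _) U'y).
  have [_ fs] := hP _ U's.
  have := hL _ _ U's U'y; rewrite -/x; set xs := h _ in fs *.
  rewrite addrK normrZ => xsx.
  have xsd : `|xs - x| < d3.
    apply: le_lt_trans xsx _; rewrite mulrCA; near: s.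
    have [->|v0] := eqVneq v 0; first by near=> s; rewrite normr0 !mulr0.
    near=> s; rewrite -ltr_pdivlMr ?mulr_gt0// ?normr_gt0//; near: s.
    by apply: dnbhs0_lt; rewrite divr_gt0// ?mulr_gt0// normr_gt0.
  have := sdx xs x xsd; rewrite subrr normr0 => /(_ d30).
  rewrite fs fx addrK => sdxs.
  have -> : w - s^-1 *: (xs - x) =
      s^-1 *: ((s *: v - (xs - x) *m 'J f x) *m invmx ('J f x)).
    by rewrite mulmxBl mulmxK// -scalemxAl [RHS]scalerBr scalerA mulVf// scale1r.
  move: (s *: v - (xs - x) *m 'J f x) sdxs => q sdxs.
  move: (q *m invmx ('J f x)) (Ab q) => q' Abq.
  rewrite normrZ normfV ler_pdivrMl ?normr_gt0//; apply: le_trans Abq _.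
  have : b * `|q| <= b * (e / c * (2 * a * (`|s| * `|v|))).
    by rewrite ler_pM2l//; apply: le_trans sdxs _; rewrite ler_pM2l.
  move=> /le_trans; apply.
  have -> : b * (e / c * (2 * a * (`|s| * `|v|))) =
     `|s| * (e * ((b * (2 * a * `|v|)) / c)) by ring.
  rewrite ler_wpM2l// -[leRHS]mulr1 ler_pM2l// ler_pdivrMr// mul1r.
  by rewrite /c lerDl.
Unshelve. all: by end_near.
Qed.

End InverseFunction.

(** * Polynomial maps and their Jacobians *)

Section PolynomialMaps.
Context {R : realType} {n : nat}.

Definition polynomial_map m (f : 'rV[R]_n -> 'rV[R]_m) :=
  forall j, polynomial_fun (fun x => f x 0 j).

Lemma polynomial_map_differentiable m (f : 'rV[R]_n -> 'rV[R]_m) x :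
  polynomial_map f -> differentiable f x.
Proof.
by move=> pf; apply: differentiable_rVP => j; exact: polynomial_fun_differentiable.
Qed.

Lemma polynomial_fun_jacobian m (f : 'rV[R]_n -> 'rV[R]_m) i j :
  polynomial_map f -> polynomial_fun (fun x => 'J f x i j).
Proof.
move=> pf; rewrite (_ : (fun _ => _) = 'D_(delta_mx 0 i) (fun x => f x 0 j)).
  exact: polynomial_fun_derive.
by apply/funext => x; apply/jacobian_coord/polynomial_map_differentiable.
Qed.

Lemma polynomial_map_jacobian_continuous m (f : 'rV[R]_n -> 'rV[R]_m) :
  polynomial_map f -> continuous (jacobian f).
Proof.
move=> pf x; apply: mx_continuous => i j.
exact/polynomial_fun_continuous/polynomial_fun_jacobian.
Qed.

Lemma polynomial_map_mulmx m p (f : 'rV[R]_n -> 'rV[R]_m) (A : 'M[R]_(m, p)) :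
  polynomial_map f -> polynomial_map (fun x => f x *m A).
Proof.
move=> pf j; rewrite (_ : (fun _ => _) = fun x => \sum_i f x 0 i * A i j).
  apply: ring_closure_sum => i _; apply: ring_closureM; first exact: pf.
  exact: ring_closure_cst.
by apply/funext => x; rewrite mxE.
Qed.

Lemma polynomial_mapD m (f g : 'rV[R]_n -> 'rV[R]_m) :
  polynomial_map f -> polynomial_map g -> polynomial_map (fun x => f x + g x).
Proof.
move=> pf pg j; rewrite (_ : (fun _ => _) = (fun x => f x 0 j) \+ (fun x => g x 0 j)).
  exact: (ring_closureD (pf j) (pg j)).
by apply/funext => x; rewrite mxE.
Qed.

Lemma polynomial_map_id : polynomial_map (fun x : 'rV[R]_n => x).
Proof. by move=> j; exact: polynomial_fun_coord. Qed.

Lemma jacobian_mulmx m p (f : 'rV[R]_n -> 'rV[R]_m) (A : 'M[R]_(m, p)) x :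
  polynomial_map f -> 'J (fun y => f y *m A) x = 'J f x *m A.
Proof.
move=> pf; have pfA := polynomial_map_mulmx A pf.
apply/matrixP => i j.
have dfx : differentiable f x by exact: polynomial_map_differentiable.
rewrite jacobian_coord; last exact: polynomial_map_differentiable.
rewrite (_ : (fun _ => _) = \sum_k (fun y => f y 0 k * A k j)); last first.
  by apply/funext => y; rewrite fct_sumE mxE.
have dk k : derivable (fun y => f y 0 k) x (delta_mx 0 i).
  exact/diff_derivable/polynomial_fun_differentiable.
rewrite derive_sum => [|k]; last first.
  exact: (derivableM (dk k) (derivable_cst _ _ _)).
rewrite mxE; apply: eq_bigr => k _.
by rewrite jacobian_coord// (deriveMr _ (dk k)) mulrC.
Qed.

Lemma jacobianD m (f g : 'rV[R]_n -> 'rV[R]_m) x :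
  polynomial_map f -> polynomial_map g ->
  'J (fun y => f y + g y) x = 'J f x + 'J g x.
Proof.
move=> pf pg; apply/matrixP => i j.
rewrite jacobian_coord; last first.
  exact: (polynomial_map_differentiable _ (polynomial_mapD pf pg)).
rewrite (_ : (fun _ => _) = (fun y => f y 0 j) + (fun y => g y 0 j)); last first.
  by apply/funext => y; rewrite mxE.
rewrite deriveD; try exact/diff_derivable/polynomial_fun_differentiable.
by rewrite mxE -!jacobian_coord//; exact: polynomial_map_differentiable.
Qed.

Lemma jacobian_id (x : 'rV[R]_n) : 'J (fun y : 'rV[R]_n => y) x = 1%:M.
Proof.
apply/matrixP => i j.
rewrite jacobian_coord; last exact/polynomial_map_differentiable/polynomial_map_id.
have idx : derivable (fun y : 'rV[R]_n => y) x (delta_mx 0 i) by exact: derivable_id.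
have := derive_mx idx; rewrite derive_id => /matrixP /(_ 0 j).
by rewrite !mxE => <-; rewrite eqxx eq_sym.
Qed.

End PolynomialMaps.

(** The derivatives of s are, by hypothesis, polynomials in the coordinates of s
    and in the inverse of the determinant of the Jacobian at s.  The ring
    generated by these functions is stable under differentiation, since
    d (1 / D) = - d D / D^2.  The inverse of f is the case w v = v, and its
    restriction to a line is the case where w is a multiple of the direction. *)
Lemma inverse_flow_smooth (R : realType) (V : normedModType R) n (U : set V)
    (f : 'rV[R]_n -> 'rV[R]_n) (s : V -> 'rV[R]_n) (w : V -> 'rV[R]_n) :
  open U -> polynomial_map f ->
  (forall x, U x -> {for x, continuous s}) ->
  (forall x, U x -> 'J f (s x) \in unitmx) ->
  (forall x v, U x -> is_derive x v s (w v *m invmx ('J f (s x)))) ->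
  smooth_on U s.
Proof.
move=> oU pf cs Ju ds.
pose S0 (g : V -> R) := exists i, g = fun x => s x 0 i.
pose d x := \det ('J f (s x)).
pose S (g : V -> R) := S0 g \/ g = fun x => (d x)^-1.
have S0S g : S0 g -> ring_closure S g by move=> S0g; apply: ring_closure_gen; left.
have comp (T : (V -> R) -> Prop) (g : 'rV[R]_n -> R) :
    (forall g, S0 g -> ring_closure T g) ->
    polynomial_fun g -> ring_closure T (fun x => g (s x)).
  move=> S0T; apply: (ring_closure_comp (h := s)) => _ [i ->].
  by apply: S0T; exists i.
have d0 x : U x -> d x != 0 by move=> /Ju; rewrite unitmxE unitfE.
have dS0 : ring_closure S0 d.
  apply: (comp S0 (fun x => \det ('J f x))) => [g|]; first exact: ring_closure_gen.
  by apply: ring_closure_det => i j; exact: polynomial_fun_jacobian.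
have cS0 x g : U x -> S0 g -> {for x, continuous g}.
  move=> Ux [i ->].
  exact: (@continuous_comp _ _ _ s (fun M : 'rV[R]_n => M 0 i) x (cs x Ux)
           (@coord_continuous _ _ _ _ _ _)).
have adjS i j : ring_closure S (fun x => \adj ('J f (s x)) i j).
  apply: (comp S (fun y => \adj ('J f y) i j)) => //.
  rewrite (_ : (fun _ => _) = fun y => cofactor ('J f y) j i); last first.
    by apply/funext => y; rewrite mxE.
  apply: ring_closureZ; apply: ring_closure_det => k l.
  rewrite (_ : (fun _ => _) = fun y => 'J f y (lift j k) (lift i l)).
    exact: polynomial_fun_jacobian.
  by apply/funext => y; rewrite !mxE.
have dcoord v g : S0 g -> exists2 g', ring_closure S g' &
    forall x, U x -> is_derive x v g (g' x).
  move=> [i ->].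
  exists (fun x => \sum_j w v 0 j * ((d x)^-1 * \adj ('J f (s x)) j i)).
    apply: ring_closure_sum => j _; apply: ring_closureZ.
    by apply: ring_closureM => //; apply: ring_closure_gen; right.
  move=> x Ux; have [sd sE] := ds x v Ux.
  split; first by move/derivable_mxP : sd; exact.
  have := derive_mx sd; rewrite sE => /matrixP /(_ 0 i); rewrite !mxE => <-.
  by apply: eq_bigr => j _; rewrite /invmx Ju// !mxE.
apply: (@smooth_on_class _ _ _ _ (ring_closure S)) => //.
- move=> g Sg x Ux; apply: ring_closure_continuous Sg => {}g [S0g|->].
    exact: cS0.
  apply: cvgV; first exact: d0.
  by apply: ring_closure_continuous dS0 => ? ?; exact: cS0.
- move=> v g Sg.
  suff [] : ring_closure S g /\ exists2 g', ring_closure S g' &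
    forall x, U x -> is_derive x v g (g' x) by [].
  apply: ring_closure_derive Sg => {}g; first exact: ring_closure_gen.
  case=> [|->]; first exact: dcoord.
  have [_ [d' Sd' dd']] := ring_closure_derive S0S (dcoord v) dS0.
  exists (fun x => - 1 * ((d x)^-1 * (d x)^-1 * d' x)).
    by apply: ring_closureZ; apply: ring_closureM => //; apply: ring_closureM;
      apply: ring_closure_gen; right.
  move=> x Ux; have [dd dE] := dd' x Ux.
  split; first by apply: derivableV => //; exact: d0.
  rewrite deriveV//; last exact: d0.
  by rewrite dE mulN1r scaleNr -expr2 exprVn.
- move=> j; exists (fun x => s x 0 j) => //.
  by apply: ring_closure_gen; left; exists j.
Qed.

(** * Level sets of maps of corank one *)

Section CorankOne.
Context {F : fieldType}.

Lemma rank_factor n m p (A : 'M[F]_(n, p)) : \rank A = m ->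
  exists (C : 'M[F]_(n, m)) (D : 'M[F]_(m, p)), [/\ A = C *m D, row_full C & row_free D].
Proof.
move=> <-; exists (col_base A), (row_base A).
by rewrite mulmx_base col_base_full row_base_free.
Qed.

Lemma rank_le_ker n m (A : 'M[F]_(n, m.+1)) (l : 'cV[F]_m.+1) :
  l != 0 -> A *m l = 0 -> (\rank A <= m)%N.
Proof.
move=> l0 /eqP; rewrite -sub_kermx => /mxrankS; rewrite mxrank_ker.
move: l0; rewrite -mxrank_eq0; case: (\rank l) => //= r _; rewrite subSS.
by move=> /leq_trans; apply; exact: leq_subr.
Qed.

(** The row space of A lies in the kernel of l and both have dimension m, hence
    they are equal. *)
Lemma sub_corank1 n m p (A : 'M[F]_(n, m.+1)) (l : 'cV[F]_m.+1) (w : 'M[F]_(p, m.+1)) :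
  l != 0 -> A *m l = 0 -> \rank A = m -> w *m l = 0 -> (w <= A)%MS.
Proof.
move=> l0 Al rA wl.
have sA : (A <= kermx l)%MS by apply/sub_kermxP.
have rl : \rank l = 1%N.
  by apply/eqP; rewrite eqn_leq rank_leq_col lt0n mxrank_eq0.
have : (kermx l <= A)%MS.
  have := mxrank_leqif_sup sA; rewrite mxrank_ker rA rl subn1 /= => -[_ <-].
  by rewrite eqxx.
by apply: submx_trans; apply/sub_kermxP.
Qed.

Lemma row_mx_complement k m (C : 'M[F]_(k + m, m)) :
  row_full C -> exists K : 'M[F]_(k + m, k), row_mx K C \in unitmx.
Proof.
move=> /eqP rC.
have rCT : \rank C^T = m by rewrite mxrank_tr.
have rcomp : \rank (C^T)^C%MS = k by rewrite mxrank_compl rCT addnK.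
have [K0 [D [E fK fD]]] := rank_factor rcomp.
exists D^T; rewrite -unitmx_tr tr_row_mx trmxK -row_full_unit.
have : row_full (C^T + (C^T)^C)%MS by exact: addsmx_compl_full.
rewrite -!sub1mx => /submx_trans; apply.
have DC r (B : 'M[F]_(r, k + m)) : (B <= col_mx D C^T)%MS = (B <= D + C^T)%MS.
  by rewrite addsmxE.
rewrite addsmx_sub !DC addsmxSr /= E.
exact: submx_trans (submxMl _ _) (addsmxSl _ _).
Qed.

End CorankOne.

Section ConstantRank.
Context {R : realType} {k m : nat}.
Variables (G : 'rV[R]_(k + m) -> 'rV[R]_m.+1) (l : 'cV[R]_m.+1).
Hypotheses (pG : polynomial_map G) (l0 : l != 0).
Hypothesis Gl : forall y, G y *m l = 0.
Variable p : 'rV[R]_(k + m).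
Hypothesis rGp : \rank ('J G p) = m.

Lemma jacobian_dependent x : 'J G x *m l = 0.
Proof.
rewrite -jacobian_mulmx//; apply/matrixP => i j.
rewrite jacobian_coord; last exact/polynomial_map_differentiable/polynomial_map_mulmx.
rewrite (_ : (fun _ => _) = cst 0) ?derive_cst ?mxE//.
by apply/funext => y; rewrite Gl mxE.
Qed.

(** The rank cannot drop near p, and the relation jacobian_dependent prevents it
    from growing. *)
Lemma jacobian_rank_near : \forall y \near p, \rank ('J G y) = m.
Proof.
have [C [D [E fC fD]]] := rank_factor rGp.
pose L y := pinvmx C *m 'J G y *m pinvmx D.
have cL : {for p, continuous L}.
  apply: mx_continuous => i j; apply: (@polynomial_fun_continuous _ _ _ _ p).
  rewrite (_ : (fun _ => _) = fun y => \sum_a (\sum_b pinvmx C i b * 'J G y b a) * pinvmx D a j).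
    apply: ring_closure_sum => a _; apply: ring_closureM; last exact: ring_closure_cst.
    by apply: ring_closure_sum => b _; apply: ring_closureZ; exact: polynomial_fun_jacobian.
  apply/funext => y; rewrite !mxE; apply: eq_bigr => a _; by rewrite !mxE.
have uL : L p \in unitmx by rewrite /L E mulmxA mulVpmx// mul1mx mulmxVp// unitmx1.
apply: filterS (near_unitmx cL uL) => y Ly; apply/eqP; rewrite eqn_leq.
rewrite (rank_le_ker l0 (jacobian_dependent y))/=.
rewrite -[m in (m <= _)%N](mxrank_unit Ly); apply: leq_trans (mxrankM_maxl _ _) _.
exact: mxrankM_maxr.
Qed.

(** Write 'J G p = C D with C of full column rank and D of full row rank, let K
    complete C to an invertible matrix, and let S be a right inverse of D.  The
    Jacobian of f x = x [K | 0] + G x [0 | S] at p is [K | C], which is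
    invertible.  The relation G x l = 0 forces G x into the row space of D, where
    S is injective: the last m coordinates of f x vanish only if G x = 0. *)
Lemma level_set_chart : exists (U U' : set 'rV[R]_(k + m))
    (f h : 'rV[R]_(k + m) -> 'rV[R]_(k + m)),
  [/\ [/\ U p, polynomial_map f & smooth_diffeo U U' f h],
      (forall x, U x -> 'J f x \in unitmx),
      (forall y v, U' y -> is_derive y v h (v *m invmx ('J f (h y)))),
      (forall x, G x = 0 <-> forall i : 'I_(k + m), (k <= i)%N -> f x 0 i = 0) &
      (forall x (v : 'rV[R]_(k + m)), v *m 'J G x = 0 ->
         forall i : 'I_(k + m), (k <= i)%N -> (v *m 'J f x) 0 i = 0)].
Proof.
have [C [D [E fC fD]]] := rank_factor rGp.
have [K uK] := row_mx_complement fC.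
pose S := pinvmx D.
pose f x := x *m row_mx K 0 + G x *m row_mx 0 S.
have pf : polynomial_map f.
  by apply: polynomial_mapD; apply: polynomial_map_mulmx => //; exact: polynomial_map_id.
have Jf x : 'J f x = row_mx K ('J G x *m S).
  rewrite /f jacobianD; try by apply: polynomial_map_mulmx => //; exact: polynomial_map_id.
  rewrite !jacobian_mulmx//; last exact: polynomial_map_id.
  by rewrite jacobian_id mul1mx mul_mx_row mulmx0 add_row_mx addr0 add0r.
have Jp : 'J f p \in unitmx.
  by rewrite Jf E -mulmxA /S mulmxVp// mulmx1.
have [U [U' [h [[oU oU' Up] fU hU' ch dh]]]] := inverse_function
  (fun x => polynomial_map_differentiable x pf)
  (polynomial_map_jacobian_continuous pf) Jp.
have kshift (i : 'I_(k + m)) : (k <= i)%N -> exists j, i = rshift k j.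
  move=> ki; have ik : (i - k < m)%N by rewrite ltn_subLR.
  by exists (Ordinal ik); apply: val_inj; rewrite /= subnKC.
exists U, U', f, h; split.
- split; [exact: Up|exact: pf|split].
  + by split; [exact: oU|exact: oU'].
  + split; first exact: polynomial_map_smooth.
    apply: (@inverse_flow_smooth _ _ _ _ f h (fun v => v) oU' pf ch _ dh) => y U'y.
    by have [/fU[]] := hU' y U'y.
  + by move=> x /fU[].
  + exact: hU'.
- by move=> x /fU[].
- exact: dh.
- move=> x; have fE (i : 'I_m) : f x 0 (rshift k i) = (G x *m S) 0 i.
    by rewrite /f !mul_mx_row mulmx0 mxE !row_mxEr mxE add0r.
  split=> [Gx i /kshift[j ->]|fx]; first by rewrite fE Gx mul0mx mxE.
  have GS : G x *m S = 0.
    by apply/rowP => i; rewrite -fE fx ?mxE//= leq_addr.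
  have /submxP[u Gu] : (G x <= D)%MS.
    apply: (submx_trans (sub_corank1 l0 (jacobian_dependent p) rGp (Gl x))).
    by rewrite E submxMl.
  move: GS; rewrite Gu -mulmxA /S mulmxVp// mulmx1 => ->.
  by rewrite mul0mx.
- move=> x v vG i /kshift[j ->].
  by rewrite Jf mul_mx_row row_mxEr mulmxA vG mul0mx mxE.
Qed.

Lemma level_set_submanifold : exists U : set 'rV[R]_(k + m),
  [/\ open U, U p & smooth_submanifold k ([set y | G y = 0] `&` U)].
Proof.
have [U [U' [f [h [[Up pf fh] _ _ fG _]]]]] := level_set_chart.
have [[oU oU'] _ _ _] := fh.
exists U; split => //; split; first exact: leq_addr.
move=> q [_ Uq]; exists U, U', f, h; split => // x Ux.
by split=> [[/fG]//|/fG].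
Qed.

(** The curve is the preimage under the chart of the line through f p with
    direction v 'J f p; this line stays in the slice because v is in the kernel. *)
Lemma level_set_tangent v : G p = 0 -> v *m 'J G p = 0 ->
  tangent_to_smooth_curve [set y | G y = 0] p v.
Proof.
move=> Gp vG; have [U [U' [f [h [[Up pf fh] Ju dh fG vJ]]]]] := level_set_chart.
have [[oU oU'] [_ sh] fU hU'] := fh.
have [U'fp hfp] := fU p Up.
pose w := v *m 'J f p; pose line (t : R) := f p + t *: w.
pose gamma (t : R) := h (line t).
have cline : continuous line.
  by move=> t; apply: cvgD; [exact: cvg_cst|exact: scalel_continuous].
have : \forall t \near (0 : R), U' (line t).
  apply: cline; rewrite /line scale0r addr0.
  by apply: open_nbhs_nbhs; split.
move=> /nbhs_normP[e /= e0 eU'].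
have inU' t : `|t| < e -> U' (line t).
  by move=> te; apply: eU'; rewrite /= sub0r normrN.
have gamma0 : gamma 0 = p by rewrite /gamma /line scale0r addr0.
have dgamma (t u : R) : `|t| < e ->
    is_derive t u gamma ((u *: w) *m invmx ('J f (gamma t))).
  by move=> te; apply: is_derive_line; apply: dh; exact: inU'.
have Ugamma t : `|t| < e -> U (gamma t) by move=> /inU' /hU'[].
exists e, gamma; split => //.
- have absE (t : R) : `]- e, e[%classic t -> `|t| < e.
    by rewrite /= in_itv /= ltr_norml.
  apply: (@inverse_flow_smooth _ _ _ _ f gamma (fun u => u *: w)).
  + exact: interval_open.
  + exact: pf.
  + move=> t /absE te; apply: differentiable_continuous; apply/derivable1_diffP.
    by have [] := dgamma t 1 te.
  + by move=> t /absE /Ugamma; exact: Ju.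
  + by move=> t u /absE; exact: dgamma.
- have := dgamma 0 1; rewrite normr0 gamma0 scale1r /w mulmxK; last exact: Ju.
  exact.
- move=> t te; apply/fG => i ki; have [_ ->] := hU' _ (inU' t te).
  rewrite mxE (fG p).1// add0r mxE.
  by rewrite /w (vJ p v vG)// mulr0.
Qed.

End ConstantRank.

(** * The smallest eigenvalue of a nonnegative quadratic form *)

Section Rayleigh.
Context {R : realType}.

Definition sqnorm n (x : 'rV[R]_n) : R := (x *m x^T) 0 0.

Lemma sqnormE n (x : 'rV[R]_n) : sqnorm x = \sum_i x 0 i ^+ 2.
Proof. by rewrite /sqnorm mxE; apply: eq_bigr => i _; rewrite mxE expr2. Qed.

Lemma sqnorm_ge0 n (x : 'rV[R]_n) : 0 <= sqnorm x.
Proof. by rewrite sqnormE sumr_ge0// => i _; exact: sqr_ge0. Qed.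

Lemma sqnorm_eq0 n (x : 'rV[R]_n) : (sqnorm x == 0) = (x == 0).
Proof.
rewrite sqnormE; apply/eqP/eqP => [x0|->]; last first.
  by apply: big1 => i _; rewrite mxE expr0n.
apply/rowP => i; rewrite mxE; apply/eqP; rewrite -sqrf_eq0; apply/eqP.
by apply: (psumr_eq0P _ x0) => // j _; exact: sqr_ge0.
Qed.

Lemma sqnormZ n (a : R) (x : 'rV[R]_n) : sqnorm (a *: x) = a ^+ 2 * sqnorm x.
Proof. by rewrite !sqnormE mulr_sumr; apply: eq_bigr => i _; rewrite mxE exprMn. Qed.

Lemma norm_le_sqnorm n (x : 'rV[R]_n) : `|x| ^+ 2 <= sqnorm x.
Proof.
have [->|x0] := eqVneq x 0; first by rewrite normr0 expr0n sqnorm_ge0.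
have [[i j] ->] : exists i, `|x| = `|x i.1 i.2|.
  by have := @mx_norm_neq0 _ _ _ x; apply; apply: contra_neq x0 => /mx_norm_eq0.
rewrite (ord1 i) /= sqnormE real_normK ?num_real//.
by rewrite (bigD1 j)//= lerDl sumr_ge0// => k _; exact: sqr_ge0.
Qed.

Lemma sqnorm_le_norm n (x : 'rV[R]_n) : sqnorm x <= n%:R * `|x| ^+ 2.
Proof.
rewrite sqnormE -[n in n%:R]card_ord -sumr_const mulr_suml ler_sum// => i _.
rewrite mul1r -real_normK ?num_real// lerXn2r ?nnegrE//.
exact: coord_le_norm.
Qed.

(** A minimizer v of the Rayleigh quotient on the unit sphere is an eigenvector:
    P = H - mu is nonnegative and v P v^T = 0, so that expanding the form of P at
    v + t v P, for small t < 0, forces v P = 0. *)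
Lemma min_eigenvalue n (H : 'M[R]_n.+1) : H^T = H ->
  (forall x : 'rV[R]_n.+1, 0 <= (x *m H *m x^T) 0 0) ->
  exists mu, [/\ 0 <= mu, eigenvalue H mu &
    forall x : 'rV[R]_n.+1, mu * sqnorm x <= (x *m H *m x^T) 0 0].
Proof.
move=> Hs Hpos; pose q (x : 'rV[R]_n.+1) := (x *m H *m x^T) 0 0.
have qZ a x : q (a *: x) = a ^+ 2 * q x.
  by rewrite /q linearZ/= -scalemxAl -scalemxAl -scalemxAr !mxE; ring.
have pq : polynomial_fun q.
  rewrite (_ : q = fun x => \sum_j (\sum_i x 0 i * H i j) * x 0 j).
    apply: ring_closure_sum => j _; apply: ring_closureM; last exact: polynomial_fun_coord.
    apply: ring_closure_sum => i _; apply: ring_closureM; first exact: polynomial_fun_coord.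
    exact: ring_closure_cst.
  by apply/funext => x; rewrite /q mxE; apply: eq_bigr => j _; rewrite !mxE.
have ps : polynomial_fun (@sqnorm n.+1).
  rewrite (_ : @sqnorm n.+1 = fun x => \sum_j x 0 j * x 0 j).
    by apply: ring_closure_sum => j _; apply: ring_closureM; exact: polynomial_fun_coord.
  by apply/funext => x; rewrite sqnormE; apply: eq_bigr => j _; rewrite expr2.
pose A : set 'rV[R]_n.+1 := [set x | sqnorm x = 1].
have A0 : A !=set0.
  exists (delta_mx 0 0); rewrite /A /= sqnormE (bigD1 0)//= big1 => [|i i0].
    by rewrite mxE !eqxx addr0 expr1n.
  by rewrite mxE eqxx (negbTE i0) expr0n.
have cA : compact A.
  apply: bounded_closed_compact.
    exists 1; split => // M M1 x /= Ax; apply: le_trans (ltW M1).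
    rewrite -(@expr_le1 _ 2)//; apply: le_trans (norm_le_sqnorm _) _.
    by rewrite Ax.
  apply: (@closed_comp _ _ (@sqnorm n.+1) [set 1]); last exact: closed_eq.
  by move=> x _; exact: polynomial_fun_continuous.
have [v] := EVT_min_rV A0 cA (continuous_subspaceT (polynomial_fun_continuous pq)).
rewrite inE /A /= => v1 vmin.
have qmin x : q v * sqnorm x <= q x.
  have [->|x0] := eqVneq x 0.
    have /eqP -> : sqnorm (0 : 'rV[R]_n.+1) == 0 by rewrite sqnorm_eq0.
    by rewrite mulr0 /q mul0mx mul0mx mxE.
  have s0 : 0 < sqnorm x by rewrite lt0r sqnorm_eq0 x0 sqnorm_ge0.
  rewrite -ler_pdivlMr//.
  have -> : q x / sqnorm x = q ((Num.sqrt (sqnorm x))^-1 *: x).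
    by rewrite qZ exprVn sqr_sqrtr ?ltW// mulrC.
  apply: vmin; rewrite inE /A /= sqnormZ exprVn sqr_sqrtr ?ltW// mulVf//.
  by rewrite gt_eqF.
exists (q v); split => //; first exact: Hpos.
apply/eigenvalueP; exists v; last first.
  by apply/eqP => v0; move: v1; rewrite v0 sqnormE big1 => [/eqP|i _];
    rewrite ?mxE ?expr0n// eq_sym oner_eq0.
pose P := H - (q v)%:M.
have Ps : P^T = P by rewrite /P linearB/= Hs tr_scalar_mx.
have pE x : (x *m P *m x^T) 0 0 = q x - q v * sqnorm x.
  rewrite /P mulmxBr mulmxBl mul_mx_scalar -scalemxAl /q /sqnorm.
  by move: (x *m H *m x^T) (x *m x^T) => a b; rewrite !mxE.
have vPE : v *m P = v *m H - q v *: v by rewrite /P mulmxBr mul_mx_scalar.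
clearbody P.
have Ppos (x : 'rV[R]_n.+1) : 0 <= (x *m P *m x^T) 0 0.
  by rewrite pE subr_ge0 qmin.
pose c := sqnorm (v *m P); pose d := (v *m P *m P *m (v *m P)^T) 0 0.
have d0 : 0 <= d by exact: Ppos.
have vP : (v *m P *m v^T) 0 0 = 0 by rewrite pE v1 mulr1 subrr.
have E t : 0 <= 2 * t * c + t ^+ 2 * d.
  have := Ppos (v + t *: (v *m P)); congr (_ <= _).
  have -> : (v + t *: (v *m P))^T = v^T + t *: (v *m P)^T by rewrite linearD linearZ.
  rewrite !(mulmxDl, mulmxDr) -!scalemxAl -!scalemxAr.
  have -> : v *m P *m P *m v^T = v *m P *m (v *m P)^T.
    by rewrite trmx_mul Ps -!mulmxA.
  rewrite /d /c /sqnorm; move: vP.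
  move: (v *m P *m v^T) (v *m P *m P *m _) (v *m P *m (v *m P)^T) => a b g a0.
  by rewrite !mxE a0; ring.
have c0 : c = 0.
  apply/eqP; rewrite eq_le sqnorm_ge0 andbT leNgt; apply/negP => cpos.
  (* For this t the right-hand side of E is - c^2 (d + 2) / (d + 1)^2. *)
  have := E (- c / (d + 1)).
  have -> : 2 * (- c / (d + 1)) * c + (- c / (d + 1)) ^+ 2 * d =
     - (c ^+ 2 * ((d + 2) / (d + 1) ^+ 2)).
    have : d + 1 != 0 by rewrite gt_eqF// ltr_wpDl.
    by move=> ?; field.
  rewrite oppr_ge0 leNgt mulr_gt0 ?exprn_gt0// divr_gt0// ?exprn_gt0 ?ltr_wpDl//.
move/eqP: c0; by rewrite sqnorm_eq0 vPE subr_eq0 => /eqP.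
Qed.

End Rayleigh.

(** * Pencils through a matrix of corank one *)

Section SingularPencil.
Context {R : realType} {n m : nat}.
Variables (B B1 B2 : 'M[R]_(n, m.+1)) (z : 'rV[R]_n) (l : 'cV[R]_m.+1).
Hypotheses (zB : z *m B = 0) (Bl : B *m l = 0) (rB : \rank B = m).
Hypothesis zB1l : (z *m B1 *m l) 0 0 != 0.

Definition pencil (t : R) := B + t *: B1 + t ^+ 2 *: B2.

Let l0 : l != 0.
Proof. by apply: contra_neq zB1l => ->; rewrite mulmx0 mxE. Qed.

(** Let kap = z B1 l.  Every row killed by l is a combination of rows of B, which
    gives C with C B = 1 - l z B1 / kap; put D = l z / kap.  Then D B = 0 and
    D B1 = 1 - C B, hence (t C + D) (B + t B1 + t^2 B2) = t (1 + t E) with E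
    bounded: a left inverse of the pencil of size 1 / |t|. *)
Lemma pencil_lower_bound : exists c d : R, [/\ 0 < c, 0 < d &
  forall t, `|t| < d -> forall w : 'rV[R]_m.+1,
    c * `|t| * `|w| <= `|w *m (pencil t)^T|].
Proof.
set kap := (z *m B1 *m l) 0 0.
have [C CB] : exists C : 'M[R]_(m.+1, n),
    C *m B = 1%:M - l *m (kap^-1 *: (z *m B1)).
  suff /submxP[C ->] : (1%:M - l *m (kap^-1 *: (z *m B1)) <= B)%MS by exists C.
  apply: (sub_corank1 l0 Bl rB); rewrite mulmxBl mul1mx -mulmxA -scalemxAl.
  have -> : z *m B1 *m l = kap%:M by rewrite [LHS]mx11_scalar.
  by rewrite scale_scalar_mx mulVf// mulmx1 subrr.
pose D := kap^-1 *: (l *m z).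
have DB : D *m B = 0 by rewrite /D -scalemxAl -mulmxA zB mulmx0 scaler0.
have DB1 : D *m B1 = l *m (kap^-1 *: (z *m B1)).
  by rewrite /D -scalemxAl -mulmxA -scalemxAr.
clearbody D; move: (l *m _) CB DB1 => P CB DB1.
pose E0 := C *m B1 + D *m B2; pose E1 := C *m B2.
have ME t : (t *: C + D) *m pencil t = t *: 1%:M + t ^+ 2 *: (E0 + t *: E1).
  rewrite /pencil !(mulmxDl, mulmxDr) -!(scalemxAl, scalemxAr) CB DB DB1 /E0 /E1.
  move: (C *m B1) (C *m B2) (D *m B2) => Q S T.
  by apply/matrixP => i j; rewrite !mxE; ring.
have [aC aC0 hC] := mulmx_bounded C^T.
have [aD aD0 hD] := mulmx_bounded D^T.
have [a0 a00 h0] := mulmx_bounded E0^T.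
have [a1 a10 h1] := mulmx_bounded E1^T.
pose a := aC + aD; pose e := a0 + a1.
have pa : 0 < a by rewrite addr_gt0.
have pe : 0 < e by rewrite addr_gt0.
exists (2 * a)^-1, (Num.min 1 (2 * e)^-1); split.
- by rewrite invr_gt0 mulr_gt0.
- by rewrite lt_min ltr01 invr_gt0 mulr_gt0.
move=> t; rewrite lt_min => /andP[t1 te] w.
set u := w *m _.
have uM : u *m (t *: C + D)^T = t *: w + t ^+ 2 *: (w *m E0^T + t *: (w *m E1^T)).
  rewrite /u -mulmxA -trmx_mul ME.
  have -> : (t *: 1%:M + t ^+ 2 *: (E0 + t *: E1))^T =
      t *: 1%:M + t ^+ 2 *: (E0^T + t *: E1^T).
    by rewrite linearD 2!linearZ/= linearD linearZ/= trmx1.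
  by rewrite mulmxDr -!scalemxAr mulmx1 mulmxDr -scalemxAr.
have tw : `|t| * `|w| <= `|u *m (t *: C + D)^T| +
    `|t| ^+ 2 * `|w *m E0^T + t *: (w *m E1^T)|.
  rewrite -normrX -!normrZ; apply: le_trans (ler_normB _ _).
  by rewrite uM addrK.
have uMa : `|u *m (t *: C + D)^T| <= a * `|u|.
  rewrite linearD/= linearZ/= mulmxDr -scalemxAr; apply: le_trans (ler_normD _ _) _.
  rewrite normrZ /a mulrDl lerD//; apply: le_trans (hC u).
  by rewrite ler_piMl// ltW.
have wE : `|w *m E0^T + t *: (w *m E1^T)| <= e * `|w|.
  apply: le_trans (ler_normD _ _) _; rewrite normrZ /e mulrDl lerD//.
  by apply: le_trans (h1 w); rewrite ler_piMl// ltW.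
have t2 : `|t| ^+ 2 * `|w *m E0^T + t *: (w *m E1^T)| <= 2^-1 * (`|t| * `|w|).
  apply: le_trans (ler_wpM2l (exprn_ge0 _ (normr_ge0 _)) wE) _.
  have -> : `|t| ^+ 2 * (e * `|w|) = `|t| * e * (`|t| * `|w|) by ring.
  rewrite ler_wpM2r ?mulr_ge0//; move: te => /ltW; rewrite invfM => te.
  by rewrite -ler_pdivlMr.
rewrite -mulrA ler_pdivrMl ?mulr_gt0//.
move: tw uMa t2; set q := `|t| * `|w|; set r := `|u *m _|; lra.
Qed.

(** B l = 0, so that the pencil at t maps l to a vector of size |t|. *)
Lemma pencil_upper_bound : exists2 k : R, 0 < k &
  forall t, `|t| <= 1 -> sqnorm (l^T *m (pencil t)^T) <= (k * `|t|) ^+ 2 * sqnorm l^T.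
Proof.
pose b := B1 *m l; pose c := B2 *m l.
have pl : 0 < sqnorm l^T by rewrite lt0r sqnorm_eq0 trmx_eq0 l0 sqnorm_ge0.
pose g := `|b^T| + `|c^T| + 1.
have pg : 0 < g by rewrite ltr_wpDl// addr_ge0.
pose K := n%:R * g ^+ 2 / sqnorm l^T + 1.
have pK : 0 < K by rewrite ltr_wpDl// divr_ge0 ?sqnorm_ge0// mulr_ge0// exprn_ge0// ltW.
exists K => // t t1.
have -> : l^T *m (pencil t)^T = t *: (b^T + t *: c^T).
  rewrite -trmx_mul /pencil !mulmxDl Bl add0r -!scalemxAl -/b -/c.
  by rewrite linearD/= !linearZ/= scalerDr scalerA expr2.
rewrite sqnormZ exprMn real_normK ?num_real// [K ^+ 2 * _]mulrC -[leRHS]mulrA.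
apply: ler_wpM2l; first exact: sqr_ge0.
apply: le_trans (sqnorm_le_norm _) _.
have bcg : `|b^T + t *: c^T| <= g.
  apply: le_trans (ler_normD _ _) _; rewrite normrZ /g -addrA lerD2l.
  by rewrite -[leLHS]addr0 lerD// ler_piMl.
have : n%:R * `|b^T + t *: c^T| ^+ 2 <= n%:R * g ^+ 2.
  by rewrite ler_wpM2l// lerXn2r// nnegrE// ltW.
move=> /le_trans; apply; rewrite -ler_pdivrMr//.
have K1 : 1 <= K by rewrite lerDr divr_ge0 ?sqnorm_ge0// mulr_ge0// exprn_ge0// ltW.
apply: (@le_trans _ _ K); first by rewrite lerDl.
by rewrite expr2 ler_peMr// ltW.
Qed.

Lemma pencil_rank : \forall t \near (0 : R)^', \rank (pencil t) = m.+1.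
Proof.
have [c [d [c0 d0 lb]]] := pencil_lower_bound.
near=> t.
have t0 : t != 0 by near: t; exact: nbhs_dnbhs_neq.
have td : `|t| < d by near: t; exact: dnbhs0_lt.
rewrite -mxrank_tr; apply/eqP; apply: inj_row_free => w wA.
apply/eqP; rewrite -normr_le0; have := lb t td w; rewrite wA normr0.
by rewrite pmulr_rle0// mulr_gt0// normr_gt0.
Unshelve. all: by end_near.
Qed.

Lemma pencil_smallest_singular_value : (m.+1 < n)%N ->
  (fun t : R => smallest_singular_value (pencil t))
    \is 'Theta_((0 : R)^') (fun t : R => `|t|).
Proof.
move=> mn.
have [c [d [c0 d0 lb]]] := pencil_lower_bound.
have [k k0 ub] := pencil_upper_bound.
have qE t (x : 'rV[R]_m.+1) : (x *m ((pencil t)^T *m pencil t) *m x^T) 0 0 =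
    sqnorm (x *m (pencil t)^T).
  by rewrite /sqnorm trmx_mul trmxK !mulmxA.
have pl : 0 < sqnorm l^T by rewrite lt0r sqnorm_eq0 trmx_eq0 l0 sqnorm_ge0.
have svE t s : singular_values (pencil t) s <->
    0 <= s /\ eigenvalue ((pencil t)^T *m pencil t) (s ^+ 2).
  by rewrite /singular_values /= leqNgt mn.
have sv_lower t s : `|t| < d -> singular_values (pencil t) s ->
    c / m.+1%:R * `|t| <= s.
  move=> td /svE[s0 /eigenvalueP[v vs v0]].
  have pv : 0 < `|v| by rewrite normr_gt0.
  have := lb t td v.
  set u := v *m _ => lbu.
  have su : sqnorm u = s ^+ 2 * sqnorm v.
    by rewrite -qE vs -scalemxAl mxE.
  have : (c * `|t| * `|v|) ^+ 2 <= (s * m.+1%:R * `|v|) ^+ 2.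
    apply: (@le_trans _ _ (`|u| ^+ 2)).
      by rewrite lerXn2r ?nnegrE// !mulr_ge0// ltW.
    apply: le_trans (norm_le_sqnorm _) _; rewrite su !exprMn -mulrA.
    rewrite ler_wpM2l ?sqr_ge0//; apply: le_trans (sqnorm_le_norm _) _.
    rewrite ler_wpM2r ?sqr_ge0// -natrX ler_nat.
    by rewrite expnS expn1 leq_pmulr.
  rewrite ler_sqr ?nnegrE ?mulr_ge0// ?(ltW c0)// ler_pM2r//.
  by rewrite mulrAC ler_pdivrMr.
have sv_upper t : `|t| <= 1 ->
    exists2 s, singular_values (pencil t) s & s <= k * `|t|.
  move=> t1; have [||mu [mu0 emu mumin]] :=
      @min_eigenvalue R m ((pencil t)^T *m pencil t).
  - by rewrite trmx_mul trmxK.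
  - by move=> x; rewrite qE sqnorm_ge0.
  exists (Num.sqrt mu).
    by apply/svE; rewrite sqrtr_ge0 sqr_sqrtr.
  rewrite -(@ler_sqr _ (Num.sqrt mu)) ?nnegrE ?sqrtr_ge0 ?mulr_ge0// ?(ltW k0)//.
  rewrite sqr_sqrtr// -(ler_pM2r pl).
  by apply: le_trans (mumin _) _; rewrite qE ub.
(* The infimum is bounded below by sv_lower and above by the smallest
   eigenvalue of the Gram matrix; m.+1 compares the Euclidean and the sup norm. *)
rewrite qualifE; apply/asboolP; exists (c / m.+1%:R, k).
  by rewrite /= divr_gt0.
near=> t.
have t1 : `|t| <= 1 by apply: ltW; near: t; exact: dnbhs0_lt.
have td : `|t| < d by near: t; exact: dnbhs0_lt.
have [s ss sk] := sv_upper t t1.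
have inf_ge : c / m.+1%:R * `|t| <= smallest_singular_value (pencil t).
  by apply: lb_le_inf; [exists s|move=> r; exact: sv_lower].
have inf_le : smallest_singular_value (pencil t) <= s.
  apply: ge_inf ss; exists (c / m.+1%:R * `|t|) => r; exact: sv_lower.
rewrite /= normr_id (ger0_norm (le_trans _ inf_ge)); last first.
  by rewrite mulr_ge0// divr_ge0// ltW.
by split => //; exact: le_trans inf_le sk.
Unshelve. all: by end_near.
Qed.

End SingularPencil.

(** * Integrals of monomials over the simplex *)

Section BetaSegment.
Context {R : realType}.

(** The Euler beta value B(j + 1, k + 1). *)
Definition beta_coef (j k : nat) : R := (j`! * k`!)%:R / (j + k).+1`!%:R.

Lemma beta_coefS j k :
  beta_coef j.+1 k = j.+1%:R / k.+1%:R * beta_coef j k.+1.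
Proof.
rewrite /beta_coef addSnnS !factS !natrM mulrACA mulrA; congr (_ / _).
by have : k.+1%:R != 0 :> R by []; move=> ?; field.
Qed.

Lemma beta_coef_ge0 j k : 0 <= beta_coef j k.
Proof. by rewrite /beta_coef divr_ge0. Qed.

(** Repeated integration by parts lowers j to 0.  A polynomial primitive is kept
    through the induction so that the integral needs a single appeal to the
    fundamental theorem. *)
Lemma beta_primitive (c : R) j k : exists P : {poly R},
  [/\ forall y, P^`().[y] = y ^+ j * (c - y) ^+ k, P.[c] = 0 &
      P.[0] = - (c ^+ (j + k).+1 * beta_coef j k)].
Proof.
elim: j k => [|j IH] k.
  have k0 : k.+1%:R != 0 :> R by [].
  exists (- k.+1%:R^-1 *: (c%:P - 'X) ^+ k.+1); split => [y||].
  - rewrite derivZ deriv_exp derivB derivC derivX sub0r !hornerE.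
    by rewrite !(hornerE, hornerMn) /= -mulr_natr; field.
  - by rewrite !hornerE subrr expr0n mulr0.
  - transitivity (- k.+1%:R^-1 * c ^+ k.+1); first by rewrite !hornerE subr0.
    rewrite /beta_coef add0n fact0 mul1n factS natrM.
    have kf : k`!%:R != 0 :> R by rewrite pnatr_eq0 -lt0n fact_gt0.
    have -> : k`!%:R / (k.+1%:R * k`!%:R) = k.+1%:R^-1 :> R.
      by rewrite invfM mulrC divfK.
    by rewrite mulNr mulrC.
have k0 : k.+1%:R != 0 :> R by [].
have [P [dP Pc P0]] := IH k.+1.
exists (- k.+1%:R^-1 *: ('X^(j.+1) * (c%:P - 'X) ^+ k.+1)
        + (j.+1%:R / k.+1%:R) *: P); split => [y||].
- rewrite derivD !derivZ derivM derivXn deriv_exp derivB derivC derivX sub0r.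
  rewrite !(hornerE, hornerMn) dP /= -[_ *+ k.+1]mulr_natr -[_ *+ j.+1]mulr_natr !exprS.
  by move: (y ^+ j) ((c - y) ^+ k) => u w; field.
- by rewrite !hornerE Pc subrr expr0n /= !(mulr0, addr0).
- transitivity ((j.+1%:R / k.+1%:R) * P.[0]).
    by rewrite !hornerE expr0n /= !(mul0r, mulr0, add0r).
  by rewrite P0 beta_coefS addSnnS mulrN mulrCA.
Qed.

Lemma beta_segment (c : R) j k : 0 <= c ->
  (\int[@lebesgue_measure R]_(y in `[0%R, c]) (y ^+ j * (c - y) ^+ k)%R%:E =
   (c ^+ (j + k).+1 * beta_coef j k)%R%:E)%E.
Proof.
rewrite le_eqVlt => /predU1P[<-|c0].
  by rewrite set_itv1 integral_set1 expr0n mul0r.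
have [P [dP Pc P0]] := beta_primitive c j k.
have E : (fun y => y ^+ j * (c - y) ^+ k) = horner P^`().
  by apply/funext => y; rewrite dP.
under eq_integral do rewrite -dP.
rewrite (@continuous_FTC2 _ _ (horner P)) ?Pc ?P0//.
- by rewrite sub0e -EFinN opprK.
- by apply: continuous_subspaceT; exact: continuous_horner.
- split => [y _||]; first by have [] := is_derive_poly P y.
    by apply: cvg_at_right_filter; exact: continuous_horner.
  by apply: cvg_at_left_filter; exact: continuous_horner.
- by move=> y _; rewrite derivE.
Qed.

(** Tonelli: integrating out the last coordinate leaves an integrand of the same
    kind, so that the lemma can be iterated down to an interval. *)
Lemma integral_under_graph d (T : measurableType d)
    (mu : {sigma_finite_measure set T -> \bar R}) (D : set T) (g c : T -> R) j k :
  measurable D -> measurable_fun setT g -> measurable_fun setT c ->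
  (forall x, D x -> 0 <= g x /\ 0 <= c x) ->
  (\int[mu \x @lebesgue_measure R]_(p in [set p | [/\ D p.1, 0 <= p.2 & p.2 <= c p.1]%R])
     (g p.1 * (p.2 ^+ j * (c p.1 - p.2) ^+ k))%R%:E =
   \int[mu]_(x in D) (g x * (c x ^+ (j + k).+1 * beta_coef j k))%R%:E)%E.
Proof.
move=> mD mg mc gc0.
set E := [set p | _]; pose TR := (T * measurableTypeR R)%type.
have mg1 : measurable_fun setT (fun p : TR => g p.1) by exact: measurableT_comp.
have mc1 : measurable_fun setT (fun p : TR => c p.1) by exact: measurableT_comp.
have m2 : measurable_fun (U := R) setT (fun p : TR => p.2).
  exact: (@measurable_snd _ _ T (measurableTypeR R)).
have mE : measurable (E : set TR).
  rewrite (_ : E = (fst @^-1` D) `&` ((setT `&` [set p : TR | (cst 0 p <= p.2)%R]) `&`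
     (setT `&` [set p : TR | (p.2 <= c p.1)%R]))); last first.
    by apply/seteqP; split => [p [? ? ?]|p [? [[_ ?] [_ ?]]]].
  apply: measurableI.
    by rewrite -[X in measurable X]setTI; exact: measurable_fst.
  by apply: measurableI; exact: measurable_fun_le.
have mp : measurable_fun E
    (fun p : TR => (g p.1 * (p.2 ^+ j * (c p.1 - p.2) ^+ k))%:E : \bar R).
  apply: measurable_funTS; apply/measurable_EFinP.
  apply: (@measurable_funM _ TR R setT (fun p : TR => g p.1)) => //.
  apply: (@measurable_funM _ TR R setT (fun p : TR => p.2 ^+ j)).
    exact: measurable_funX.
  by apply: measurable_funX; exact: measurable_funB.
have mpE := (measurable_restrictT _ mE).1 mp.
rewrite integral_mkcond fubini_tonelli1 => [||p]; last 2 first.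
- exact: mpE.
- rewrite /patch; case: ifPn => //; rewrite inE => -[/gc0[g0 c0] p0 pc].
  by rewrite lee_fin !mulr_ge0 ?exprn_ge0 ?subr_ge0.
rewrite [RHS]integral_mkcond; apply: eq_integral => x _.
rewrite /fubini_F /patch /=; case: ifPn => [|xD].
  rewrite inE => /[dup] Dx /gc0[g0 c0].
  transitivity (\int[@lebesgue_measure R]_(y in `[0%R, c x])
     ((g x)%:E * (y ^+ j * (c x - y) ^+ k)%R%:E))%E.
    rewrite [RHS]integral_mkcond; apply: eq_integral => y _.
    rewrite /patch /=; congr (if _ then _ else _).
    apply/idP/idP; rewrite !inE /E /= in_itv /=; first by case=> _ -> ->.
    by move=> /andP[].
  rewrite ge0_integralZl_EFin//.
  + by rewrite beta_segment// EFinM.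
  + move=> y /=; rewrite in_itv /= => /andP[y0 yc].
    by rewrite lee_fin mulr_ge0 ?exprn_ge0 ?subr_ge0.
  + apply: measurable_funTS; apply/measurable_EFinP.
    apply: (@measurable_funM _ _ R setT (fun y : R => y ^+ j)).
      exact: measurable_funX.
    by apply: measurable_funX; exact: measurable_funB.
rewrite integral0_eq// => y _; case: ifPn => //; rewrite inE => -[Dx].
by rewrite (mem_set Dx) in xD.
Qed.

(* Named, so that its sigma-finiteness can be declared for Tonelli. *)
Definition lebesgue2 := (@lebesgue_measure R \x @lebesgue_measure R)%E.
HB.instance Definition _ := Measure.on lebesgue2.
Lemma lebesgue2_sigma_finite : sigma_finite setT lebesgue2.
Proof.
have /sigma_finiteP[F [FT ndF Foo]] := sigma_finiteT (@lebesgue_measure R).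
exists (fun n => F n `*` F n).
  rewrite -setXTT FT; apply/seteqP; split.
    move=> [x y] [[i _ Fi] [j _ Fj]]; exists (maxn i j) => //.
    by split; [apply: (subsetPset _ _ (ndF _ _ (leq_maxl i j)))
              |apply: (subsetPset _ _ (ndF _ _ (leq_maxr i j)))].
  by move=> [x y] [i _ [? ?]]; split; exists i.
move=> k; have [mF Fo] := Foo k; split; first exact: measurableX.
by rewrite /lebesgue2 product_measure1E// lte_mul_pinfty// ge0_fin_numE.
Qed.
HB.instance Definition _ := Measure_isSigmaFinite.Build _ _ _ lebesgue2
  lebesgue2_sigma_finite.

Definition simplex_monomial i j k l (x : R * R * R) : R :=
  x.1.1 ^+ i * x.1.2 ^+ j * x.2 ^+ k * (1 - x.1.1 - x.1.2 - x.2) ^+ l.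

(** Dirichlet's formula: the simplex is the region under 1 - x - y over the
    triangle, which is the region under 1 - x over [0, 1]. *)
Lemma simplex_monomial_integral i j k l :
  (\int[@lebesgue3 R]_(x in parent_cell) (simplex_monomial i j k l x)%:E =
   ((i`! * j`! * k`! * l`!)%:R / (i + j + k + l + 3)`!%:R)%R%:E)%E.
Proof.
pose TR := measurableTypeR R; pose TR2 := (TR * TR)%type.
pose D1 : set TR := [set` `[0, 1]].
pose D2 : set (TR * TR) := [set q | [/\ D1 q.1, 0 <= q.2 & q.2 <= 1 - q.1]].
have mfst : measurable_fun (U := R) setT (fun q : TR * TR => q.1).
  exact: (@measurable_fst _ _ TR TR).
have msnd : measurable_fun (U := R) setT (fun q : TR * TR => q.2).
  exact: (@measurable_snd _ _ TR TR).
have mid : measurable_fun (U := R) setT (fun x : TR => x).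
  exact: (@measurable_id _ TR).
have mX a : measurable_fun (U := R) setT (fun x : TR => (x : R) ^+ a).
  exact: measurable_funX.
have mg1 : measurable_fun (U := R) setT (fun x : TR => beta_coef k l * (x : R) ^+ i).
  by apply: measurable_funM => //; exact: mX.
have m1x : measurable_fun (U := R) setT (fun x : TR => 1 - (x : R)).
  exact: measurable_funB.
have mD1 : measurable D1 by exact: measurable_itv.
have mD2 : measurable D2.
  rewrite (_ : D2 = (fst @^-1` D1) `&` ((setT `&` [set p : TR * TR | (cst 0 p <= p.2)%R])
     `&` (setT `&` [set p : TR * TR | (p.2 <= 1 - p.1)%R]))); last first.
    by apply/seteqP; split => [p [? ? ?]|p [? [[_ ?] [_ ?]]]].
  apply: measurableI.
    by rewrite -[X in measurable X]setTI; exact: measurable_fst.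
  by apply: measurableI; apply: measurable_fun_le => //; exact: measurable_funB.
have -> : parent_cell = [set p : TR * TR * TR |
    [/\ D2 p.1, 0 <= p.2 & p.2 <= 1 - p.1.1 - p.1.2]].
  apply/seteqP; split=> -[[x y] z] /=; rewrite /D2 /D1 /= in_itv /=.
    by move=> [/= x0 y0 z0 xyz]; split; [split; [apply/andP; split|..]|..]; lra.
  by move=> [[/andP[x0 x1] y0 yx] z0 zc]; split => /=; lra.
have step1 := @integral_under_graph _ _ lebesgue2 D2 (fun q => q.1 ^+ i * q.2 ^+ j)
  (fun q => 1 - q.1 - q.2) k l mD2.
transitivity (\int[lebesgue2 \x @lebesgue_measure R]_(p in [set p : TR * TR * TR |
    [/\ D2 p.1, 0 <= p.2 & p.2 <= 1 - p.1.1 - p.1.2]%R])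
    ((p.1.1 ^+ i * p.1.2 ^+ j) * (p.2 ^+ k * (1 - p.1.1 - p.1.2 - p.2) ^+ l))%R%:E)%E.
  by apply: eq_integral => p _; rewrite /simplex_monomial mulrA.
rewrite {}step1; last 3 first.
- by apply: (@measurable_funM _ TR2 R setT (fun q => q.1 ^+ i)
    (fun q => q.2 ^+ j)); exact: measurable_funX.
- apply: (@measurable_funB _ TR2 R setT (fun q => 1 - q.1)) => //.
  by apply: (@measurable_funB _ TR2 R setT (cst 1)).
- move=> -[x y] [/=]; rewrite /D1 /= in_itv /= => /andP[x0 x1] y0 yx.
  by split; [rewrite mulr_ge0// exprn_ge0|lra].
transitivity (\int[@lebesgue_measure R \x @lebesgue_measure R]_(q in D2)
   (beta_coef k l * q.1 ^+ i * (q.2 ^+ j * (1 - q.1 - q.2) ^+ (k + l).+1))%R%:E)%E.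
  by apply: eq_integral => q _; congr (_%:E); ring.
rewrite (@integral_under_graph _ _ (@lebesgue_measure R) D1
  (fun x => beta_coef k l * x ^+ i) (fun x => 1 - x) j (k + l).+1 mD1); last 3 first.
- exact: mg1.
- exact: m1x.
- move=> x; rewrite /D1 /= in_itv /= => /andP[x0 x1].
  by rewrite subr_ge0 x1 mulr_ge0 ?exprn_ge0 ?beta_coef_ge0.
set m := (j + (k + l).+1).+1.
transitivity (\int[@lebesgue_measure R]_(x in `[0%R, 1%R])
   ((beta_coef k l * beta_coef j (k + l).+1)%R%:E * (x ^+ i * (1 - x) ^+ m)%R%:E))%E.
  by apply: eq_integral => x _; rewrite -EFinM; congr (_%:E); ring.
rewrite ge0_integralZl_EFin//; last 3 first.
- move=> x /=; rewrite in_itv /= => /andP[x0 x1].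
  by rewrite lee_fin mulr_ge0 ?exprn_ge0 ?subr_ge0.
- apply: measurable_funTS; apply/measurable_EFinP.
  apply: (@measurable_funM _ TR R setT (fun x : TR => x ^+ i)).
    exact: mX.
  exact: measurable_funX.
- by rewrite mulr_ge0// beta_coef_ge0.
rewrite beta_segment// expr1n mul1r -EFinM; congr (_%:E).
rewrite /beta_coef /m.
have f0 a : a`!%:R != 0 :> R by rewrite pnatr_eq0 -lt0n fact_gt0.
have -> : ((i + (j + (k + l).+1).+1).+1 = i + j + k + l + 3)%N by lia.
have nat4 a b c d : (a * b * c * d)%:R = a%:R * b%:R * c%:R * d%:R :> R.
  by rewrite !natrM.
rewrite nat4 (natrM _ k`! l`!) (natrM _ j`! _) (natrM _ i`! _).
move: (f0 (k + l).+1) (f0 (j + (k + l).+1).+1) (f0 (i + j + k + l + 3)%N).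
move: ((k + l).+1)`!%:R ((j + (k + l).+1).+1)`!%:R ((i + j + k + l + 3)%N)`!%:R.
move: i`!%:R j`!%:R k`!%:R l`!%:R => a b c d u v w u0 v0 w0.
by field; rewrite ?u0 ?v0 ?w0.
Qed.

Section SimplexIntegrable.
Let TR3 := (measurableTypeR R * measurableTypeR R * measurableTypeR R)%type.

Let m1 : measurable_fun (U := R) setT (fun x : TR3 => x.1.1 : R).
Proof. exact: (@measurableT_comp _ _ _ _ _ _ fst _ fst). Qed.
Let m2 : measurable_fun (U := R) setT (fun x : TR3 => x.1.2 : R).
Proof. exact: (@measurableT_comp _ _ _ _ _ _ snd _ fst). Qed.
Let m3 : measurable_fun (U := R) setT (fun x : TR3 => x.2 : R).
Proof. exact: measurable_snd. Qed.

Lemma measurable_parent_cell : measurable (parent_cell : set TR3).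
Proof.
rewrite (_ : parent_cell =
  (setT `&` [set x : TR3 | (cst 0 x <= x.1.1)%R]) `&`
  (setT `&` [set x : TR3 | (cst 0 x <= x.1.2)%R]) `&`
  (setT `&` [set x : TR3 | (cst 0 x <= x.2)%R]) `&`
  (setT `&` [set x : TR3 | (x.1.1 + x.1.2 + x.2 <= cst 1 x)%R])); last first.
  by apply/seteqP; split=> [x [? ? ? ?]|x [[[[_ ?] [_ ?]] [_ ?]] [_ ?]]].
have m12 : measurable_fun (U := R) setT (fun x : TR3 => x.1.1 + x.1.2 : R).
  exact: measurable_funD.
have m123 : measurable_fun (U := R) setT (fun x : TR3 => x.1.1 + x.1.2 + x.2 : R).
  exact: measurable_funD.
by apply: measurableI; [apply: measurableI; [apply: measurableI|]|];
  apply: measurable_fun_le.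
Qed.

Lemma simplex_monomial_integrable i j k l :
  (@lebesgue3 R).-integrable parent_cell (EFin \o simplex_monomial i j k l).
Proof.
apply/integrableP; split.
  apply: measurable_funTS; apply/measurable_EFinP.
  rewrite /simplex_monomial; apply: measurable_funM.
    by apply: measurable_funM; [apply: measurable_funM|]; exact: measurable_funX.
  by apply: measurable_funX; repeat apply: measurable_funB.
have -> : (\int[@lebesgue3 R]_(x in parent_cell) `|(EFin \o simplex_monomial i j k l) x| =
    \int[@lebesgue3 R]_(x in parent_cell) (simplex_monomial i j k l x)%:E)%E.
  apply: eq_integral => x; rewrite inE => -[x0 y0 z0 xyz] /=; congr (_%:E).
  by rewrite ger0_norm// !mulr_ge0// exprn_ge0//; lra.
by rewrite simplex_monomial_integral ltry.
Qed.

End SimplexIntegrable.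

End BetaSegment.

(** * Trilinear forms with integer coefficients *)

(* The delimiter %Z denotes the integers int. *)
Delimit Scope Z_scope with BinZ.

Section Det3.
Context {R : comNzRingType}.
Implicit Types u v w : nat -> R.

Definition det3 u v w : R :=
  u 0%N * (v 1%N * w 2%N - v 2%N * w 1%N) - u 1%N * (v 0%N * w 2%N - v 2%N * w 0%N)
  + u 2%N * (v 0%N * w 1%N - v 1%N * w 0%N).

Lemma det3C12 u v w : det3 v u w = - det3 u v w.
Proof. by rewrite /det3; ring. Qed.

Lemma det3C23 u v w : det3 u w v = - det3 u v w.
Proof. by rewrite /det3; ring. Qed.

Lemma det3_eq12 u w : det3 u u w = 0.
Proof. by rewrite /det3; ring. Qed.

Lemma det3_eq23 u v : det3 u v v = 0.
Proof. by rewrite /det3; ring. Qed.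

Lemma det_mx33 (m : nat -> nat -> R) :
  \det (\matrix_(i < 3, j < 3) m i j) = det3 (m 0%N) (m 1%N) (m 2%N).
Proof.
rewrite (expand_det_row _ 0) !big_ord_recl big_ord0 /cofactor.
rewrite !(expand_det_row _ 0) !big_ord_recl !big_ord0 /cofactor !det_mx11 !mxE /=.
by rewrite /bump /= /det3; ring.
Qed.

End Det3.

Section Triform.
Context {R : comNzRingType} {K : eqType}.
Implicit Types (u v w h : K -> nat -> R).

Definition int_scalar (z : Z) : R := (int_of_Z z)%:~R.

Lemma int_scalarD a b : int_scalar (Z.add a b) = int_scalar a + int_scalar b.
Proof. by rewrite /int_scalar -intrD -(rmorphD int_of_Z). Qed.

Lemma int_scalarM a b : int_scalar (Z.mul a b) = int_scalar a * int_scalar b.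
Proof. by rewrite /int_scalar -intrM -(rmorphM int_of_Z). Qed.

Lemma int_scalarN a : int_scalar (Z.opp a) = - int_scalar a.
Proof. by rewrite /int_scalar -mulrNz -(rmorphN int_of_Z). Qed.

Lemma int_scalarB a b : int_scalar (Z.sub a b) = int_scalar a - int_scalar b.
Proof. by rewrite int_scalarD int_scalarN. Qed.

Lemma int_scalar_nat n : int_scalar (Z.of_nat n) = n%:R.
Proof.
rewrite /int_scalar (_ : int_of_Z _ = n%:Z)//.
by apply: (can_inj Z_of_intK); rewrite int_of_ZK.
Qed.

(** A term (c, (i, j, k)) stands for c times the determinant of the vectors
    attached to i, j and k. *)
Definition term := (Z * (K * K * K))%type.

Definition triform (s : seq term) u v w : R :=
  \sum_(t <- s) int_scalar t.1 * det3 (u t.2.1.1) (v t.2.1.2) (w t.2.2).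

Variable le : rel K.

Definition swap12 (t : term) : term :=
  let: (c, (i, j, k)) := t in if le i j then t else (Z.opp c, (j, i, k)).
Definition swap23 (t : term) : term :=
  let: (c, (i, j, k)) := t in if le j k then t else (Z.opp c, (i, k, j)).

Definition proper_term (t : term) :=
  let: (c, (i, j, k)) := t in [&& c != Z0, i != j & j != k].

Definition term_le (t t' : term) :=
  let: (_, (i, j, k)) := t in let: (_, (i', j', k')) := t' in
  if i == i' then if j == j' then le k k' else le j j' else le i i'.

Definition insert_term (t : term) (s : seq term) : seq term :=
  if s is t' :: s' then
    if t.2 == t'.2 then (Z.add t.1 t'.1, t.2) :: s' else t :: s
  else [:: t].

(** Sorts the indices of each term by antisymmetry, collects equal terms and
    drops the zero ones.  When the three arguments coincide this does not change
    the value, so cancellations can be decided by evaluating it. *)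
Definition normalize (s : seq term) : seq term :=
  seq.filter proper_term (foldr insert_term [::] (sort term_le
    (seq.filter proper_term [seq swap12 (swap23 (swap12 t)) | t <- s]))).

Lemma triform_cons t s u v w :
  triform (t :: s) u v w =
  int_scalar t.1 * det3 (u t.2.1.1) (v t.2.1.2) (w t.2.2) + triform s u v w.
Proof. by rewrite /triform big_cons. Qed.

Lemma triform_normalize s u : triform (normalize s) u u u = triform s u u u.
Proof.
have filterE r : triform (seq.filter proper_term r) u u u = triform r u u u.
  rewrite /triform big_filter big_mkcond /=; apply: eq_bigr => -[c [[i j] k]] _.
  case: ifPn => //=; rewrite !negb_and !negbK => /or3P[] /eqP ->.
  - by rewrite mul0r.
  - by rewrite det3_eq12 mulr0.
  - by rewrite det3_eq23 mulr0.
pose value (t : term) := int_scalar t.1 * det3 (u t.2.1.1) (u t.2.1.2) (u t.2.2).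
have swap12E t : value (swap12 t) = value t.
  by rewrite /value; case: t => c [[i j] k] /=; case: ifP => //= _;
    rewrite int_scalarN det3C12 mulrNN.
have swap23E t : value (swap23 t) = value t.
  by rewrite /value; case: t => c [[i j] k] /=; case: ifP => //= _;
    rewrite int_scalarN det3C23 mulrNN.
have insertE r : triform (foldr insert_term [::] r) u u u = triform r u u u.
  elim: r => //= t r IH; rewrite triform_cons -IH.
  case: (foldr _ _ r) => [|t' r'] /=; first by rewrite triform_cons.
  case: ifP => [/eqP tt'|_]; last by rewrite triform_cons.
  by rewrite !triform_cons /= -tt' int_scalarD mulrDl addrA.
rewrite /normalize filterE insertE /triform (perm_big _ (permEl (perm_sort _ _))) /=.
rewrite -[LHS]/(triform _ u u u) filterE /triform big_map.
by apply: eq_bigr => t _; rewrite -/(value _) swap12E swap23E swap12E.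
Qed.

(** The first and second order parts of the cubic form of s at u in the
    direction h; see triform_line. *)
Definition triform1 s u h := triform s h u u + triform s u h u + triform s u u h.
Definition triform2 s u h := triform s h h u + triform s h u h + triform s u h h.

Lemma triform_line s u h t :
  let v k c := u k c + t * h k c in
  triform s v v v = triform s u u u + t * triform1 s u h
    + t ^+ 2 * triform2 s u h + t ^+ 3 * triform s h h h.
Proof.
rewrite /triform1 /triform2 /triform -!big_split /= !mulr_sumr -!big_split /=.
by apply: eq_bigr => -[c [[i j] k]] _ /=; rewrite /det3; ring.
Qed.

End Triform.

Lemma triform_map (R : comNzRingType) (K L : eqType) (f : K -> L)
    (s : seq (@term K)) (u v w : L -> nat -> R) :
  triform [seq (t.1, (f t.2.1.1, f t.2.1.2, f t.2.2)) | t <- s] u v w =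
  triform s (u \o f) (v \o f) (w \o f).
Proof. by rewrite /triform big_map. Qed.

Lemma triformZ (R : comNzRingType) (K : eqType) (s : seq (@term K))
    (a b c : R) (u v w : K -> nat -> R) :
  triform s (fun k i => a * u k i) (fun k i => b * v k i) (fun k i => c * w k i) =
  a * b * c * triform s u v w.
Proof.
rewrite /triform mulr_sumr; apply: eq_bigr => -[z [[i j] k]] _ /=.
by rewrite /det3; ring.
Qed.

Section IntegerEvaluation.
Context {K : eqType}.
Implicit Types (s : seq (@term K)) (u v w h : K -> nat -> Z).

Definition zdet3 (x y z : nat -> Z) : Z :=
  (x 0%N * (y 1%N * z 2%N - y 2%N * z 1%N) - x 1%N * (y 0%N * z 2%N - y 2%N * z 0%N)
   + x 2%N * (y 0%N * z 1%N - y 1%N * z 0%N))%BinZ.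

Definition zsum (l : seq Z) : Z := foldr Z.add Z0 l.

Definition ztriform s u v w : Z :=
  zsum [seq Z.mul t.1 (zdet3 (u t.2.1.1) (v t.2.1.2) (w t.2.2)) | t <- s].

Definition ztriform1 s u h : Z :=
  Z.add (Z.add (ztriform s h u u) (ztriform s u h u)) (ztriform s u u h).
Definition ztriform2 s u h : Z :=
  Z.add (Z.add (ztriform s h h u) (ztriform s h u h)) (ztriform s u h h).

Variable R : comNzRingType.
Let zr : Z -> R := int_scalar.

Lemma int_scalar_sum (I : Type) (f : I -> Z) (l : seq I) :
  zr (zsum [seq f i | i <- l]) = \sum_(i <- l) zr (f i).
Proof.
elim: l => [|i l IH]; first by rewrite big_nil.
by rewrite big_cons /= /zr int_scalarD -/zr IH.
Qed.

Lemma int_scalar_det3 x y z :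
  zr (zdet3 x y z) = det3 (zr \o x) (zr \o y) (zr \o z).
Proof. by rewrite /zr !(int_scalarD, int_scalarB, int_scalarM). Qed.

Lemma int_scalar_triform s u v w :
  zr (ztriform s u v w) =
  triform s (fun k i => zr (u k i)) (fun k i => zr (v k i)) (fun k i => zr (w k i)).
Proof.
rewrite int_scalar_sum; apply: eq_bigr => t _.
by rewrite /zr int_scalarM -/zr int_scalar_det3.
Qed.

Lemma int_scalar_triform1 s u h : zr (ztriform1 s u h) =
  triform1 s (fun k i => zr (u k i)) (fun k i => zr (h k i)).
Proof. by rewrite /zr !int_scalarD -/zr !int_scalar_triform. Qed.

Lemma int_scalar_triform2 s u h : zr (ztriform2 s u h) =
  triform2 s (fun k i => zr (u k i)) (fun k i => zr (h k i)).
Proof. by rewrite /zr !int_scalarD -/zr !int_scalar_triform. Qed.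

End IntegerEvaluation.

Section RowExpansion.
Context {R : comNzRingType}.

Lemma det3_suml (I : Type) (r : seq I) (x : I -> R) (N : I -> nat -> R) v w :
  det3 (fun c => \sum_(k <- r) x k * N k c) v w =
  \sum_(k <- r) x k * det3 (N k) v w.
Proof.
elim: r => [|k r IH].
  by rewrite big_nil /det3 !big_nil; ring.
rewrite big_cons -IH /det3 !big_cons; ring.
Qed.

Lemma det3_summ (I : Type) (r : seq I) (x : I -> R) (N : I -> nat -> R) u w :
  det3 u (fun c => \sum_(k <- r) x k * N k c) w =
  \sum_(k <- r) x k * det3 u (N k) w.
Proof.
elim: r => [|k r IH].
  by rewrite big_nil /det3 !big_nil; ring.
rewrite big_cons -IH /det3 !big_cons; ring.
Qed.

Lemma det3_sumr (I : Type) (r : seq I) (x : I -> R) (N : I -> nat -> R) u v :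
  det3 u v (fun c => \sum_(k <- r) x k * N k c) =
  \sum_(k <- r) x k * det3 u v (N k).
Proof.
elim: r => [|k r IH].
  by rewrite big_nil /det3 !big_nil; ring.
rewrite big_cons -IH /det3 !big_cons; ring.
Qed.

Definition triples n : seq (nat * nat * nat) :=
  [seq (ij, k) | ij <- [seq (i, j) | i <- iota 0 n, j <- iota 0 n], k <- iota 0 n].

Lemma big_triples n (F : nat -> nat -> nat -> R) :
  \sum_(t <- triples n) F t.1.1 t.1.2 t.2 =
  \sum_(i <- iota 0 n) \sum_(j <- iota 0 n) \sum_(k <- iota 0 n) F i j k.
Proof. by rewrite big_allpairs_dep big_allpairs_dep. Qed.

Lemma det3_sum n (x y z : nat -> R) (N : nat -> nat -> R) :
  det3 (fun c => \sum_(k <- iota 0 n) x k * N k c)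
       (fun c => \sum_(k <- iota 0 n) y k * N k c)
       (fun c => \sum_(k <- iota 0 n) z k * N k c) =
  \sum_(t <- triples n) x t.1.1 * y t.1.2 * z t.2 * det3 (N t.1.1) (N t.1.2) (N t.2).
Proof.
rewrite (big_triples n (fun i j k => x i * y j * z k * det3 (N i) (N j) (N k))).
rewrite det3_suml; apply: eq_bigr => i _.
rewrite det3_summ mulr_sumr; apply: eq_bigr => j _.
rewrite det3_sumr !mulr_sumr; apply: eq_bigr => k _.
by rewrite !mulrA.
Qed.

(** Expansion, as a trilinear form in the nodal values N, of the weighted sum of
    the determinants with rows i = 0, 1, 2 taken at the vertices a, b, c, where
    row i at vertex v is the combination of the N k with coefficients G v i k. *)
Definition expand_coef (W G : nat -> nat -> nat -> Z) (t : nat * nat * nat) : Z :=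
  zsum [seq (W a.1.1 a.1.2 a.2 *
             (G a.1.1 0%N t.1.1 * G a.1.2 1%N t.1.2 * G a.2 2%N t.2))%BinZ
       | a <- triples 4].

Definition expand_rows n W G : seq (@term nat) :=
  [seq (expand_coef W G t, t) | t <- triples n].

Lemma triform_expand_rows n W G (N : nat -> nat -> R) :
  triform (expand_rows n W G) N N N =
  \sum_(a <- triples 4) int_scalar (W a.1.1 a.1.2 a.2) *
    det3 (fun c => \sum_(k <- iota 0 n) int_scalar (G a.1.1 0%N k) * N k c)
         (fun c => \sum_(k <- iota 0 n) int_scalar (G a.1.2 1%N k) * N k c)
         (fun c => \sum_(k <- iota 0 n) int_scalar (G a.2 2%N k) * N k c).
Proof.
rewrite /triform /expand_rows big_map.
transitivity (\sum_(t <- triples n) \sum_(a <- triples 4)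
   int_scalar (W a.1.1 a.1.2 a.2 *
     (G a.1.1 0%N t.1.1 * G a.1.2 1%N t.1.2 * G a.2 2%N t.2))%BinZ *
   det3 (N t.1.1) (N t.1.2) (N t.2)).
  by apply: eq_bigr => t _; rewrite /expand_coef int_scalar_sum mulr_suml.
rewrite exchange_big; apply: eq_bigr => a _; rewrite det3_sum mulr_sumr.
by apply: eq_bigr => t _; rewrite !int_scalarM !mulrA.
Qed.

End RowExpansion.

(** * Integer computations on the mesh *)

Definition zcross (x y : nat -> Z) (c : nat) : Z :=
  let d := (c.+1 %% 3)%N in let d' := (c.+2 %% 3)%N in
  Z.sub (Z.mul (x d) (y d')) (Z.mul (x d') (y d)).

Definition zgradient (s : seq (@term nat)) (u : nat -> nat -> Z) (k c : nat) : Z :=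
  zsum [seq Z.mul t.1
      (Z.add (Z.add (if t.2.1.1 == k then zcross (u t.2.1.2) (u t.2.2) c else Z0)
                    (if t.2.1.2 == k then zcross (u t.2.2) (u t.2.1.1) c else Z0))
             (if t.2.2 == k then zcross (u t.2.1.1) (u t.2.1.2) c else Z0))
  | t <- s].

Section MeshData.
Local Open Scope nat_scope.

(** The integral of lambda_a lambda_b lambda_c over the simplex is the product of
    the factorials of its exponents divided by 6! = 720; the numerator is 6, 2
    or 1. *)
Definition weight_exact (a b c : nat) : Z :=
  if (a == b) && (b == c) then 6%BinZ
  else if [|| a == b, b == c | a == c] then 2%BinZ else 1%BinZ.

(** The error of the four-point rule on lambda_a lambda_b lambda_c is a common
    factor times 3, -1 or 1; see quad_weight.  It vanishes on
    lambda_a lambda_b (lambda_0 + lambda_1 + lambda_2 + lambda_3), as the rule is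
    exact in degree two. *)
Definition weight_defect (a b c : nat) : Z :=
  if (a == b) && (b == c) then 3%BinZ
  else if [|| a == b, b == c | a == c] then (-1)%BinZ else 1%BinZ.

Definition bary_slope (a i : nat) : Z :=
  if a is a'.+1 then if a' == i then 1%BinZ else Z0 else (-1)%BinZ.

Definition edge_ends : seq (nat * nat) :=
  [seq (a, b) | a <- iota 0 4, b <- iota a.+1 (3 - a)].

(** Derivative along xi_i, at vertex v, of the k-th shape function: the vertex
    functions lambda (2 lambda - 1) for k < 4, then the edge functions
    4 lambda_a lambda_b. *)
Definition shape_slope (v i k : nat) : Z :=
  if k < 4 then Z.mul (if k == v then 3%BinZ else (-1)%BinZ) (bary_slope k i)
  else let: (a, b) := nth (0, 0) edge_ends (k - 4) in
    Z.mul 4 (Z.add (if v == a then bary_slope b i else Z0)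
                   (if v == b then bary_slope a i else Z0)).

(* Evaluated once and for all: the computations below run through these lists
   for each of the 48 cells. *)
Definition exact_terms : seq (@term nat) := Eval vm_compute in
  normalize leq (expand_rows 10 weight_exact shape_slope).
Definition defect_terms : seq (@term nat) := Eval vm_compute in
  normalize leq (expand_rows 10 weight_defect shape_slope).

Lemma exact_termsE :
  exact_terms = normalize leq (expand_rows 10 weight_exact shape_slope).
Proof. by vm_compute. Qed.

Lemma defect_termsE :
  defect_terms = normalize leq (expand_rows 10 weight_defect shape_slope).
Proof. by vm_compute. Qed.

Definition node_rank (p : seq nat) : nat := foldl (fun n d => 5 * n + d) 0 p.
Definition node_le (p q : seq nat) : bool := node_rank p <= node_rank q.

Definition cell_terms (e : nat) : seq (@term (seq nat)) :=
  let t := cell_nodes e in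
  [seq (x.1, (nth [::] t x.2.1.1, nth [::] t x.2.1.2, nth [::] t x.2.2))
  | x <- exact_terms].

(** The reference position of a node multiplied by 4^6: the bump is a product of
    six multiples of 1/4. *)
Definition ref_z (p : seq nat) (c : nat) : Z :=
  let b i := Z.of_nat (nth 0 p i * (4 - nth 0 p i)) in
  Z.add (Z.mul 1024 (Z.of_nat (nth 0 p c)))
        (if c == 2 then Z.mul (b 0) (Z.mul (b 1) (b 2)) else Z0).

(** The witness multiplied by 3840 = 15 * 2^8, a common denominator. *)
Definition witness_z (p : seq nat) (c : nat) : Z :=
  nth Z0
    (if p == [:: 2; 1; 1] then [:: 0; -7680; -7905]%BinZ
     else if p == [:: 3; 1; 1] then [:: -3840; -3840; -3840]%BinZ
     else if p == [:: 3; 2; 1] then [:: 2560; 0; 2533]%BinZ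
     else [:: 0; 0; 0]%BinZ) c.

Definition free_node_nat (i : nat) : seq nat :=
  [:: (i %/ 27).+1; ((i %/ 9) %% 3).+1; ((i %/ 3) %% 3).+1].

(** Tabulated, so that the nodal values of a cell are computed once and not at
    each of their occurrences in a form. *)
Definition cell_field (e : nat) (u : seq nat -> nat -> Z) : nat -> nat -> Z :=
  let t := [seq [seq u p c | c <- iota 0 3] | p <- cell_nodes e] in
  fun k c => nth Z0 (nth [::] t k) c.

Definition boundary_term (t : @term (seq nat)) : bool :=
  [&& ~~ interior_node t.2.1.1, ~~ interior_node t.2.1.2 & ~~ interior_node t.2.2].

(** Discrete form of the fact that an exact volume is a boundary integral: a face
    shared by two cells contributes with opposite signs, and after normalization
    only triples of boundary nodes remain. *)
Lemma cell_terms_boundary :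
  all boundary_term (normalize node_le (flatten [seq cell_terms e | e <- iota 0 48])).
Proof. by vm_compute. Qed.

Definition term_bounded (t : @term nat) : bool :=
  [&& t.2.1.1 < 10, t.2.1.2 < 10 & t.2.2 < 10].

Lemma terms_bounded : all term_bounded exact_terms && all term_bounded defect_terms.
Proof. by vm_compute. Qed.

Lemma cell_nodes_wf :
  all (fun e => [&& size (cell_nodes e) == 10 &
    all (fun p => (size p == 3) && all (fun d => d <= 4) p) (cell_nodes e)]) (iota 0 48).
Proof. by vm_compute. Qed.

Lemma witness_kernel_z :
  all (fun e => ztriform1 exact_terms (cell_field e ref_z) (cell_field e witness_z) == Z0)
    (iota 0 48).
Proof. by vm_compute. Qed.

Lemma defect_stationary_z :
  all (fun e => let u := cell_field e ref_z in
    all (fun k => all (fun c => zgradient defect_terms u k c == Z0) (iota 0 3))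
      (iota 0 10)) (iota 0 48).
Proof. by vm_compute. Qed.

Lemma witness_second_order_z :
  (zsum [seq ztriform2 exact_terms (cell_field e ref_z) (cell_field e witness_z)
        | e <- iota 0 48] == Z0) &&
  (zsum [seq ztriform2 defect_terms (cell_field e ref_z) (cell_field e witness_z)
        | e <- iota 0 48] != Z0).
Proof. by vm_compute. Qed.

(** Column e of the Jacobian of the exact volumes at X, up to a common factor: the
    gradient of the e-th volume is nonzero only at the nodes of the cell. *)
Definition jacobian_column_z (e : nat) : seq Z :=
  let u := cell_field e ref_z in
  let t := [seq (nth [::] (cell_nodes e) k,
                 [seq zgradient exact_terms u k c | c <- iota 0 3]) | k <- iota 0 10] in
  [seq zsum [seq (if interior_node x.1 && (x.1 == free_node_nat i)
                  then nth Z0 x.2 (i %% 3) else Z0) | x <- t]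
  | i <- iota 0 81].

(** Row k of a 47 x 81 matrix modulo 7, its entries being the digits in base 7. *)
Definition left_inverse_digits : seq Z :=
  [:: 1820365391112132632860627717006315194976;
   4709551776076778865868750151091835878896;
   1247893931348601930390086808316446858;
   1820365391112132632860627717010229494823;
   4709551776076778865868750151095750178775;
   1285330808004335574089227000726175915605;
   298545804963010231008559110403988708530946256547200;
   1820365391112134078532599714760478264922;
   297703772622367925878572227789949165009121864145338;
   120907209707465614905121365295343011735933578939;
   246132532161962275262144405142330581536803730862;
   1820365391112133158559526625284470611167;
   3639482739795992515556119363649080741580;
   3639482739795992515556033057730247753705;
   3639482739795992515556026544075856111909;
   3639482739795992515556026544079851119002;
   2355399844285121924512210131835815666562;
   2355399844285121924512542328207650656987;
   21095030133657883437402256913593624813978609203874702780285525;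
   3960503453066786615624909806082363941066;
   4174517251307058641775941801836122423467;
   1045509973932270426737851217874649587024565539996592053;
   147665206056554618879888563012356956265276612383254346063446909;
   4709551784031972849119682367498458589650;
   2355399844285121924401950411055366000346;
   4174517195025426136539529678240032446455;
   4709551776076778865868750151097879574388;
   2355399845259227133085088421096639895628;
   4174517192968981807097349434819525098235;
   1820365391112132632860627717004249965934;
   7405566486724371447119202885318271697897252452470;
   1285330808007648922824321126197273531464;
   16264105110154672061758223866877005370649181240421482;
   1529990035407158372324618642873663774028213113434902;
   1285330808003546762891415135227380773519;
   1285330808548818483203842242886870139954;
   4174517192968981807097349438693269703333;
   3639482741257150366898655869212360577129;
   4174517193943087015780487943354764243525;
   4174517192968981807097349235421941680629;
   1820365391112132632861744677552491867498;
   1820365393168576990466366829653347414148;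
   1255133541777274939095495569330849909229958597029317306841;
   625777625058594958449411464162529056084214;
   4181068636100267785710552128910609182619;
   1255133541777274935447586005455020853097041836227987122486;
   1651652817794146610921161974101208308012187]%BinZ.

Definition left_inverse_z (k i : nat) : Z :=
  Z.modulo (Z.div (nth Z0 left_inverse_digits k) (Z.pow 7 (Z.of_nat i))) 7.

(** A certificate that the first 47 columns are independent, first over the field
    with seven elements and then over the rationals.  Working modulo a prime
    keeps its entries small. *)
Lemma left_inverse_mod7 :
  let L := [seq [seq left_inverse_z k i | i <- iota 0 81] | k <- iota 0 47] in
  let J := [seq jacobian_column_z e | e <- iota 0 47] in
  [seq [seq Z.modulo (zsum [seq Z.mul x.1 x.2 | x <- zip l j]) 7 | j <- J] | l <- L] =
  [seq [seq (if k == e then 1%BinZ else Z0) | e <- iota 0 47] | k <- iota 0 47].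
Proof. by vm_compute. Qed.

End MeshData.

(** * First variation of a trilinear form *)

Section Gradient.
Context {R : comNzRingType}.
Implicit Types (s : seq (@term nat)) (u h : nat -> nat -> R).

Definition cross (x y : nat -> R) (c : nat) : R :=
  x (c.+1 %% 3)%N * y (c.+2 %% 3)%N - x (c.+2 %% 3)%N * y (c.+1 %% 3)%N.

(** The cofactor of u_i in det (u_i, u_j, u_l) is the cross product of u_j and
    u_l, and cyclic permutations give the other two. *)
Definition gradient s u (k c : nat) : R :=
  \sum_(t <- s) int_scalar t.1 *
    ((if t.2.1.1 == k then cross (u t.2.1.2) (u t.2.2) c else 0)
     + (if t.2.1.2 == k then cross (u t.2.2) (u t.2.1.1) c else 0)
     + (if t.2.2 == k then cross (u t.2.1.1) (u t.2.1.2) c else 0)).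

Lemma int_scalar_gradient s (u : nat -> nat -> Z) k c :
  int_scalar (zgradient s u k c) = gradient s (fun k c => int_scalar (u k c)) k c :> R.
Proof.
rewrite int_scalar_sum; apply: eq_bigr => t _.
have zc x y : int_scalar (zcross x y c) =
    cross (fun c => int_scalar (x c)) (fun c => int_scalar (y c)) c :> R.
  by rewrite int_scalarB !int_scalarM.
have zif (b : bool) x : int_scalar (if b then x else Z0) =
    if b then int_scalar x else 0 :> R by case: b.
by rewrite int_scalarM !int_scalarD !zif !zc.
Qed.

Lemma gradientZ s a u k c :
  gradient s (fun k c => a * u k c) k c = a ^+ 2 * gradient s u k c.
Proof.
rewrite /gradient mulr_sumr; apply: eq_bigr => t _.
rewrite /cross; do 3 case: ifP => _; ring.
Qed.

Lemma triform1_gradient s u h : all term_bounded s ->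
  triform1 s u h = \sum_(k <- iota 0 10) \sum_(c <- iota 0 3) h k c * gradient s u k c.
Proof.
have pick (k : nat) (F : nat -> R) : (k < 10)%N ->
    \sum_(l <- iota 0 10) (if k == l then F l else 0) = F k.
  move=> k10; rewrite (bigD1_seq k) ?mem_iota ?iota_uniq//= eqxx big1 ?addr0// => l.
  by rewrite eq_sym => /negbTE ->.
have det3_cross x y z : det3 x y z = \sum_(c <- iota 0 3) x c * cross y z c.
  by rewrite /= !big_cons big_nil /det3 /cross /=; ring.
elim: s => [|t s IH] /=.
  move=> _; rewrite /triform1 /triform !big_nil !addr0 big1// => k _.
  by rewrite big1// => c _; rewrite /gradient big_nil mulr0.
case: t => z [[i j] l] /= /andP[/and3P[/= i10 j10 l10] bs].
transitivity (int_scalar z * (det3 (h i) (u j) (u l) + det3 (h j) (u l) (u i)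
   + det3 (h l) (u i) (u j)) + triform1 s u h).
  by rewrite /triform1 !triform_cons /= /det3; ring.
rewrite {}IH//; apply/esym.
transitivity (\sum_(k <- iota 0 10) (int_scalar z *
   ((if i == k then det3 (h k) (u j) (u l) else 0)
    + (if j == k then det3 (h k) (u l) (u i) else 0)
    + (if l == k then det3 (h k) (u i) (u j) else 0))
   + \sum_(c <- iota 0 3) h k c * gradient s u k c)).
  apply: eq_bigr => k _; rewrite !det3_cross.
  have sif (b : bool) (F : nat -> R) : (if b then \sum_(c <- iota 0 3) F c else 0) =
      \sum_(c <- iota 0 3) if b then F c else 0 by case: b => //; rewrite big1.
  rewrite !sif -!big_split /= mulr_sumr -big_split /=; apply: eq_bigr => c _.
  rewrite {1}/gradient big_cons /= -/(gradient s u k c).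
  by do 3 case: ifP => _; ring.
rewrite big_split /= -mulr_sumr !big_split /= .
by rewrite !(pick _ (fun k => det3 (h k) _ _)).
Qed.

End Gradient.

(** * Geometry of a quadratic cell *)

(** All the functions differentiated here are cubic polynomials along a line, so
    their derivatives are read off as coefficients of t. *)
Lemma is_derive_cubic (R : realType) (V : normedModType R) (f : V -> R) x v (a b c : R) :
  (forall t, f (x + t *: v) = f x + t * a + t ^+ 2 * b + t ^+ 3 * c) ->
  is_derive x v f a.
Proof.
move=> fE.
have cv : h^-1 *: ((f \o shift x) (h *: v) - f x) @[h --> (0 : R)^'] --> a.
  have : (fun h : R => a + h * b + h ^+ 2 * c) @ (0 : R)^' --> a.
    apply: cvg_within_filter.
    have pE : (fun h : R => a + h * b + h ^+ 2 * c) =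
        horner (a%:P + b *: 'X + c *: 'X^2).
      by apply/funext => h; rewrite !hornerE /=; ring.
    have p0 : (a%:P + b *: 'X + c *: 'X^2).[0] = a.
      by rewrite !hornerE /= !mulr0 !addr0.
    have := @continuous_horner R (a%:P + b *: 'X + c *: 'X^2) 0.
    by rewrite /prop_for /continuous_at p0 pE.
  apply: cvg_trans; apply: near_eq_cvg; near=> h.
  have h0 : h != 0 by near: h; exact: nbhs_dnbhs_neq.
  rewrite /= [h *: v + x]addrC fE /GRing.scale/=.
  by field.
by split; [apply/cvg_ex; exists a|exact/cvg_lim].
Unshelve. all: by end_near.
Qed.

Section CellGeometry.
Context {R : realType}.
Implicit Types (y h : 'rV[R]_81) (xi : 'rV[R]_3) (e : nat).

Definition node_field y (p : seq nat) (c : nat) : R := nodal_value y p 0 (inord c).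

Definition cell_values y e (k : nat) : nat -> R :=
  node_field y (nth [::] (cell_nodes e) k).

Definition slope_row y e (v i c : nat) : R :=
  \sum_(k <- iota 0 10) int_scalar (shape_slope v i k) * cell_values y e k c.

Definition vertex_bary xi (v : nat) : R := bary xi (inord v).

Lemma bary_line xi i a t :
  bary (xi + t *: delta_mx 0 i) a = bary xi a + t * int_scalar (bary_slope a i).
Proof.
rewrite /bary; case: unliftP => [j|] ->.
  rewrite !mxE eqxx /=; congr (_ + _ * _).
  by rewrite add0n -val_eqE /=; case: (_ == _).
have -> : \sum_(j < 3) (xi + t *: delta_mx 0 i) 0 j = \sum_(j < 3) xi 0 j + t.
  rewrite (eq_bigr (fun j => xi 0 j + t * (j == i)%:R)) => [|j _]; last by rewrite !mxE eqxx.
  rewrite big_split /= -mulr_sumr [X in t * X](_ : _ = 1) ?mulr1//.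
  by rewrite (bigD1 i)//= eqxx big1 ?addr0// => j /negbTE ->.
have -> : int_scalar (bary_slope (ord0 : 'I_4) i) = -1 :> R by [].
ring.
Qed.

Lemma bary_sum xi : bary xi 0 = 1 - bary xi 1 - bary xi (inord 2) - bary xi (inord 3).
Proof.
have lE (j : 'I_3) : bary xi (lift ord0 j) = xi 0 j by rewrite /bary liftK.
have -> : bary xi 0 = 1 - \sum_(j < 3) xi 0 j.
  by rewrite /bary; case: unliftP => // j /(congr1 val).
have -> : (1 : 'I_4) = lift ord0 (ord0 : 'I_3) by apply: val_inj.
have -> : inord 2 = lift ord0 (lift ord0 (ord0 : 'I_2)) :> 'I_4.
  by apply: val_inj; rewrite /= inordK.
have -> : inord 3 = lift ord0 (lift ord0 (lift ord0 (ord0 : 'I_1))) :> 'I_4.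
  by apply: val_inj; rewrite /= inordK.
by rewrite !big_ord_recl big_ord0 !lE; ring.
Qed.

Lemma cell_mapE y e xi (c : 'I_3) :
  let l v := vertex_bary xi v in let N k := cell_values y e k c in
  cell_map y e xi 0 c =
    l 0%N * (2 * l 0%N - 1) * N 0%N + l 1%N * (2 * l 1%N - 1) * N 1%N
  + l 2%N * (2 * l 2%N - 1) * N 2%N + l 3%N * (2 * l 3%N - 1) * N 3%N
  + 4 * (l 0%N * l 1%N * N 4%N + l 0%N * l 2%N * N 5%N + l 0%N * l 3%N * N 6%N
       + l 1%N * l 2%N * N 7%N + l 1%N * l 3%N * N 8%N + l 2%N * l 3%N * N 9%N).
Proof.
move=> l N.
have lE (a : 'I_4) : bary xi a = l a by rewrite /l /vertex_bary inord_val.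
have NE p : nodal_value y p 0 c = node_field y p c by rewrite /node_field inord_val.
rewrite /cell_map !mxE !summxE.
under eq_bigr do rewrite mxE lE NE.
under [X in _ + X]eq_bigr => a _.
  rewrite summxE big_mkcond /=.
  under eq_bigr do rewrite mxE !lE NE.
  over.
rewrite !big_ord_recl !big_ord0 /=.
have -> : bump 0 (bump 0 0) = 2%N by []; have -> : bump 0 (bump 0 (bump 0 0)) = 3%N by [].
have -> : bump 0 0 = 1%N by [].
rewrite /N /cell_values /=.
ring.
Qed.

Lemma slope_rowE y e v i c : (v < 4)%N ->
  let g a : R := int_scalar (bary_slope a i) in let N k := cell_values y e k c in
  let d a : R := (v == a)%:R in
  slope_row y e v i c =
    (4 * d 0%N - 1) * g 0%N * N 0%N + (4 * d 1%N - 1) * g 1%N * N 1%N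
  + (4 * d 2%N - 1) * g 2%N * N 2%N + (4 * d 3%N - 1) * g 3%N * N 3%N
  + 4 * ((d 0%N * g 1%N + d 1%N * g 0%N) * N 4%N + (d 0%N * g 2%N + d 2%N * g 0%N) * N 5%N
       + (d 0%N * g 3%N + d 3%N * g 0%N) * N 6%N + (d 1%N * g 2%N + d 2%N * g 1%N) * N 7%N
       + (d 1%N * g 3%N + d 3%N * g 1%N) * N 8%N + (d 2%N * g 3%N + d 3%N * g 2%N) * N 9%N).
Proof.
move=> v4 g N d.
have z4 : int_scalar 4 = 4 :> R by [].
have z3 : int_scalar 3 = 3 :> R by [].
have z1 : int_scalar (-1) = -1 :> R by [].
have zif (b : bool) x : int_scalar (if b then x else Z0) = b%:R * int_scalar x :> R.
  by case: b; rewrite ?mul1r ?mul0r.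
rewrite /slope_row /= !big_cons big_nil /shape_slope.
rewrite ![(_ < 4)%N]/=.
rewrite [nth _ _ (4 - 4)]/= [nth _ _ (5 - 4)]/= [nth _ _ (6 - 4)]/= [nth _ _ (7 - 4)]/=
  [nth _ _ (8 - 4)]/= [nth _ _ (9 - 4)]/=.
rewrite !(int_scalarM, int_scalarD, zif) z4.
have gE a : g a.+1 = (a == i)%:R * int_scalar 1.
  by rewrite /g /bary_slope zif.
rewrite -/(g 0%N) -/(d 0%N) -/(d 1%N) -/(d 2%N) -/(d 3%N).
have vif a : int_scalar (if a == v then 3%BinZ else (-1)%BinZ) = 4 * d a - 1.
  by rewrite /d eq_sym; case: eqP => _; rewrite ?z3 ?z1 /=; ring.
rewrite !vif -!gE /N; ring.
Qed.

(** The shape functions are quadratic, so that the derivative of the cell map is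
    affine in xi: it interpolates barycentrically its values at the vertices. *)
Lemma cell_map_line y e xi (i : 'I_3) t (c : 'I_3) :
  let f t := cell_map y e (xi + t *: delta_mx 0 i) 0 c in
  let D := \sum_(v <- iota 0 4) vertex_bary xi v * slope_row y e v i c in
  f t = f 0 + t * D + t ^+ 2 * (f 1 - f 0 - D).
Proof.
pose g a : R := int_scalar (bary_slope a i).
have lE s v : (v < 4)%N ->
    vertex_bary (xi + s *: delta_mx 0 i) v = vertex_bary xi v + s * g v.
  by move=> v4; rewrite /vertex_bary bary_line inordK.
have l0 : vertex_bary xi 0 =
    1 - vertex_bary xi 1 - vertex_bary xi 2 - vertex_bary xi 3.
  have e0 : inord 0 = 0 :> 'I_4 by apply: val_inj; rewrite /= inordK.
  have e1 : inord 1 = 1 :> 'I_4 by apply: val_inj; rewrite /= inordK.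
  by rewrite /vertex_bary e0 e1 bary_sum.
rewrite /= !cell_mapE !lE// !big_cons big_nil !slope_rowE//=.
rewrite l0 -/(g 0%N) -/(g 1%N) -/(g 2%N) -/(g 3%N).
move: (vertex_bary xi 1) (vertex_bary xi 2) (vertex_bary xi 3) => l1 l2 l3.
move: (g 0%N) (g 1%N) (g 2%N) (g 3%N) => g0 g1 g2 g3.
move: (cell_values y e 0 c) (cell_values y e 1 c) (cell_values y e 2 c)
  (cell_values y e 3 c) (cell_values y e 4 c) (cell_values y e 5 c)
  (cell_values y e 6 c) (cell_values y e 7 c) (cell_values y e 8 c)
  (cell_values y e 9 c) => N0 N1 N2 N3 N4 N5 N6 N7 N8 N9.
ring.
Qed.

End CellGeometry.

(** * Exact and four-point volumes of a cell *)

Section CellVolumes.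
Context {R : realType}.
Implicit Types (y h : 'rV[R]_81) (xi : 'rV[R]_3) (e : nat).

Lemma polynomial_fun_bary a : polynomial_fun (fun xi : 'rV[R]_3 => bary xi a).
Proof.
rewrite /bary; case: unlift => [i|]; first exact: polynomial_fun_coord.
apply: ring_closureB; first exact: ring_closure_cst.
by apply: ring_closure_sum => i _; exact: polynomial_fun_coord.
Qed.

Lemma polynomial_map_cell_map y e : polynomial_map (cell_map y e).
Proof.
move=> c; rewrite (_ : (fun _ => _) = fun xi =>
  \sum_(a < 4) (bary xi a * (2 * bary xi a - 1)) * nodal_value y (cell_vertex e a) 0 c
  + \sum_(a < 4) \sum_(b < 4 | (a < b)%N)
      (4 * bary xi a * bary xi b) * nodal_value y (edge_node e a b) 0 c); last first.
  apply/funext => xi; rewrite /cell_map !mxE !summxE; congr (_ + _).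
    by apply: eq_bigr => a _; rewrite mxE.
  apply: eq_bigr => a _; rewrite summxE; apply: eq_bigr => b _; by rewrite mxE.
apply: ring_closureD; apply: ring_closure_sum => a _.
  apply: ring_closureM; last exact: ring_closure_cst.
  apply: ring_closureM; first exact: polynomial_fun_bary.
  apply: ring_closureB; last exact: ring_closure_cst.
  exact/ring_closureZ/polynomial_fun_bary.
apply: ring_closure_sum => b _; apply: ring_closureM; last exact: ring_closure_cst.
apply: ring_closureM; last exact: polynomial_fun_bary.
exact/ring_closureZ/polynomial_fun_bary.
Qed.

Definition corner_det y e (a : nat * nat * nat) : R :=
  det3 (slope_row y e a.1.1 0) (slope_row y e a.1.2 1) (slope_row y e a.2 2).

(** The determinant is trilinear in the rows, each of which is a barycentric
    interpolation. *)
Lemma det_jacE y e xi : det_jac y e xi = \sum_(a <- triples 4)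
  (vertex_bary xi a.1.1 * vertex_bary xi a.1.2 * vertex_bary xi a.2) * corner_det y e a.
Proof.
pose m i c := \sum_(v <- iota 0 4) vertex_bary xi v * slope_row y e v i c.
have JE : 'J (cell_map y e) xi = \matrix_(i < 3, c < 3) m i c.
  apply/matrixP => i c; rewrite [RHS]mxE jacobian_coord; last first.
    exact/polynomial_map_differentiable/polynomial_map_cell_map.
  have [_ ->//] : is_derive xi (delta_mx 0 i) (fun x => cell_map y e x 0 c) (m i c).
  pose f t := cell_map y e (xi + t *: delta_mx 0 i) 0 c.
  apply: (@is_derive_cubic _ _ _ _ _ _ (f 1 - f 0 - m i c) 0) => t.
  by rewrite cell_map_line /f scale0r addr0 mulr0 addr0.
rewrite /det_jac JE det_mx33 /m.
rewrite (big_triples 4 (fun a b c => vertex_bary xi a * vertex_bary xi b *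
  vertex_bary xi c * corner_det y e (a, b, c))).
rewrite det3_suml; apply: eq_bigr => a _.
rewrite det3_summ mulr_sumr; apply: eq_bigr => b _.
rewrite det3_sumr !mulr_sumr; apply: eq_bigr => c _.
by rewrite !mulrA.
Qed.

Lemma mem_triples n t : t \in triples n ->
  [/\ (t.1.1 < n)%N, (t.1.2 < n)%N & (t.2 < n)%N].
Proof.
move=> /allpairsP[[ij k] /= [/allpairsP[[i j] /= [+ + ->]] + ->]] /=.
by rewrite !mem_iota.
Qed.

Definition exponent (v : nat) (a : nat * nat * nat) : nat :=
  (a.1.1 == v) + (a.1.2 == v) + (a.2 == v).

Lemma bary_point3 (x : R * R * R) v : (v < 4)%N ->
  vertex_bary (point3 x) v =
  simplex_monomial (v == 1%N) (v == 2%N) (v == 3%N) (v == 0%N) x.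
Proof.
move=> v4; rewrite /vertex_bary.
have p3 i : (i < 3)%N -> bary (point3 x) (inord i.+1) = [:: x.1.1; x.1.2; x.2]`_i.
  move=> i3; rewrite (_ : inord i.+1 = lift ord0 (Ordinal i3)).
    by rewrite /bary liftK mxE.
  by apply: val_inj; rewrite /= inordK.
rewrite /simplex_monomial.
have e0 : inord 0 = 0 :> 'I_4 by apply: val_inj; rewrite /= inordK.
have e1 : inord 1 = 1 :> 'I_4 by apply: val_inj; rewrite /= inordK.
case: v v4 => [_|[_|[_|[_|//]]]] /=; rewrite ?p3//= ?expr0 ?expr1 ?mulr1 ?mul1r//.
by rewrite e0 bary_sum -e1 !p3.
Qed.

Lemma volI_corner y e : volI y e = 720%:R^-1 *
  \sum_(a <- triples 4) int_scalar (weight_exact a.1.1 a.1.2 a.2) * corner_det y e a.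
Proof.
pose mono (a : nat * nat * nat) := @simplex_monomial R (exponent 1 a) (exponent 2 a)
  (exponent 3 a) (exponent 0 a).
have monoE (a : nat * nat * nat) x : a \in triples 4 ->
    vertex_bary (point3 x) a.1.1 * vertex_bary (point3 x) a.1.2 *
    vertex_bary (point3 x) a.2 = mono a x.
  move=> /mem_triples[a1 a2 a3]; rewrite !bary_point3// /mono /simplex_monomial.
  by rewrite /exponent !exprD; ring.
have monoI (a : nat * nat * nat) : a \in triples 4 ->
    \int[lebesgue3]_(x in parent_cell) mono a x =
    720%:R^-1 * int_scalar (weight_exact a.1.1 a.1.2 a.2).
  move=> at4; rewrite /Rintegral /mono simplex_monomial_integral /=.
  have : all (fun a => (Z.of_nat ((exponent 1 a)`! * (exponent 2 a)`! *
      (exponent 3 a)`! * (exponent 0 a)`!) == weight_exact a.1.1 a.1.2 a.2) &&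
    ((exponent 1 a + exponent 2 a + exponent 3 a + exponent 0 a + 3)`! == 720%N))
    (triples 4) by vm_compute.
  move=> /allP /(_ a at4) /andP[/eqP <- /eqP ->].
  by rewrite int_scalar_nat mulrC.
have lin (s : seq (nat * nat * nat)) :
    \int[lebesgue3]_(x in parent_cell) (\sum_(a <- s) corner_det y e a * mono a x) =
    \sum_(a <- s) corner_det y e a * \int[lebesgue3]_(x in parent_cell) mono a x.
  have mP := @measurable_parent_cell R.
  have int_mono a : lebesgue3.-integrable parent_cell
      (EFin \o (fun x => corner_det y e a * mono a x)).
    exact: (integrableZl mP _ (simplex_monomial_integrable _ _ _ _)).
  elim: s => [|a s IH].
    rewrite big_nil /Rintegral; under eq_integral do rewrite big_nil.
    by rewrite integral0.
  rewrite big_cons -IH -RintegralZl//; last exact: simplex_monomial_integrable.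
  rewrite -RintegralD//.
    by apply: eq_Rintegral => x _; rewrite big_cons.
  rewrite (_ : EFin \o _ = fun x => \sum_(a <- s) (corner_det y e a * mono a x)%:E)%E.
    exact: (integrable_sum mP _ (fun a _ => int_mono a)).
  by apply/funext => x /=; rewrite sumEFin.
transitivity (\int[lebesgue3]_(x in parent_cell)
    (\sum_(a <- triples 4) corner_det y e a * mono a x)).
  rewrite /volI; apply: eq_Rintegral => x _; rewrite det_jacE !big_seq.
  by apply: eq_bigr => a at4; rewrite monoE// mulrC.
rewrite lin mulr_sumr !big_seq; apply: eq_bigr => a at4.
by rewrite monoI//; ring.
Qed.

Definition defect_factor : R := (3 * Num.sqrt 5 - 5) / (120 * 120).

Lemma defect_factor_gt0 : 0 < defect_factor.
Proof.
have s2 : (5 / 3 : R) < Num.sqrt 5.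
  have s0 : 0 <= Num.sqrt 5 :> R := sqrtr_ge0 _.
  have s5 : Num.sqrt 5 ^+ 2 = 5 :> R by rewrite sqr_sqrtr.
  by rewrite ltNge; apply/negP => s53; nra.
by rewrite /defect_factor divr_gt0 ?mulr_gt0 ?ltr0n// subr_gt0; lra.
Qed.

Lemma bary_quad_point q v : (v < 4)%N ->
  vertex_bary (@quad_point R q) v = if v == q then quad_alpha else quad_beta.
Proof.
move=> v4; rewrite /vertex_bary.
have l i : bary (@quad_point R q) (lift ord0 i) =
    if lift ord0 i == q then quad_alpha else quad_beta by rewrite /bary liftK mxE.
have [->|v0] := eqVneq v 0%N; last first.
  have v3 : (v.-1 < 3)%N by case: v v4 v0.
  have E : inord v = lift ord0 (Ordinal v3) :> 'I_4.
    by apply: val_inj; rewrite /= inordK// /bump add1n prednK// lt0n.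
  rewrite E l -E; congr (if _ then _ else _).
  by rewrite -val_eqE /= inordK.
have -> : inord 0 = ord0 :> 'I_4 by apply: val_inj; rewrite /= inordK.
rewrite /bary unlift_none !big_ord_recl big_ord0 !mxE.
have ab : quad_alpha = 1 - 3 * quad_beta :> R by rewrite /quad_alpha /quad_beta; field.
by case: q {l} => [[|[|[|[|//]]]] q4]; rewrite -!val_eqE /= ab; ring.
Qed.

(** Both sides depend only on the coincidences among a, b, c.  Each of the four
    sample points contributes alpha^n beta^(3 - n), where n counts the indices
    equal to the distinguished vertex. *)
Lemma quad_weight a b c : (a < 4)%N -> (b < 4)%N -> (c < 4)%N ->
  24^-1 * \sum_(q < 4) (vertex_bary (@quad_point R q) a *
     vertex_bary (@quad_point R q) b * vertex_bary (@quad_point R q) c) =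
  720%:R^-1 * int_scalar (weight_exact a b c)
  + defect_factor * int_scalar (weight_defect a b c).
Proof.
move=> a4 b4 c4; pose s : R := Num.sqrt 5.
have s2 : s * s = 5 by rewrite -expr2 sqr_sqrtr.
(* alpha^n beta^(3 - n) for n = 0, 1, 2, 3, reduced with s^2 = 5. *)
pose f n : R := nth 0 [:: (200 - 80 * s) / (20 * 20 * 20); 40 * s / (20 * 20 * 20);
  (200 + 80 * s) / (20 * 20 * 20); (800 + 360 * s) / (20 * 20 * 20)] n.
have pick (x y z : bool) : (if x then quad_alpha else quad_beta) *
    (if y then quad_alpha else quad_beta) * (if z then quad_alpha else quad_beta) =
    f (x + y + z)%N.
  have E (u v u' v' u'' v'' : R) :
      (u + v * s) / 20 * ((u' + v' * s) / 20) * ((u'' + v'' * s) / 20) =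
      ((u * u' + 5 * (v * v')) * u'' + 5 * ((u * v' + v * u') * v'')
       + ((u * u' + 5 * (v * v')) * v'' + (u * v' + v * u') * u'') * s) / (20 * 20 * 20).
    by rewrite -s2; field.
  have aE : quad_alpha = (5 + 3 * s) / 20 by [].
  have bE : quad_beta = (5 + -1 * s) / 20 by rewrite mulN1r.
  case: x; case: y; case: z => /=; rewrite ?aE ?bE E /f /=; by field.
under eq_bigr do rewrite !bary_quad_point// pick.
have z6 : int_scalar 6 = 6 :> R by [].
have z3 : int_scalar 3 = 3 :> R by [].
have z2 : int_scalar 2 = 2 :> R by [].
have z1 : int_scalar 1 = 1 :> R by [].
have zN1 : int_scalar (-1) = -1 :> R by [].
rewrite !big_ord_recl big_ord0 /=.
rewrite /defect_factor -/s /weight_exact /weight_defect.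
case: a a4 => [_|[_|[_|[_|//]]]]; case: b b4 => [_|[_|[_|[_|//]]]];
case: c c4 => [_|[_|[_|[_|//]]]]; rewrite /f /= ?z6 ?z3 ?z2 ?z1 ?zN1; by field.
Qed.

Definition exact_form y e : R :=
  triform exact_terms (cell_values y e) (cell_values y e) (cell_values y e).
Definition defect_form y e : R :=
  triform defect_terms (cell_values y e) (cell_values y e) (cell_values y e).

Lemma exact_form_corner y e : exact_form y e =
  \sum_(a <- triples 4) int_scalar (weight_exact a.1.1 a.1.2 a.2) * corner_det y e a.
Proof. by rewrite /exact_form exact_termsE triform_normalize triform_expand_rows. Qed.

Lemma defect_form_corner y e : defect_form y e =
  \sum_(a <- triples 4) int_scalar (weight_defect a.1.1 a.1.2 a.2) * corner_det y e a.
Proof. by rewrite /defect_form defect_termsE triform_normalize triform_expand_rows. Qed.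

Lemma volI_form y e : volI y e = 720%:R^-1 * exact_form y e.
Proof. by rewrite volI_corner exact_form_corner. Qed.

Lemma volQ_form y e :
  volQ y e = 720%:R^-1 * exact_form y e + defect_factor * defect_form y e.
Proof.
rewrite exact_form_corner defect_form_corner /volQ /Q4.
under eq_bigr do rewrite det_jacE.
rewrite exchange_big !mulr_sumr -big_split /= !big_seq; apply: eq_bigr => a at4.
have [a1 a2 a3] := mem_triples at4.
by rewrite -mulr_suml mulrA quad_weight// mulrDl -!mulrA.
Qed.

End CellVolumes.

(** * Scaled nodal values of the reference configuration and of the witness *)

Lemma gradient_eq (R : comNzRingType) s (u u' : nat -> nat -> R) k c :
  all term_bounded s ->
  (forall k c, (k < 10)%N -> (c < 3)%N -> u k c = u' k c) ->
  gradient s u k c = gradient s u' k c.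
Proof.
move=> bs uu'; rewrite /gradient !big_seq; apply: eq_bigr => t /(allP bs) /and3P[a b d].
have crossE i j : (i < 10)%N -> (j < 10)%N -> cross (u i) (u j) c = cross (u' i) (u' j) c.
  by move=> i10 j10; rewrite /cross !uu'// ltn_mod.
by congr (_ * (_ + _ + _)); case: ifP => // _; exact: crossE.
Qed.

Lemma triform_eq (R : comNzRingType) s (u u' v v' w w' : nat -> nat -> R) :
  all term_bounded s ->
  (forall k c, (k < 10)%N -> (c < 3)%N -> u k c = u' k c) ->
  (forall k c, (k < 10)%N -> (c < 3)%N -> v k c = v' k c) ->
  (forall k c, (k < 10)%N -> (c < 3)%N -> w k c = w' k c) ->
  triform s u v w = triform s u' v' w'.
Proof.
move=> bs uu' vv' ww'; rewrite /triform !big_seq.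
apply: eq_bigr => t /(allP bs) /and3P[a b d].
by rewrite /det3 !uu' ?vv' ?ww'.
Qed.

Section ReferenceValues.
Context {R : realType}.
Implicit Types (y h : 'rV[R]_81) (e : nat) (p : seq nat).
Local Notation X := (@ref_config R).
Local Notation z := (@witness R).

(** The boundary nodes do not move. *)
Definition node_dir h p (c : nat) : R :=
  if interior_node p then h 0 (free_index p (inord c : 'I_3)) else 0.

Definition cell_dirs h e (k : nat) : nat -> R :=
  node_dir h (nth [::] (cell_nodes e) k).

Lemma node_field_line y h t p c :
  node_field (y + t *: h) p c = node_field y p c + t * node_dir h p c.
Proof.
rewrite /node_field /nodal_value /node_dir; case: ifP => _; last by rewrite mulr0 addr0.
by rewrite !mxE.
Qed.

Lemma free_node_index p (c : 'I_3) : size p = 3%N -> interior_node p ->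
  free_node (free_index p c) = p /\ free_axis (free_index p c) = c.
Proof.
case: p => [|a [|b [|d []]]]// _ /=; rewrite andbT.
case: a => [|[|[|[|a]]]]//; case: b => [|[|[|[|b]]]]//; case: d => [|[|[|[|d]]]]// _;
  by case: c => [[|[|[|]]]]// c3; rewrite /free_node /free_axis /free_index inordK//=;
  split => //; apply: val_inj; rewrite /= inordK.
Qed.

Lemma node_field_ref p c : size p = 3%N ->
  node_field X p c = ref_position p 0 (inord c).
Proof.
move=> p3; rewrite /node_field /nodal_value; case: ifP => // pi.
by rewrite mxE mxE; have [-> ->] := free_node_index (inord c) p3 pi.
Qed.

Definition ref_scale : R := 4 ^+ 6.
Definition witness_scale : R := 15 * 2 ^+ 8.

Lemma node_field_refE p c : size p = 3%N -> all (fun d => d <= 4)%N p -> (c < 3)%N ->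
  node_field X p c = ref_scale^-1 * int_scalar (ref_z p c).
Proof.
case: p => [|a [|b [|d []]]]// _ /= /and4P[a4 b4 d4 _] c3; rewrite node_field_ref//.
have z1024 : int_scalar 1024 = 4 ^+ 5 :> R.
  have -> : 1024%BinZ = (4 * (4 * (4 * (4 * 4))))%BinZ by [].
  by rewrite !int_scalarM; have -> : int_scalar 4 = 4 :> R by []; ring.
have zif (q : bool) x : int_scalar (if q then x else Z0) =
    if q then int_scalar x else 0 :> R by case: q.
rewrite /ref_z int_scalarD zif !int_scalarM !int_scalar_nat z1024.
rewrite mxE !big_ord_recl big_ord0 -val_eqE /= inordK//.
rewrite !natrM !natrB// /ref_scale.
by case: c c3 => [|[|[|]]]// _ /=; field.
Qed.

Lemma node_dir_witnessE p c : size p = 3%N -> (c < 3)%N ->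
  node_dir z p c = witness_scale^-1 * int_scalar (witness_z p c).
Proof.
move=> p3 c3; rewrite /node_dir.
rewrite /witness_z /witness_scale.
have z0 : int_scalar 0 = 0 :> R by [].
have z2560 : int_scalar 2560 = 10 * 2 ^+ 8 :> R.
  have -> : 2560%BinZ = (10 * (16 * 16))%BinZ by [].
  by rewrite !int_scalarM; have -> : int_scalar 10 = 10 :> R by [];
    have -> : int_scalar 16 = 16 :> R by []; ring.
have z2533 : int_scalar 2533 = 2533 :> R.
  have -> : 2533%BinZ = (17 * 149)%BinZ by [].
  by rewrite !int_scalarM; have -> : int_scalar 17 = 17 :> R by [];
    have -> : int_scalar 149 = 149 :> R by []; ring.
have z3840 : int_scalar (-3840) = - (15 * 2 ^+ 8) :> R.
  have -> : (-3840)%BinZ = (- (15 * (16 * 16)))%BinZ by [].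
  by rewrite int_scalarN !int_scalarM; have -> : int_scalar 15 = 15 :> R by [];
    have -> : int_scalar 16 = 16 :> R by []; ring.
have z7680 : int_scalar (-7680) = - (30 * 2 ^+ 8) :> R.
  have -> : (-7680)%BinZ = (- (30 * (16 * 16)))%BinZ by [].
  by rewrite int_scalarN !int_scalarM; have -> : int_scalar 30 = 30 :> R by [];
    have -> : int_scalar 16 = 16 :> R by []; ring.
have z7905 : int_scalar (-7905) = - (15 * 527) :> R.
  have -> : (-7905)%BinZ = (- (15 * (17 * 31)))%BinZ by [].
  by rewrite int_scalarN !int_scalarM; have -> : int_scalar 15 = 15 :> R by [];
    have -> : int_scalar 17 = 17 :> R by []; have -> : int_scalar 31 = 31 :> R by []; ring.
case: ifPn => pi; last first.
  have [pE|_] := eqVneq p [:: 2; 1; 1]%N; first by rewrite pE in pi.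
  have [pE|_] := eqVneq p [:: 3; 1; 1]%N; first by rewrite pE in pi.
  have [pE|_] := eqVneq p [:: 3; 2; 1]%N; first by rewrite pE in pi.
  by case: c c3 => [|[|[|]]]// _ /=; rewrite z0 mulr0.
have [fn fa] := free_node_index (inord c) p3 pi; rewrite mxE fn fa inordK//.
rewrite /witness_value; case: (p == [:: 2; 1; 1]%N); last case: (p == [:: 3; 1; 1]%N);
  last case: (p == [:: 3; 2; 1]%N).
all: case: c c3 {fn fa} => [|[|[|c]]] c3; last by [].
all: rewrite [X in X = _]/= [X in _ * int_scalar X]/=.
all: rewrite ?z0 ?z2560 ?z2533 ?z3840 ?z7680 ?z7905; by field.
Qed.

End ReferenceValues.

(** * The volume maps and their Jacobians *)

Section VolumeMaps.
Context {R : realType}.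
Implicit Types (y h : 'rV[R]_81) (e : nat).

Lemma cell_values_line y h t e :
  cell_values (y + t *: h) e =
  (fun k c => cell_values y e k c + t * cell_dirs h e k c).
Proof.
by apply/funext => k; apply/funext => c; rewrite /cell_values node_field_line.
Qed.

Lemma exact_form_line y h t e :
  let u := cell_values y e in let w := cell_dirs h e in
  exact_form (y + t *: h) e = exact_form y e + t * triform1 exact_terms u w
    + t ^+ 2 * triform2 exact_terms u w + t ^+ 3 * triform exact_terms w w w.
Proof. by move=> u w; rewrite /exact_form cell_values_line triform_line. Qed.

Lemma defect_form_line y h t e :
  let u := cell_values y e in let w := cell_dirs h e in
  defect_form (y + t *: h) e = defect_form y e + t * triform1 defect_terms u w
    + t ^+ 2 * triform2 defect_terms u w + t ^+ 3 * triform defect_terms w w w.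
Proof. by move=> u w; rewrite /defect_form cell_values_line triform_line. Qed.

Lemma polynomial_triform s (u v w : 'rV[R]_81 -> nat -> nat -> R) :
  (forall k c, polynomial_fun (fun y => u y k c)) ->
  (forall k c, polynomial_fun (fun y => v y k c)) ->
  (forall k c, polynomial_fun (fun y => w y k c)) ->
  polynomial_fun (fun y => triform s (u y) (v y) (w y)).
Proof.
move=> pu pv pw; apply: ring_closure_sum => t _.
apply: ring_closureZ; rewrite /det3.
have minor a b c d : polynomial_fun
    (fun y => v y t.2.1.2 a * w y t.2.2 b - v y t.2.1.2 c * w y t.2.2 d).
  by apply: ring_closureB; apply: ring_closureM; (exact: pv || exact: pw).
apply: ring_closureD; last exact: (ring_closureM (pu _ _) (minor _ _ _ _)).
by apply: ring_closureB; apply: (ring_closureM (pu _ _) (minor _ _ _ _)).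
Qed.

Lemma polynomial_cell_values e k c : polynomial_fun (fun y => cell_values y e k c).
Proof.
rewrite /cell_values; set p := nth _ _ _.
have [pi|pi] := boolP (interior_node p); last first.
  rewrite (_ : (fun _ => _) = fun=> ref_position p 0 (inord c)).
    exact: ring_closure_cst.
  by apply/funext => y; rewrite /node_field /nodal_value (negbTE pi).
rewrite (_ : (fun _ => _) = fun y : 'rV[R]_81 => y 0 (free_index p (inord c : 'I_3))).
  exact: polynomial_fun_coord.
by apply/funext => y; rewrite /node_field /nodal_value pi mxE.
Qed.

Lemma polynomial_exact_form e : polynomial_fun (fun y => exact_form y e).
Proof. by apply: polynomial_triform; exact: polynomial_cell_values. Qed.

Lemma polynomial_defect_form e : polynomial_fun (fun y => defect_form y e).
Proof. by apply: polynomial_triform; exact: polynomial_cell_values. Qed.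

Lemma polynomial_gI : polynomial_map (@gI R).
Proof.
move=> e; rewrite (_ : (fun _ => _) =
    fun y => 720%:R^-1 * exact_form y e - volI ref_config e).
  apply: ring_closureB; last exact: ring_closure_cst.
  exact/ring_closureZ/polynomial_exact_form.
by apply/funext => y; rewrite mxE volI_form.
Qed.

Lemma polynomial_gQ : polynomial_map (@gQ R).
Proof.
move=> e; rewrite (_ : (fun _ => _) = fun y =>
    720%:R^-1 * exact_form y e + defect_factor * defect_form y e - volQ ref_config e).
  apply: ring_closureB; last exact: ring_closure_cst.
  apply: ring_closureD; apply: ring_closureZ; first exact: polynomial_exact_form.
  exact: polynomial_defect_form.
by apply/funext => y; rewrite mxE volQ_form.
Qed.

Lemma jacobian_row_cubic n m (f : 'rV[R]_n -> 'rV[R]_m) (x v : 'rV[R]_n) j a b c :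
  polynomial_map f ->
  (forall t, f (x + t *: v) 0 j = f x 0 j + t * a + t ^+ 2 * b + t ^+ 3 * c) ->
  (v *m 'J f x) 0 j = a.
Proof.
move=> pf fE; have df := polynomial_map_differentiable x pf.
rewrite -deriveEjacobian// derive_mx ?mxE; last exact: diff_derivable.
by have [] := @is_derive_cubic _ _ (fun x => f x 0 j) x v a b c fE.
Qed.

Lemma jacobian_gI y h (e : 'I_48) : (h *m 'J gI y) 0 e =
  720%:R^-1 * triform1 exact_terms (cell_values y e) (cell_dirs h e).
Proof.
set u := cell_values y e; set w := cell_dirs h e.
apply: (@jacobian_row_cubic _ _ _ _ _ _ _ (720%:R^-1 * triform2 exact_terms u w)
  (720%:R^-1 * triform exact_terms w w w)) => [|t]; first exact: polynomial_gI.
rewrite [LHS]mxE [X in _ = X + _ + _ + _]mxE !volI_form exact_form_line -/u -/w.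
move: (720%:R^-1 : R) (exact_form ref_config e) => r f.
move: (exact_form y e) (triform1 exact_terms u w) (triform2 exact_terms u w)
  (triform exact_terms w w w) => f0 f1 f2 f3.
by ring.
Qed.

(** The exact part contributes as in jacobian_gI; the second summand is what makes
    the four-point rule differ. *)
Lemma jacobian_gQ y h (e : 'I_48) : (h *m 'J gQ y) 0 e =
  720%:R^-1 * triform1 exact_terms (cell_values y e) (cell_dirs h e)
  + defect_factor * triform1 defect_terms (cell_values y e) (cell_dirs h e).
Proof.
set u := cell_values y e; set w := cell_dirs h e.
apply: (@jacobian_row_cubic _ _ _ _ _ _ _ (720%:R^-1 * triform2 exact_terms u w
    + defect_factor * triform2 defect_terms u w)
  (720%:R^-1 * triform exact_terms w w w + defect_factor * triform defect_terms w w w))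
  => [|t]; first exact: polynomial_gQ.
rewrite [LHS]mxE [X in _ = X + _ + _ + _]mxE !volQ_form exact_form_line defect_form_line.
rewrite -/u -/w.
move: (720%:R^-1 : R) (exact_form ref_config e) (defect_form ref_config e) => r f d.
move: (exact_form y e) (triform1 exact_terms u w) (triform2 exact_terms u w)
  (triform exact_terms w w w) => f0 f1 f2 f3.
move: (defect_form y e) (triform1 defect_terms u w) (triform2 defect_terms u w)
  (triform defect_terms w w w) => d0 d1 d2 d3.
by ring.
Qed.

End VolumeMaps.

(** * Variations at the reference configuration *)

Lemma mulmx_row_inj (R : pzRingType) n m (A B : 'M[R]_(n, m)) :
  (forall (h : 'rV_n) j, (h *m A) 0 j = (h *m B) 0 j) -> A = B.
Proof.
by move=> AB; apply/row_matrixP => i; rewrite !rowE; apply/rowP => j; exact: AB.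
Qed.

Section ReferenceGeometry.
Context {R : realType}.
Implicit Types (y h : 'rV[R]_81) (e : nat).
Local Notation X := (@ref_config R).
Local Notation z := (@witness R).
Local Notation zr := (@int_scalar R).

Lemma cell_node_wf e k : (e < 48)%N -> (k < 10)%N ->
  [/\ (k < size (cell_nodes e))%N, size (nth [::] (cell_nodes e) k) = 3%N
    & all (fun d => d <= 4)%N (nth [::] (cell_nodes e) k)].
Proof.
move=> e48 k10; have /allP /(_ e) := cell_nodes_wf.
rewrite mem_iota e48 => /(_ isT) /andP[/eqP s10 wf].
have ks : (k < size (cell_nodes e))%N by rewrite s10.
by have /andP[/eqP p3 p4] := all_nthP [::] wf k ks.
Qed.

Lemma cell_fieldE e (u : seq nat -> nat -> Z) k c :
  (e < 48)%N -> (k < 10)%N -> (c < 3)%N ->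
  cell_field e u k c = u (nth [::] (cell_nodes e) k) c.
Proof.
move=> e48 k10 c3; have [ks _ _] := cell_node_wf e48 k10.
rewrite /cell_field (nth_map [::])//.
by rewrite (nth_map 0%N) ?size_iota// nth_iota.
Qed.

Lemma cell_values_ref e k c : (e < 48)%N -> (k < 10)%N -> (c < 3)%N ->
  cell_values X e k c = ref_scale^-1 * zr (cell_field e ref_z k c).
Proof.
move=> e48 k10 c3; have [_ p3 p4] := cell_node_wf e48 k10.
by rewrite cell_fieldE// /cell_values node_field_refE.
Qed.

Lemma cell_dirs_witness e k c : (e < 48)%N -> (k < 10)%N -> (c < 3)%N ->
  cell_dirs z e k c = witness_scale^-1 * zr (cell_field e witness_z k c).
Proof.
move=> e48 k10 c3; have [_ p3 p4] := cell_node_wf e48 k10.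
by rewrite cell_fieldE// /cell_dirs node_dir_witnessE.
Qed.

Lemma triform1_ref s e : all term_bounded s -> (e < 48)%N ->
  triform1 s (cell_values X e) (cell_dirs z e) =
  ref_scale^-1 ^+ 2 * witness_scale^-1 *
    zr (ztriform1 s (cell_field e ref_z) (cell_field e witness_z)).
Proof.
move=> bs e48; rewrite int_scalar_triform1.
have X_ k c k10 c3 := @cell_values_ref e k c e48 k10 c3.
have z_ k c k10 c3 := @cell_dirs_witness e k c e48 k10 c3.
rewrite /triform1 (triform_eq bs z_ X_ X_) (triform_eq bs X_ z_ X_) (triform_eq bs X_ X_ z_).
rewrite !triformZ; move: ref_scale^-1 witness_scale^-1 => a b.
by move: (triform _ _ _ _) (triform _ _ _ _) (triform _ _ _ _) => t0 t1 t2; ring.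
Qed.

Lemma triform2_ref s e : all term_bounded s -> (e < 48)%N ->
  triform2 s (cell_values X e) (cell_dirs z e) =
  ref_scale^-1 * witness_scale^-1 ^+ 2 *
    zr (ztriform2 s (cell_field e ref_z) (cell_field e witness_z)).
Proof.
move=> bs e48; rewrite int_scalar_triform2.
have X_ k c k10 c3 := @cell_values_ref e k c e48 k10 c3.
have z_ k c k10 c3 := @cell_dirs_witness e k c e48 k10 c3.
rewrite /triform2 (triform_eq bs z_ z_ X_) (triform_eq bs z_ X_ z_) (triform_eq bs X_ z_ z_).
rewrite !triformZ; move: ref_scale^-1 witness_scale^-1 => a b.
by move: (triform _ _ _ _) (triform _ _ _ _) (triform _ _ _ _) => t0 t1 t2; ring.
Qed.

Lemma gradient_ref s e k c : all term_bounded s -> (e < 48)%N ->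
  gradient s (cell_values X e) k c =
  ref_scale^-1 ^+ 2 * zr (zgradient s (cell_field e ref_z) k c).
Proof.
move=> bs e48; have X_ k c k10 c3 := @cell_values_ref e k c e48 k10 c3.
by rewrite (gradient_eq _ _ bs X_) gradientZ int_scalar_gradient.
Qed.

Lemma exact_bounded : all term_bounded exact_terms.
Proof. by have /andP[] := terms_bounded. Qed.

Lemma defect_bounded : all term_bounded defect_terms.
Proof. by have /andP[] := terms_bounded. Qed.

(** At X two of the three components are affine on each cell, so the cofactors of
    the Jacobian have degree at most one and the first variation of its
    determinant has degree at most two: the four-point rule makes no error on
    it.  The computation checks that the gradient of the defect vanishes. *)
Lemma defect_stationary e w : (e < 48)%N ->
  triform1 defect_terms (cell_values X e) w = 0.
Proof.
move=> e48; rewrite triform1_gradient ?defect_bounded//.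
have /allP /(_ e) := defect_stationary_z; rewrite mem_iota => /(_ e48) /allP st.
rewrite big_seq big1// => k k10; rewrite big_seq big1// => c c3.
have /allP /(_ c c3) /eqP g0 := st k k10.
rewrite (gradient_ref _ _ defect_bounded e48).
by rewrite g0 mulrA mulr0.
Qed.

Lemma jacobian_ref : 'J (@gQ R) X = 'J (@gI R) X.
Proof.
apply: mulmx_row_inj => h e.
apply: etrans (jacobian_gQ X _ e) _; apply/esym.
apply: etrans (jacobian_gI X _ e) _.
by rewrite (defect_stationary _ (ltn_ord e)) mulr0 addr0.
Qed.

Lemma witness_kernel : z *m 'J (@gI R) X = 0.
Proof.
apply/rowP => e; apply: etrans (jacobian_gI X z e) _.
rewrite (triform1_ref exact_bounded (ltn_ord e)).
have /allP /(_ e) := witness_kernel_z; rewrite mem_iota => /(_ (ltn_ord e)) /eqP ->.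
by rewrite [RHS]mxE mulrA mulr0.
Qed.

Lemma int_scalar_neq0 a : a != Z0 -> zr a != 0.
Proof.
move=> a0; rewrite /int_scalar intr_eq0; apply: contra a0 => /eqP i0; apply/eqP.
by rewrite -[LHS]int_of_ZK i0.
Qed.

(** The first sum vanishes because the total exact volume is constant; the second
    one is the obstruction for which the witness is chosen. *)
Lemma witness_second_order :
  \sum_(e < 48) triform2 exact_terms (cell_values X e) (cell_dirs z e) = 0 /\
  \sum_(e < 48) triform2 defect_terms (cell_values X e) (cell_dirs z e) != 0.
Proof.
have sumE s : all term_bounded s ->
    \sum_(e < 48) triform2 s (cell_values X e) (cell_dirs z e) =
    ref_scale^-1 * witness_scale^-1 ^+ 2 *
    zr (zsum [seq ztriform2 s (cell_field e ref_z) (cell_field e witness_z) | e <- iota 0 48]).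
  move=> bs; rewrite int_scalar_sum mulr_sumr.
  rewrite -[iota 0 48]/(index_iota 0 48) big_mkord.
  by apply: eq_bigr => e _; rewrite triform2_ref.
have /andP[/eqP ez dz] := witness_second_order_z.
rewrite !sumE; try exact: exact_bounded; try exact: defect_bounded.
split; first by rewrite ez mulrA mulr0.
have s0 : ref_scale != 0 :> R by rewrite /ref_scale expf_neq0.
have w0 : witness_scale != 0 :> R by rewrite /witness_scale mulf_neq0// expf_neq0.
apply: mulf_neq0; last exact: int_scalar_neq0 dz.
move: ref_scale witness_scale s0 w0 {ez dz sumE} => a b a0 b0.
by rewrite mulf_neq0 ?invr_eq0// expf_neq0 ?invr_eq0.
Qed.

End ReferenceGeometry.

(** * The total exact volume *)

Section TotalVolume.
Context {R : realType}.
Implicit Types (y : 'rV[R]_81).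

Lemma exact_form_nodes y e : exact_form y e =
  triform (cell_terms e) (node_field y) (node_field y) (node_field y).
Proof.
rewrite /cell_terms (triform_map (fun k => nth [::] (cell_nodes e) k)).
by rewrite /exact_form.
Qed.

(** By cell_terms_boundary the total is a form in the boundary nodes, which are
    fixed. *)
Lemma total_exact_form y y' :
  \sum_(e < 48) exact_form y e = \sum_(e < 48) exact_form y' e.
Proof.
pose s := normalize node_le (flatten [seq cell_terms e | e <- iota 0 48]).
have totalE (x : 'rV[R]_81) : \sum_(e < 48) exact_form x e =
    triform s (node_field x) (node_field x) (node_field x).
  rewrite triform_normalize /triform big_flatten big_map.
  rewrite -[iota 0 48]/(index_iota 0 48) big_mkord.
  apply: eq_bigr => e _. exact: exact_form_nodes.
have bs : all boundary_term s := cell_terms_boundary; clearbody s.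
rewrite 2!totalE /triform 2!big_seq; apply: eq_bigr => t ts.
have /allP /(_ t ts) /and3P[b1 b2 b3] := bs.
have fixed p : ~~ interior_node p -> node_field y p = node_field y' p.
  by move=> pb; apply/funext => c; rewrite /node_field /nodal_value (negbTE pb).
by congr (_ * det3 _ _ _); exact: fixed.
Qed.

Lemma gI_total y : gI y *m const_mx 1 = 0 :> 'rV_1.
Proof.
apply/rowP => j; rewrite [LHS]mxE [RHS]mxE.
transitivity (\sum_(e < 48) (720%:R^-1 * exact_form y e
    - 720%:R^-1 * exact_form ref_config e)).
  by apply: eq_bigr => e _; rewrite !mxE mulr1 !volI_form.
by rewrite sumrB -!mulr_sumr (total_exact_form y ref_config) subrr.
Qed.

End TotalVolume.

(** * Rank of the integer Jacobian *)

Lemma mx_delta_rows (R : pzRingType) n m (A B : 'M[R]_(n, m)) :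
  (forall i j, (delta_mx 0 i *m A : 'rV_m) 0 j = B i j) -> A = B.
Proof. by move=> AB; apply/matrixP => i j; rewrite -AB -rowE mxE. Qed.

(** The product of L with r columns of M is an integer matrix whose determinant is
    1 modulo p, hence nonzero in characteristic zero. *)
Lemma rank_mod_prime (F : numFieldType) p n m r (M : 'M[int]_(n, m))
    (f : 'I_r -> 'I_m) (L : 'M[int]_(r, n)) :
  prime p -> map_mx (intr : int -> 'F_p) (L *m colsub f M) = 1%:M ->
  (r <= \rank (map_mx (intr : int -> F) M))%N.
Proof.
move=> pp LM; set P := L *m colsub f M in LM.
have P0 : \det P != 0.
  apply/eqP => /(congr1 (intr : int -> 'F_p)); rewrite -det_map_mx LM det1 => /eqP.
  by rewrite oner_eq0.
have : map_mx (intr : int -> F) P \in unitmx.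
  by rewrite unitmxE det_map_mx unitfE intr_eq0.
move=> /mxrank_unit {1}<-; rewrite map_mxM /= map_mxsub.
have -> : colsub f (map_mx intr M) = map_mx intr M *m colsub f 1%:M :> 'M[F]_(n, r).
  by rewrite mulmx_colsub mulmx1.
exact: leq_trans (mxrankM_maxr _ _) (mxrankM_maxl _ _).
Qed.

(** Reads one entry of an equality of tables without evaluating the tables. *)
Lemma table_entry (S T U : Type) (g : S -> T -> U) (h : nat -> nat -> U)
    (a : nat -> S) (b : nat -> T) n m :
  [seq [seq g x y | y <- [seq b j | j <- iota 0 m]] | x <- [seq a i | i <- iota 0 n]] =
  [seq [seq h i j | j <- iota 0 m] | i <- iota 0 n] ->
  forall i j, (i < n)%N -> (j < m)%N -> g (a i) (b j) = h i j.
Proof.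
move=> gh i j i_n jm; have x0 := h i j.
move: gh => /(congr1 (fun s => nth x0 (nth [::] s i) j)).
rewrite (nth_map (a 0%N)) ?size_map ?size_iota// (nth_map (b 0%N)) ?size_map ?size_iota//.
by rewrite !(nth_map 0%N) ?size_iota// !nth_iota.
Qed.

Lemma left_inverse_entry k e : (k < 47)%N -> (e < 47)%N ->
  Z.modulo (zsum [seq Z.mul x.1 x.2
    | x <- zip [seq left_inverse_z k i | i <- iota 0 81] (jacobian_column_z e)]) 7 =
  if k == e then 1%BinZ else Z0.
Proof.
exact: (@table_entry _ _ _ (fun l j => Z.modulo (zsum [seq Z.mul x.1 x.2 | x <- zip l j]) 7)
  (fun k e => if k == e then 1%BinZ else Z0)
  (fun k => [seq left_inverse_z k i | i <- iota 0 81]) jacobian_column_z 47 47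
  left_inverse_mod7).
Qed.

Lemma size_jacobian_column e : size (jacobian_column_z e) = 81%N.
Proof. by rewrite size_map size_iota. Qed.

Lemma left_inverse_dot (T : comNzRingType) k e :
  \sum_(i < 81) int_scalar (left_inverse_z k i) * int_scalar (nth Z0 (jacobian_column_z e) i) =
  int_scalar (zsum [seq Z.mul x.1 x.2
    | x <- zip [seq left_inverse_z k i | i <- iota 0 81] (jacobian_column_z e)]) :> T.
Proof.
have sz : size (jacobian_column_z e) = 81%N := size_jacobian_column e.
set l := [seq left_inverse_z k i | i <- iota 0 81].
have sl : size l = 81%N by rewrite size_map size_iota.
have lE (i : 'I_81) : nth Z0 l i = left_inverse_z k i.
  by rewrite (nth_map 0%N) ?size_iota// nth_iota.
move: l (jacobian_column_z e) sl lE sz => l j sl lE sz.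
rewrite int_scalar_sum (big_nth (Z0, Z0)) size_zip sl sz minnn big_mkord.
by apply: eq_bigr => i _; rewrite nth_zip ?sl ?sz//= int_scalarM lE.
Qed.

Definition jacobian_z : 'M[int]_(81, 48) :=
  \matrix_(i, e) int_of_Z (nth Z0 (jacobian_column_z e) i).

Lemma rank_jacobian_z (F : numFieldType) :
  (47 <= \rank (map_mx (intr : int -> F) jacobian_z))%N.
Proof.
pose L : 'M[int]_(47, 81) := \matrix_(k, i) int_of_Z (left_inverse_z k i).
apply: (@rank_mod_prime _ 7 _ _ _ _ (widen_ord (leqnSn 47)) L); first by [].
apply/matrixP => k e; rewrite [LHS]mxE [RHS]mxE.
transitivity (int_scalar (zsum [seq Z.mul x.1 x.2
    | x <- zip [seq left_inverse_z k i | i <- iota 0 81] (jacobian_column_z e)]) : 'F_7).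
  rewrite -left_inverse_dot mxE rmorph_sum; apply: eq_bigr => i _.
  by rewrite rmorphM [L _ _]mxE [colsub _ _ _ _]mxE [jacobian_z _ _]mxE.
have := left_inverse_entry (ltn_ord k) (ltn_ord e).
move: (zsum _) => a a7.
have seven : int_scalar 7 = 0 :> 'F_7 by apply: val_inj.
rewrite (Z.div_mod a 7)// int_scalarD int_scalarM seven mul0r add0r a7.
by rewrite -val_eqE; case: (_ == _).
Qed.

(** * Rank of the Jacobian at the reference configuration *)

Lemma const1_neq0 (R : realType) : (const_mx 1 : 'cV[R]_48) != 0.
Proof. by apply/eqP => /matrixP /(_ 0 0) /eqP; rewrite !mxE oner_eq0. Qed.

Section ReferenceRank.
Context {R : realType}.
Local Notation X := (@ref_config R).

(** Moving the i-th coordinate affects one node and one axis. *)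
Lemma node_dir_delta (i : 'I_81) p (g : nat -> R) : size p = 3%N ->
  \sum_(c <- iota 0 3) node_dir (delta_mx 0 i) p c * g c =
  if interior_node p && (p == free_node i) then g (i %% 3)%N else 0.
Proof.
move=> p3; rewrite /node_dir; case: (boolP (interior_node p)) => pi; last first.
  by rewrite big1 => [|c _]; rewrite ?mul0r.
have indexE (c : 'I_3) : (free_index p c == i) = (p == free_node i) && (c == free_axis i).
  have [fn fa] := free_node_index c p3 pi.
  apply/eqP/andP => [<-|[/eqP -> /eqP ->]]; last exact: free_indexK.
  by rewrite fn fa.
rewrite -[iota 0 3]/(index_iota 0 3) big_mkord.
under eq_bigr => c _ do rewrite mxE eqxx inord_val indexE.
case: eqP => /= _; last by rewrite big1 => [|c _]; rewrite ?mul0r.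
rewrite (bigD1 (free_axis i))//= eqxx mul1r big1 ?addr0.
  by rewrite /free_axis inordK// ltn_mod.
by move=> c /negbTE ->; rewrite mul0r.
Qed.

Lemma jacobian_ref_entry (i : 'I_81) (e : 'I_48) :
  (delta_mx 0 i *m 'J (@gI R) X : 'rV_48) 0 e =
  720%:R^-1 * ref_scale^-1 ^+ 2 * int_scalar (nth Z0 (jacobian_column_z e) i).
Proof.
apply: etrans (jacobian_gI X _ e) _.
rewrite -mulrA; congr (_ * _).
rewrite triform1_gradient ?exact_bounded//.
rewrite (nth_map 0%N) ?size_iota// nth_iota// add0n.
rewrite -map_comp int_scalar_sum mulr_sumr !big_seq; apply: eq_bigr => k.
rewrite mem_iota => k10; have [_ p3 _] := cell_node_wf (ltn_ord e) k10.
transitivity (\sum_(c <- iota 0 3) cell_dirs (delta_mx 0 i : 'rV[R]_81) e k c *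
   (ref_scale^-1 ^+ 2 * int_scalar (zgradient exact_terms (cell_field e ref_z) k c))).
  by apply: eq_bigr => c _; rewrite gradient_ref ?exact_bounded.
rewrite node_dir_delta// /= -[free_node_nat i]/(free_node i).
case: ifP => _; last by rewrite mulr0.
have := ltn_pmod i (isT : 0 < 3)%N.
by case: (i %% 3)%N => [|[|[|]]].
Qed.

Lemma rank_jacobian_ref : \rank ('J (@gI R) X) = 47%N.
Proof.
apply/eqP; rewrite eqn_leq; apply/andP; split.
  apply: (@rank_le_ker _ _ _ _ (const_mx 1)).
    exact: const1_neq0.
  exact: (@jacobian_dependent R 34 47 (@gI R) (const_mx 1) polynomial_gI gI_total X).
pose a : R := 720%:R^-1 * ref_scale^-1 ^+ 2.
have a0 : a != 0.
  by rewrite /a mulf_neq0 ?invr_eq0 ?expf_neq0 ?invr_eq0 ?pnatr_eq0 /ref_scale ?expf_neq0.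
have -> : 'J (@gI R) X = a *: map_mx intr jacobian_z.
  apply: mx_delta_rows => i j; apply: etrans (jacobian_ref_entry i j) _.
  by rewrite [RHS]mxE [map_mx _ _ _ _]mxE [jacobian_z _ _]mxE.
by rewrite (eqmx_scale _ a0) rank_jacobian_z.
Qed.

End ReferenceRank.

(** * Four-point volumes along the witness *)

(** The coefficient matrices are interpolated from the values at 0, 1 and -1, so
    that their action on every row vector is known from that of J. *)
Lemma quadratic_pencil (R : realType) n m (J : R -> 'M[R]_(n, m))
    (a b c : 'rV[R]_n -> 'I_m -> R) :
  (forall h t j, (h *m J t) 0 j = a h j + t * b h j + t ^+ 2 * c h j) ->
  exists B1 B2, (forall t, J t = J 0 + t *: B1 + t ^+ 2 *: B2) /\
    (forall h j, (h *m B1) 0 j = b h j).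
Proof.
move=> JE; exists (2^-1 *: (J 1 - J (-1))), (2^-1 *: (J 1 + J (-1)) - J 0).
pose phi (h : 'rV[R]_n) j (A : 'M[R]_(n, m)) : R := (h *m A) 0 j.
have phiD h j A A' : phi h j (A + A') = phi h j A + phi h j A'.
  by rewrite /phi mulmxDr mxE.
have phiZ h j r A : phi h j (r *: A) = r * phi h j A.
  by rewrite /phi -scalemxAr mxE.
have phiN h j A : phi h j (- A) = - phi h j A.
  by rewrite /phi mulmxN mxE.
have phiJ h j t : phi h j (J t) = a h j + t * b h j + t ^+ 2 * c h j := JE h t j.
split=> [t|h j].
  apply: mulmx_row_inj => h j; rewrite -/(phi h j _) -/(phi h j _).
  rewrite !(phiD, phiZ, phiN, phiJ); by field.
rewrite -/(phi h j _) !(phiD, phiZ, phiN, phiJ); by field.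
Qed.

Section WitnessPencil.
Context {R : realType}.
Implicit Types (y h v : 'rV[R]_81) (e : nat).
Local Notation X := (@ref_config R).
Local Notation z := (@witness R).

(** The polarization of triform1 in its first argument. *)
Definition mixed (s : seq (@term nat)) (u w d : nat -> nat -> R) : R :=
  triform s d u w + triform s d w u + triform s u d w + triform s w d u
  + triform s u w d + triform s w u d.

Lemma triform1_line s (u w d : nat -> nat -> R) t :
  triform1 s (fun k c => u k c + t * w k c) d =
  triform1 s u d + t * mixed s u w d + t ^+ 2 * triform1 s w d.
Proof.
rewrite /triform1 /mixed /triform -!big_split /= !mulr_sumr -!big_split /=.
by apply: eq_bigr => -[c [[i j] k]] _ /=; rewrite /det3; ring.
Qed.

Lemma mixed_diag s (u w : nat -> nat -> R) : mixed s u w w = 2 * triform2 s u w.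
Proof. by rewrite /mixed /triform2; ring. Qed.

Lemma jacobian_gQ_line h t (e : 'I_48) :
  let u := cell_values X e in let w := cell_dirs z e in let d := cell_dirs h e in
  (h *m 'J gQ (X + t *: z)) 0 e =
  720%:R^-1 * triform1 exact_terms u d
  + t * (720%:R^-1 * mixed exact_terms u w d + defect_factor * mixed defect_terms u w d)
  + t ^+ 2 * (720%:R^-1 * triform1 exact_terms w d
              + defect_factor * triform1 defect_terms w d).
Proof.
move=> u w d; apply: etrans (jacobian_gQ _ _ _) _.
rewrite cell_values_line -/u -/w -/d !triform1_line.
rewrite (_ : triform1 defect_terms u d = 0); last exact: defect_stationary.
move: (720%:R^-1 : R) defect_factor => r f.
move: (triform1 exact_terms u d) (triform1 exact_terms w d) (triform1 defect_terms w d)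
  (mixed exact_terms u w d) (mixed defect_terms u w d) => a b c m m'.
by ring.
Qed.

(** Summing z B1 over the cells gives twice the second order part of the total of
    gQ in the direction z, to which only the defects contribute. *)
Lemma witness_pencil : exists B1 B2 : 'M[R]_(81, 48),
  (forall t, 'J (@gQ R) (X + t *: z) = 'J (@gI R) X + t *: B1 + t ^+ 2 *: B2) /\
  (z *m B1 *m (const_mx 1 : 'cV_48)) 0 0 != 0.
Proof.
have [B1 [B2 [JE B1E]]] := quadratic_pencil jacobian_gQ_line.
exists B1, B2; split=> [t|].
  by rewrite JE scale0r addr0 jacobian_ref.
rewrite mxE.
have -> : \sum_j (z *m B1) 0 j * (const_mx 1 : 'cV_48) j 0 =
    720%:R^-1 * (2 * \sum_(e < 48) triform2 exact_terms (cell_values X e) (cell_dirs z e))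
  + defect_factor * (2 * \sum_(e < 48) triform2 defect_terms (cell_values X e) (cell_dirs z e)).
  rewrite !mulr_sumr -big_split /=; apply: eq_bigr => e _.
  by rewrite B1E !mixed_diag [const_mx _ _ _]mxE mulr1.
have [-> d0] := @witness_second_order R; rewrite !mulr0 add0r.
apply: mulf_neq0; first by rewrite gt_eqF// defect_factor_gt0.
by apply: mulf_neq0; rewrite ?pnatr_eq0.
Qed.

(** In the total the exact parts cancel, and the defects have no first order
    part. *)
Lemma quadratic_total_defect :
  let S2 v := \sum_(e < 48) triform2 defect_terms (cell_values X e) (cell_dirs v e) in
  let S3 v := \sum_(e < 48) triform defect_terms (cell_dirs v e) (cell_dirs v e) (cell_dirs v e) in
  forall v t, (gQ (X + t *: v) *m (const_mx 1 : 'cV_48)) 0 0 =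
    defect_factor * (t ^+ 2 * S2 v + t ^+ 3 * S3 v).
Proof.
move=> S2 S3 v t; rewrite mxE.
transitivity (720%:R^-1 * (\sum_(e < 48) exact_form (X + t *: v) e - \sum_(e < 48) exact_form X e)
   + defect_factor * (t ^+ 2 * S2 v + t ^+ 3 * S3 v)); last first.
  by rewrite (total_exact_form (X + t *: v) X) subrr mulr0 add0r.
rewrite -sumrB !mulr_sumr -!big_split /= mulr_sumr -big_split /=; apply: eq_bigr => e _.
rewrite [const_mx _ _ _]mxE mulr1 [LHS]mxE !volQ_form defect_form_line.
rewrite (defect_stationary _ (ltn_ord e)).
move: (720%:R^-1 : R) defect_factor => r f.
move: (exact_form _ e) (exact_form X e) (defect_form X e) (triform2 _ _ _)
  (triform _ _ _ _) => a b c d g; ring.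
Qed.

Lemma polynomial_cell_dirs e k c : polynomial_fun (fun v => cell_dirs v e k c).
Proof.
rewrite /cell_dirs /node_dir; case: (interior_node _); last exact: ring_closure_cst.
exact: polynomial_fun_coord.
Qed.

(** Dividing the vanishing total at X + t v by t^2 leaves S2 v + t * S3 v = 0; let
    t tend to 0 and v to z. *)
Lemma witness_not_tangent : ~ tangent_cone [set y | gQ y = 0] X z.
Proof.
move=> [u [t [uQ t0 tcv ucv]]].
have := quadratic_total_defect; set S2 := fun v => _; set S3 := fun v => _ => gS.
pose v j := (t j)^-1 *: (u j - X).
have vS j : S2 (v j) + t j * S3 (v j) = 0.
  have uE : u j = X + t j *: v j.
    by rewrite /v scalerA mulfV ?gt_eqF// scale1r addrC subrK.
  have := gS (v j) (t j); rewrite -uE (uQ j) mul0mx mxE => /esym/eqP.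
  rewrite (_ : t j ^+ 2 * _ + _ = t j ^+ 2 * (S2 (v j) + t j * S3 (v j))); last first.
    by move: (S2 (v j)) (S3 (v j)) => a b; ring.
  have d0 : defect_factor != 0 :> R by rewrite gt_eqF// defect_factor_gt0.
  have tj0 : t j != 0 by rewrite gt_eqF.
  by rewrite mulf_eq0 (negbTE d0) mulf_eq0 expf_eq0 (negbTE tj0) /= => /eqP.
have cX e k c : polynomial_fun (fun _ : 'rV[R]_81 => cell_values X e k c).
  exact: ring_closure_cst.
have S2c : (S2 \o v) @ \oo --> S2 z.
  apply: continuous_cvg; last exact: ucv.
  apply: polynomial_fun_continuous; apply: ring_closure_sum => e _.
  by apply: ring_closureD; [apply: ring_closureD|]; apply: polynomial_triform => //;
    exact: polynomial_cell_dirs.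
have S3c : (S3 \o v) @ \oo --> S3 z.
  apply: continuous_cvg; last exact: ucv.
  apply: polynomial_fun_continuous; apply: ring_closure_sum => e _.
  by apply: polynomial_triform; exact: polynomial_cell_dirs.
have : (fun j => S2 (v j) + t j * S3 (v j)) @ \oo --> S2 z + 0 * S3 z.
  by apply: cvgD => //; exact: cvgM.
rewrite mul0r addr0 (_ : (fun _ => _) = fun=> 0); last exact/funext.
move=> c0; have [_ /eqP[]] := @witness_second_order R.
apply/esym; apply: (cvg_unique _ (cvg_cst 0) c0) => //.
Qed.

End WitnessPencil.

(** * The theorem *)

Theorem theorem18 (R : realType) :
  let X : 'rV[R]_81 := ref_config in
  let z : 'rV[R]_81 := witness in
  let B : 'M[R]_(81, 48) := 'J (@gQ R) X in
  let feasQ : set 'rV[R]_81 := [set y | gQ y = 0] in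
  let feasI : set 'rV[R]_81 := [set y | gI y = 0] in
  [/\ z *m B = 0 /\ ~ tangent_cone feasQ X z,
      (\forall t \near (0 : R)^', \rank ('J (@gQ R) (X + t *: z)) = 48%N) /\
      (fun t : R => smallest_singular_value ('J (@gQ R) (X + t *: z)))
        \is 'Theta_((0 : R)^') (fun t : R => `|t|),
      (\forall y \near X, \rank ('J (@gI R) y) = 47%N),
      (exists U : set 'rV[R]_81,
         [/\ open U, U X & smooth_submanifold 34 (feasI `&` U)]) &
      (forall v : 'rV[R]_81, v *m B = 0 -> tangent_to_smooth_curve feasI X v) /\
      tangent_to_smooth_curve feasI X z].
Proof.
move=> X z B feasQ feasI.
have BE : B = 'J (@gI R) X := @jacobian_ref R.
have zB : z *m B = 0 by rewrite BE; exact: witness_kernel.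
have rI : \rank ('J (@gI R) X) = 47%N := @rank_jacobian_ref R.
have pI := @polynomial_gI R.
have l0 := const1_neq0 R.
have lI := @gI_total R.
have IX : gI X = 0 by apply/rowP => e; rewrite !mxE subrr.
have tang v : v *m B = 0 -> tangent_to_smooth_curve feasI X v.
  rewrite BE => vB.
  (* 81 = 34 + 47 and 48 = 47 + 1 hold by computation. *)
  exact: (@level_set_tangent R 34 47 (@gI R) (const_mx 1) pI l0 lI X rI v IX vB).
have [B1 [B2 [JE zB1l]]] := @witness_pencil R.
have Bl : 'J (@gI R) X *m (const_mx 1 : 'cV_48) = 0.
  exact: (@jacobian_dependent R 34 47 (@gI R) (const_mx 1) pI lI X).
have zBI : z *m 'J (@gI R) X = 0 by rewrite -BE.
split; [split|split| | |split].
- exact: zB.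
- exact: witness_not_tangent.
- have := @pencil_rank R 81 47 _ B1 B2 z _ zBI Bl rI zB1l.
  by apply: filterS => t; rewrite /pencil -JE.
- rewrite (_ : (fun t : R => _) = fun t : R =>
    smallest_singular_value (pencil ('J (@gI R) X) B1 B2 t)); last first.
    by apply/funext => t; rewrite JE.
  exact: (@pencil_smallest_singular_value R 81 47 _ B1 B2 z _ zBI Bl rI zB1l isT).
- exact: (@jacobian_rank_near R 34 47 (@gI R) (const_mx 1) pI l0 lI X rI).
- exact: (@level_set_submanifold R 34 47 (@gI R) (const_mx 1) pI l0 lI X rI).
- exact: tang.
- exact: tang.
Qed.
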